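(* Let $n,\delta$ be positive integers. For a binary stream (a sequence of elements from $\{0,1\}$ arriving one at a time), there exists a data structure that uses $\lceil n/\delta\rceil+O(\lg n)+o(n/\delta)$ bits and supports ${\textsf{ssA}}$ and ${\textsf{issA}}$ queries on the stream with additive error $\delta$ in constant time. Also, the structure supports updates (appending a new element to the stream) in constant time.
   Context: Model: word-RAM with word size $\Theta(\lg n)$. For $1\le i\le n$, ${\textsf{ss}}(i,n)$ is the sum of the last $i$ elements of the stream, and ${\textsf{iss}}(i,n)$ is the smallest $j$, $1\le j\le n$, with ${\textsf{ss}}(j,n)\ge i$. ${\textsf{ssA}}(i,n,\delta)$ returns any value $r$ with ${\textsf{ss}}(i,n)-\delta<r\le{\textsf{ss}}(i,n)$; ${\textsf{issA}}(i,n,\delta)$ returns any value $r$ with ${\textsf{iss}}(i-\delta,n)<r\le{\textsf{iss}}(i,n)$. *)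

(* Defs.v *)
From mathcomp Require Import all_boot all_order all_algebra.

Set Implicit Arguments.
Unset Strict Implicit.
Unset Printing Implicit Defensive.

(* Streams are listed in order of arrival: appending [b] to [s] gives
   [rcons s b]. *)
Definition stream := seq bool.

(* When fewer than [i] elements have arrived, [drop] keeps all of them. *)
Definition ss (s : stream) (i : nat) : nat :=
  \sum_(b <- drop (size s - i) s) b.

(* The argument is an integer because the specification of issA uses
   iss(i - delta, n).  The convention iss(i, n) = 0 for i <= 0 is needed there:
   the literal minimum over 1 <= j <= n would be 1, and no r would satisfy
   1 < r <= iss(i, n) when i <= delta and iss(i, n) = 1.
   If no j in [1, n] qualifies the value is n + 1. *)
Definition iss (n : nat) (s : stream) (i : int) : nat :=
  if (i <= 0)%R then 0
  else (find (fun j => (i <= (ss s j)%:Z)%R) (iota 1 n)).+1.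

Definition ssA_answer (d : nat) (s : stream) (i r : nat) : Prop :=
  ((ss s i)%:Z - d%:Z < r%:Z <= (ss s i)%:Z)%R.

Definition issA_answer (n d : nat) (s : stream) (i r : nat) : Prop :=
  iss n s (i%:Z - d%:Z)%R < r <= iss n s i%:Z.

(* Word RAM with word size w.  Words are naturals below 2 ^ w and a machine
   state is a finite array of words.  There are no registers, so input, output
   and working space are all part of that array; a memory [M] occupies
   [size M * w] bits.  Reading or writing outside the array is an error. *)
Definition memory := seq nat.

Definition wf_memory (w : nat) (M : memory) : bool :=
  all (fun x => x < 2 ^ w) M.

Inductive binop :=
  | Add | Sub | Mul | Div | Mod | And | Or | Xor | Shl | Shr | Lt | Eq.

Definition eval_op (w : nat) (o : binop) (x y : nat) : nat :=
  match o with
  | Add => (x + y) %% 2 ^ w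
  | Sub => (x + (2 ^ w - y)) %% 2 ^ w
  | Mul => (x * y) %% 2 ^ w
  | Div => x %/ y
  | Mod => x %% y
  | And => Nat.land x y
  | Or => Nat.lor x y
  | Xor => Nat.lxor x y
  | Shl => (x * 2 ^ y) %% 2 ^ w
  | Shr => x %/ 2 ^ y
  | Lt => (x < y : nat)
  | Eq => (x == y : nat)
  end.

Inductive expr :=
  | Const (k : nat)
  | Read (addr : expr)
  | Op (o : binop) (e1 e2 : expr).

Fixpoint eval (w : nat) (M : memory) (e : expr) : option nat :=
  match e with
  | Const k => Some (k %% 2 ^ w)
  | Read a =>
      if eval w M a is Some x then
        if x < size M then Some (nth 0 M x) else None
      else None
  | Op o e1 e2 =>
      match eval w M e1, eval w M e2 with
      | Some x, Some y => Some (eval_op w o x y)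
      | _, _ => None
      end
  end.

(* One time unit per constant, memory access and operation. *)
Fixpoint expr_time (e : expr) : nat :=
  match e with
  | Const _ => 1
  | Read a => (expr_time a).+1
  | Op _ e1 e2 => (expr_time e1 + expr_time e2).+1
  end.

Inductive cmd :=
  | Skip
  | Write (addr e : expr)
  | Seq (c1 c2 : cmd)
  | If (e : expr) (c1 c2 : cmd)
  | While (e : expr) (c : cmd).

(* [exec w c M M' t]: on word size w, started in memory M, the program c halts
   without error after t time units in memory M'. *)
Inductive exec (w : nat) : cmd -> memory -> memory -> nat -> Prop :=
  | exec_Skip M : exec w Skip M M 1
  | exec_Write a e M x v :
      eval w M a = Some x -> eval w M e = Some v -> x < size M ->
      exec w (Write a e) M (set_nth 0 M x v) (expr_time a + expr_time e).+1
  | exec_Seq c1 c2 M M1 M2 t1 t2 :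
      exec w c1 M M1 t1 -> exec w c2 M1 M2 t2 ->
      exec w (Seq c1 c2) M M2 (t1 + t2)
  | exec_If_true e c1 c2 M M' v t :
      eval w M e = Some v -> v != 0 -> exec w c1 M M' t ->
      exec w (If e c1 c2) M M' (expr_time e + t).+1
  | exec_If_false e c1 c2 M M' t :
      eval w M e = Some 0 -> exec w c2 M M' t ->
      exec w (If e c1 c2) M M' (expr_time e + t).+1
  | exec_While_true e c M M1 M2 v t1 t2 :
      eval w M e = Some v -> v != 0 ->
      exec w c M M1 t1 -> exec w (While e c) M1 M2 t2 ->
      exec w (While e c) M M2 (expr_time e + t1 + t2).+1
  | exec_While_false e c M :
      eval w M e = Some 0 -> exec w (While e c) M M (expr_time e).+1.

(* The argument of an operation is placed in cell 0 before the run, and the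
   result is read from cell 0 afterwards.  The rest of the memory persists
   from one operation to the next. *)
Definition call (w : nat) (p : cmd) (T : nat) (M : memory) (x : nat)
    (M' : memory) (r : nat) : Prop :=
  exists t, [/\ t <= T, exec w p (set_nth 0 M 0 x) M' t & r = nth 0 M' 0].

(* [Rep M s] reads "memory M is a valid representation of the stream s".  Since
   every operation, queries included, may modify the memory, each one must
   re-establish [Rep].  The query issA(i, n, d) is posed when iss(i, n) is
   defined, i.e. when the last n elements contain at least i ones. *)
Definition supports_operations (w n d T : nat) (update ssA issA : cmd)
    (Rep : memory -> stream -> Prop) : Prop :=
  forall M s, Rep M s ->
  [/\ forall b : bool, exists M' r,
        call w update T M b M' r /\ Rep M' (rcons s b),
      forall i, 1 <= i <= n -> exists M' r,
        [/\ call w ssA T M i M' r, Rep M' s & ssA_answer d s i r]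
    & forall i, 1 <= i <= ss s n -> exists M' r,
        [/\ call w issA T M i M' r, Rep M' s & issA_answer n d s i r]].

(* floor(lg n) + 1, the length of n in binary; it is positive at n = 1, so
   multiples of it also cover additive constants there. *)
Definition bitlen (n : nat) : nat := (trunc_log 2 n).+1.

Definition ceil_div (n d : nat) : nat := (n + d.-1) %/ d.

(* f(x) = o(x) as x tends to infinity. *)
Definition sublinear (f : nat -> nat) : Prop :=
  forall k, exists N, forall x, N <= x -> k * f x <= x.

(* Main.v *)
(* Cut the stream into chunks of d elements and let P(x) be the number of ones
   among its first x elements.  Only the bit c_k = P((k+1)d)/d - P(kd)/d (floor
   divisions) is kept for the chunk k, hence about n/d bits for a window.  If q
   is the number of ones among c_0, ..., c_(k-1), then P(kd + a) lies in
   [qd + c_k a, qd + c_k a + d - 1], which is exactly the accuracy asked for: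
   ssA reduces to counting and issA to selecting among the last chunk bits.

   These bits form a circular array, cut into blocks of polylogarithmic size.
   A block is a tree of height three: its leaves are short bit strings, a node
   is one word with the prefix counts of its children, and multiplications,
   masks and remainders give constant time search in a word, without tables.
   For each block the number of ones before it is stored.  Selection has to
   find the block of a given one.  The ones are put into groups of G; a group
   inside one block stores that block, while a group that meets several blocks
   owns a row of G explicit positions in a log.  Each such group uses up a block
   boundary, so that few rows are alive in the window.  The row is written
   before it is known to be needed, which keeps updates constant time. *)
Require Import Defs.
From mathcomp Require Import all_boot all_order all_algebra.
From mathcomp Require Import zify ring.
From Stdlib Require PeanoNat.

Set Implicit Arguments.
Unset Strict Implicit.
Unset Printing Implicit Defensive.

(** * Words as vectors of fields *)

(** The sizes come from the rule that an auxiliary word must be paid for by many window bits. Let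
    [a] be about the tenth root of [w], so [a ^ 10 <= w < 1024 * a ^ 10]; one word per [a ^ 11] bits
    then costs [O(N / a)] bits in all. A node has [a ^ 9] fields of [a] bits. Leaves have [a ^ 4]
    bits, because a leaf spread over fields takes about [a ^ 8] bits and the product of two such
    vectors must fit in a word. Nodes thus cover [a ^ 13] and [a ^ 22] bits. Groups of [a ^ 11] ones
    balance the directory: about [N / a ^ 11] entries, and about [N / a ^ 22] rows of [a ^ 11]
    cells. The stream is unbounded, so no count of ones fits in memory; counters are kept modulo a
    multiple of [G] above [N], and only differences are used. The array is overwritten in place, so
    the block under the head can hold bits of two turns. A range that starts in an old block is
    therefore measured from the end of that block, where the bits are still the old ones. *)

Lemma divn_div x y : x %/ y = Nat.div x y.
Proof.
case: y => [|y]; first by rewrite divn0.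
apply: (PeanoNat.Nat.div_unique x y.+1 _ (x %% y.+1)).
  by have := ltn_pmod x (ltn0Sn y); lia.
by have := divn_eq x y.+1; lia.
Qed.

Lemma modn_modulo x y : x %% y = Nat.modulo x y.
Proof.
case: y => [|y]; first by rewrite modn0.
apply: (PeanoNat.Nat.mod_unique x y.+1 (x %/ y.+1)).
  by have := ltn_pmod x (ltn0Sn y); lia.
by have := divn_eq x y.+1; lia.
Qed.

Lemma expn_pow x y : x ^ y = Nat.pow x y.
Proof. by elim: y => [|y IH] //; rewrite expnS IH. Qed.

Lemma modn_land x z : x %% 2 ^ z = Nat.land x (PeanoNat.Nat.ones z).
Proof. by rewrite modn_modulo expn_pow PeanoNat.Nat.land_ones. Qed.

Lemma divn_shiftr x z : x %/ 2 ^ z = PeanoNat.Nat.shiftr x z.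
Proof. by rewrite divn_div expn_pow PeanoNat.Nat.shiftr_div_pow2. Qed.

Lemma land_split z x y :
  Nat.land x y = Nat.land (x %% 2 ^ z) (y %% 2 ^ z)
                 + 2 ^ z * Nat.land (x %/ 2 ^ z) (y %/ 2 ^ z).
Proof.
rewrite [LHS](divn_eq _ (2 ^ z)) addnC mulnC; congr (_ + _ * _).
  rewrite !modn_land -!PeanoNat.Nat.land_assoc; congr Nat.land.
  by rewrite (PeanoNat.Nat.land_comm (PeanoNat.Nat.ones z)) -PeanoNat.Nat.land_assoc PeanoNat.Nat.land_diag.
by rewrite !divn_shiftr PeanoNat.Nat.shiftr_land.
Qed.

Lemma land1 x : Nat.land x 1 = x %% 2.
Proof. exact: (esym (modn_land x 1)). Qed.

Definition fsum (z F : nat) (a : nat -> nat) : nat :=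
  \sum_(j < F) a j * 2 ^ (z * j).

Lemma eq_fsum z F a a' :
  (forall j, j < F -> a j = a' j) -> fsum z F a = fsum z F a'.
Proof. by move=> E; apply: eq_bigr => j _; rewrite E. Qed.

Lemma fsum_cat z m n a :
  fsum z (m + n) a = fsum z m a + 2 ^ (z * m) * fsum z n (fun j => a (m + j)).
Proof.
rewrite /fsum big_split_ord /=; congr (_ + _).
rewrite big_distrr /=; apply: eq_bigr => j _.
by rewrite /rshift /= mulnDr expnD mulnCA.
Qed.

Lemma fsum1 z a : fsum z 1 a = a 0.
Proof. by rewrite /fsum big_ord1 muln0 muln1. Qed.

Lemma fsumSl z F a : fsum z F.+1 a = a 0 + 2 ^ z * fsum z F (fun j => a j.+1).
Proof. by rewrite -add1n fsum_cat fsum1 muln1. Qed.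

Lemma fsumSr z F a : fsum z F.+1 a = fsum z F a + a F * 2 ^ (z * F).
Proof. by rewrite -addn1 fsum_cat fsum1 addn0 mulnC. Qed.

Lemma fsum_lt z F a :
  (forall j, j < F -> a j < 2 ^ z) -> fsum z F a < 2 ^ (z * F).
Proof.
elim: F => [|F IH] Ha; first by rewrite /fsum big_ord0 muln0.
rewrite fsumSr mulnS expnD.
have := IH (fun j Hj => Ha j (ltnW Hj)); have := Ha F (ltnSn F).
by nia.
Qed.

Lemma fsum_field z F a i :
  (forall j, j < F -> a j < 2 ^ z) -> i < F ->
  (fsum z F a %/ 2 ^ (z * i)) %% 2 ^ z = a i.
Proof.
move=> Ha Hi; have -> : F = i + (F - i.+1).+1 by lia.
rewrite fsum_cat fsumSl addn0 addnC mulnC divnMDl ?expn_gt0 //.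
rewrite [X in _ + X]divn_small; last by apply: fsum_lt => j Hj; apply: Ha; lia.
by rewrite addn0 addnC mulnC modnMDl modn_small // Ha.
Qed.

Lemma fsum_low z F l a :
  l <= F -> (forall j, j < l -> a j < 2 ^ z) ->
  fsum z F a %% 2 ^ (z * l) = fsum z l a.
Proof.
move=> /subnKC <- Ha; rewrite fsum_cat addnC mulnC modnMDl modn_small //.
exact: fsum_lt.
Qed.

Lemma fsumD z F a a' :
  fsum z F a + fsum z F a' = fsum z F (fun j => a j + a' j).
Proof. by rewrite /fsum -big_split /=; apply: eq_bigr => j _; rewrite mulnDl. Qed.

Lemma fsumM z F a r : r * fsum z F a = fsum z F (fun j => r * a j).
Proof. by rewrite /fsum big_distrr /=; apply: eq_bigr => j _; rewrite mulnA. Qed.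

(* Since 2 ^ z = 1 modulo 2 ^ z - 1, a remainder adds up all the fields. *)
Lemma fsum_mod z F (a : nat -> nat) :
  \sum_(j < F) a j < 2 ^ z - 1 -> fsum z F a %% (2 ^ z - 1) = \sum_(j < F) a j.
Proof.
move=> H; rewrite -[RHS](modn_small H) /fsum.
elim: F {H} => [|F IH]; first by rewrite !big_ord0.
rewrite !big_ord_recr /= -modnDm IH modnDm -[LHS]modnDmr -[RHS]modnDmr.
congr ((_ + _) %% _); rewrite -[in RHS](muln1 (a F)) -[LHS]modnMmr -[RHS]modnMmr.
congr ((_ * _) %% _); rewrite expnM.
(* If [2 ^ z = 1] the modulus is 0, a remainder by 0 is the number itself, and both powers are 1
   anyway. *)
have [z0|z0] := posnP (2 ^ z - 1); first by have -> : 2 ^ z = 1 by [have := expn_gt0 2 z; lia]; rewrite exp1n.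
have E : 2 ^ z = 1 %[mod 2 ^ z - 1].
  have H : 0 < 2 ^ z by rewrite expn_gt0.
  by rewrite -{1}(subnK H) modnDl.
by rewrite -modnXm E modnXm exp1n.
Qed.

(** * Comparing, spreading and summing all fields of a word at once *)

Definition ones (z F : nat) : nat := fsum z F (fun => 1).

(** Induction peels off the lowest field with [land_split]. The mask turns packed comparison results
    into fields 0 or 1, which one remainder then adds up. *)
Lemma land_ones z F x : 0 < z ->
  Nat.land x (ones z F) = fsum z F (fun j => (x %/ 2 ^ (z * j)) %% 2).
Proof.
move=> Hz; elim: F x => [|F IH] x.
  by rewrite /ones /fsum !big_ord0 PeanoNat.Nat.land_0_r.
have z1 : 1 < 2 ^ z by rewrite -{1}(expn0 2) ltn_exp2l.
have E : ones z F.+1 = ones z F * 2 ^ z + 1 by rewrite /ones fsumSl addnC mulnC.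
rewrite (land_split z) E modnMDl (modn_small z1) divnMDl ?expn_gt0 // (divn_small z1) addn0.
rewrite fsumSl muln0 expn0 divn1.
rewrite IH land1 modn_dvdm; last by rewrite dvdn_exp.
congr (_ + _ * _); apply: eq_fsum => j _.
by rewrite mulnS expnD divnMA.
Qed.

Lemma sum_nat_le (F : nat) (p : nat -> bool) : \sum_(j < F) p j <= F.
Proof.
apply: (@leq_trans (\sum_(j < F) 1)); last by rewrite sum1_card card_ord.
by apply: leq_sum => j _; exact: leq_b1.
Qed.

(* The top bit of field [j] of (r + 2 ^ (z - 1)) * ones - X is set iff field [j]
   of [X] is at most [r]; no borrow crosses a field. *)
Lemma fsum_count_le z F r (a : nat -> nat) :
  0 < z -> F < 2 ^ z - 1 -> r < 2 ^ z.-1 ->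
  (forall j, j < F -> a j < 2 ^ z.-1) ->
  Nat.land (((r + 2 ^ z.-1) * ones z F - fsum z F a) %/ 2 ^ z.-1) (ones z F)
    %% (2 ^ z - 1) = \sum_(j < F) (a j <= r).
Proof.
move=> Hz HF Hr Ha; have z2 : 2 ^ z = 2 ^ z.-1 + 2 ^ z.-1.
  by rewrite -[in LHS](prednK Hz) expnS; lia.
have -> : (r + 2 ^ z.-1) * ones z F - fsum z F a =
          fsum z F (fun j => r + 2 ^ z.-1 - a j).
  have : (r + 2 ^ z.-1) * ones z F = fsum z F a + fsum z F (fun j => r + 2 ^ z.-1 - a j).
    by rewrite fsumM fsumD; apply: eq_fsum => j /Ha; lia.
  by move=> ->; rewrite addKn.
(* The fields above contribute [D * 2 ^ z], which is still even after the shift by [z - 1], so they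
   do not affect the parity being read. *)
have top_bit D f : (D * 2 ^ z + f) %/ 2 ^ z.-1 %% 2 = f %/ 2 ^ z.-1 %% 2.
  rewrite z2 addnn -mul2n mulnA divnMDl ?expn_gt0 //.
  by rewrite -modnDm modnMl add0n modn_mod.
rewrite land_ones //.
under eq_fsum => j Hj.
  have -> : fsum z F (fun j0 => r + 2 ^ z.-1 - a j0) %/ 2 ^ z.-1 %/ 2 ^ (z * j) %% 2 = (a j <= r).
    rewrite -divnMA mulnC divnMA.
    rewrite (divn_eq (_ %/ 2 ^ (z * j)) (2 ^ z)) fsum_field //; last first.
      by move=> i /Ha; lia.
    rewrite top_bit.
    have Hj' := Ha j Hj; case: leqP => Hle /=.
      have -> : r + 2 ^ z.-1 - a j = 1 * 2 ^ z.-1 + (r - a j) by lia.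
      by rewrite divnMDl ?expn_gt0 // divn_small ?addn0 //; lia.
    by rewrite divn_small //; lia.
  over.
rewrite fsum_mod //.
by apply: leq_ltn_trans HF; exact: (sum_nat_le F (fun j => a j <= r)).
Qed.

(* [b.+1 * j = b * j + j]: among copies of [y] spaced by [b], bit [j] of copy
   [j] sits at the bottom of field [j] of width [b + 1]. *)
Lemma land_spread b (B : nat -> bool) :
  0 < b ->
  Nat.land (fsum 1 b B * ones b b) (ones b.+1 b) = fsum b.+1 b B.
Proof.
move=> Hb; rewrite land_ones //; apply: eq_fsum => j Hj.
rewrite mulSn addnC expnD divnMA.
have y_lt : fsum 1 b B < 2 ^ b.
  by rewrite -{2}(mul1n b); apply: fsum_lt => i _; case: (B i).
have Hf := @fsum_field b b (fun => fsum 1 b B) j (fun _ _ => y_lt) Hj.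
rewrite /ones fsumM (@eq_fsum b b _ (fun => fsum 1 b B)); last by move=> i _; rewrite muln1.
rewrite (divn_eq (_ %/ 2 ^ (b * j)) (2 ^ b)) Hf.
have -> : 2 ^ b = 2 ^ (b - j) * 2 ^ j by rewrite -expnD subnK // ltnW.
rewrite mulnA divnMDl ?expn_gt0 //.
have -> : b - j = (b - j.+1).+1 by lia.
rewrite expnS mulnCA mulnC modnMDl.
rewrite -[RHS](@fsum_field 1 b B j _ Hj) ?mul1n // => i _; by case: (B i).
Qed.

(** Multiplying by [ones z F] adds copies shifted by whole fields, so field [j] receives fields 0 to
    [j]. The hypothesis rules out carries, and the modulus cuts off the fields from [F] on. *)
Lemma fsum_prefix z F (a : nat -> nat) :
  (forall j, j < F -> \sum_(i < j.+1) a i < 2 ^ z) ->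
  fsum z F a * ones z F %% 2 ^ (z * F) = fsum z F (fun j => \sum_(i < j.+1) a i).
Proof.
move=> Hlt.
(* For the induction, [c] is the sum of the fields already peeled off at the bottom, and [R]
   collects what lies beyond the first [F] fields. *)
suff {Hlt} gen c : exists R, (c + fsum z F a) * ones z F =
    R * 2 ^ (z * F) + fsum z F (fun j => c + \sum_(i < j.+1) a i).
  by have [R E] := gen 0; rewrite add0n in E; rewrite E modnMDl modn_small // fsum_lt.
elim: F a c => [|F IH] a c.
  by exists 0; rewrite /ones /fsum !big_ord0 muln0.
have [R E] := IH (fun j => a j.+1) (c + a 0).
have J1 : 1 + 2 ^ z * ones z F = ones z F + 2 ^ (z * F).
  by have := fsumSr z F (fun => 1); rewrite fsumSl mul1n.
exists (R + fsum z F (fun j => a j.+1)).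
rewrite [ones _ F.+1]fsumSl -/(ones z F) !fsumSl /= big_ord1.
have -> : fsum z F (fun j => c + \sum_(i < j.+2) a i) =
          fsum z F (fun j => c + a 0 + \sum_(i < j.+1) a i.+1).
  by apply: eq_fsum => j _; rewrite big_ord_recl addnA.
rewrite mulnS expnD; move: E J1.
set A := fsum z F _; set S := fsum z F _; set J := ones z F.
set P := 2 ^ z; set U := 2 ^ (z * F) => E J1.
rewrite addnA mulnDl [X in _ + X = _](_ : _ = P * A * (J + U)); last by rewrite J1.
have -> : (c + a 0) * (1 + P * J) + P * A * (J + U) =
          c + a 0 + P * ((c + a 0 + A) * J) + P * A * U by ring.
by rewrite E; ring.
Qed.

(** * Counting ones in a bit vector *)

Definition cnt (B : nat -> bool) (s l : nat) : nat := \sum_(j < l) B (s + j).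

Definition bset (B : nat -> bool) (p : nat) (v : bool) : nat -> bool :=
  fun i => if i == p then v else B i.

Definition bits (B : nat -> bool) (s l : nat) : nat :=
  fsum 1 l (fun j => B (s + j)).

(** The word of a node with [F] children of [g] bits. Counts are taken before each child: field 0 is
    0, and the total of all children is absent, which is why block totals have their own region. *)
Definition prefixes (B : nat -> bool) (s g z F : nat) : nat :=
  fsum z F (fun f => cnt B s (f * g)).

Lemma cnt0 B s : cnt B s 0 = 0.
Proof. by rewrite /cnt big_ord0. Qed.

Lemma cnt_cat B s l m : cnt B s (l + m) = cnt B s l + cnt B (s + l) m.
Proof.
rewrite /cnt big_split_ord; congr (_ + _).
by apply: eq_bigr => j _; rewrite /= addnA.
Qed.

Lemma cntS B s l : cnt B s l.+1 = cnt B s l + B (s + l).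
Proof. by rewrite /cnt big_ord_recr. Qed.

Lemma cnt_le B s l : cnt B s l <= l.
Proof. exact: (sum_nat_le l (fun j => B (s + j))). Qed.

Lemma cnt_mono B s l m : l <= m -> cnt B s l <= cnt B s m.
Proof. by move=> /subnKC <-; rewrite cnt_cat leq_addr. Qed.

Lemma eq_cnt B B' s l :
  (forall j, j < l -> B (s + j) = B' (s + j)) -> cnt B s l = cnt B' s l.
Proof. by move=> E; apply: eq_bigr => j _; rewrite E. Qed.

Lemma bset_eq B p v : bset B p v p = v.
Proof. by rewrite /bset eqxx. Qed.

Lemma bset_neq B p v i : i != p -> bset B p v i = B i.
Proof. by rewrite /bset => /negPf ->. Qed.

(** Old and new bit stand on opposite sides to avoid truncated subtraction. The instance [v = false]
    also shows that the old contribution is contained in the stored value, so the programs may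
    subtract it. *)
Lemma cnt_bset B p v s l :
  cnt (bset B p v) s l + (s <= p < s + l) * B p
  = cnt B s l + (s <= p < s + l) * v.
Proof.
elim: l => [|l IH]; first by rewrite !cnt0 (_ : (s <= p < s + 0) = false); last lia.
rewrite !cntS; have [E|E] := eqVneq (s + l) p; last first.
  rewrite bset_neq // (_ : (s <= p < s + l.+1) = (s <= p < s + l)); last by lia.
  by lia.
rewrite E bset_eq (_ : (s <= p < s + l.+1) = true); last by lia.
by rewrite (_ : (s <= p < s + l) = false) in IH; lia.
Qed.

Lemma bits_lt B s l : bits B s l < 2 ^ l.
Proof.
by rewrite -{2}(mul1n l); apply: fsum_lt => j _; case: (B _).
Qed.

Lemma bits_mod B s l m : l <= m -> bits B s m %% 2 ^ l = bits B s l.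
Proof.
move=> /subnKC <-; rewrite /bits fsum_cat mul1n addnC mulnC modnMDl.
by rewrite modn_small // bits_lt.
Qed.

Lemma bits_div B s o m : o <= m -> bits B s m %/ 2 ^ o = bits B (s + o) (m - o).
Proof.
move=> Hle; rewrite -{1}(subnKC Hle) /bits fsum_cat mul1n addnC mulnC.
rewrite divnMDl ?expn_gt0 // divn_small ?addn0 ?bits_lt //.
by apply: eq_fsum => j _; rewrite addnA.
Qed.

Lemma bits_sub B s o l m :
  o + l <= m -> (bits B s m %/ 2 ^ o) %% 2 ^ l = bits B (s + o) l.
Proof. by move=> Hle; rewrite bits_div ?bits_mod //; lia. Qed.

Lemma bits1 B s : bits B s 1 = B s.
Proof. by rewrite /bits fsum1 addn0. Qed.

Lemma bits_bset B p v s l :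
  bits (bset B p v) s l + (s <= p < s + l) * B p * 2 ^ (p - s)
  = bits B s l + (s <= p < s + l) * v * 2 ^ (p - s).
Proof.
rewrite /bits; elim: l => [|l IH].
  by rewrite (_ : (s <= p < s + 0) = false) /fsum ?big_ord0 //; lia.
rewrite !fsumSr mul1n; have [E|E] := eqVneq (s + l) p; last first.
  rewrite bset_neq // (_ : (s <= p < s + l.+1) = (s <= p < s + l)); last by lia.
  by lia.
rewrite E bset_eq (_ : (s <= p < s + l.+1) = true); last by lia.
rewrite (_ : (s <= p < s + l) = false) in IH; last by lia.
by rewrite (_ : p - s = l); lia.
Qed.

Lemma prefixes_bset B p v s g z F :
  0 < g -> s <= p -> p < s + F * g ->
  prefixes (bset B p v) s g z F + B p * fsum z F (fun j => (p - s) %/ g < j)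
  = prefixes B s g z F + v * fsum z F (fun j => (p - s) %/ g < j).
Proof.
move=> Hg Hs Hp; rewrite /prefixes !fsumM !fsumD; apply: eq_fsum => j Hj.
have := cnt_bset B p v s (j * g).
have -> : (s <= p < s + j * g) = ((p - s) %/ g < j).
  by rewrite ltn_divLR //; lia.
by lia.
Qed.

(** Shifting right drops fields 0 to [i] and shifting left refills them with zeros; [maskE] computes
    the mask in this form. *)
Lemma mask_above z F i : 0 < z -> i < F ->
  fsum z F (fun j => i < j) = ones z F %/ 2 ^ (z * i.+1) * 2 ^ (z * i.+1).
Proof.
move=> Hz /subnKC <-; rewrite /ones !fsum_cat.
rewrite [X in X %/ _]addnC [X in (X + _) %/ _]mulnC divnMDl ?expn_gt0 //.
rewrite [X in _ = (_ + X) * _]divn_small ?addn0; last first.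
  by apply: fsum_lt => j _; rewrite -{1}(expn0 2) ltn_exp2l.
rewrite [X in X + _ = _]big1 ?add0n => [|j _]; last first.
  by rewrite (_ : (i < j) = false) //; have := ltn_ord j; lia.
rewrite mulnC; congr (_ * _); apply: eq_fsum => j _.
by rewrite (_ : (i < _) = true) //; lia.
Qed.

(** Two counts locate the same jump of a monotone sequence. Node words list counts before each
    child, starting with 0, and yield [i.+1]; leaves yield counts up to and including each bit,
    hence [i]. *)
Lemma search_step (a : nat -> nat) F r :
  (forall i j, i <= j -> a i <= a j) -> a 0 <= r -> r < a F ->
  let i := \sum_(j < F) (a j.+1 <= r) in
  [/\ i < F, a i <= r, r < a i.+1 & \sum_(j < F) (a j <= r) = i.+1].
Proof.
move=> mono a0 aF.
have [i [iF ai ai1]] : exists i, [/\ i < F, a i <= r & r < a i.+1].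
  elim: F aF => [|F IH] aF; first by lia.
  case: (leqP (a F) r) => Hr; first by exists F.
  by have [i [? ? ?]] := IH Hr; exists i; split=> //; lia.
have E : \sum_(j < F) (a j.+1 <= r) = i.
  rewrite -(subnKC iF) big_split_ord /= (big_ord_recr i) /=.
  rewrite (_ : (a i.+1 <= r) = false); last by lia.
  rewrite (eq_bigr (fun => 1)) => [|j _]; last first.
    by rewrite (_ : _ <= _); [|apply: leq_trans ai; apply: mono; have := ltn_ord j; lia].
  rewrite sum1_card card_ord [X in _ + X]big1 ?addn0 // => j _.
  rewrite (_ : (_ <= r) = false) //.
  by have := mono i.+1 (i.+1 + j).+1; lia.
rewrite E; split => //.
case: F iF E aF => // F iF E aF; rewrite big_ord_recl a0 add1n; congr _.+1.
rewrite -E big_ord_recr /= (_ : (a F.+1 <= r) = false) ?addn0 //; lia.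
Qed.

Lemma cnt_descend B p g F : 0 < g -> 0 < F ->
  cnt B (p %/ (g * F) * (g * F)) (p %% (g * F)) =
  cnt B (p %/ (g * F) * (g * F)) (p %/ g %% F * g)
  + cnt B (p %/ g * g) (p %% g).
Proof.
move=> Hg HF.
have E : p %% (g * F) = p %/ g %% F * g + p %% g.
  have := divn_eq p (g * F); have := divn_eq p g; have := divn_eq (p %/ g) F.
  by rewrite -divnMA; nia.
rewrite {1}E cnt_cat; congr (_ + cnt _ _ _).
have := divn_eq (p %/ g) F; rewrite -divnMA => {2}->; ring.
Qed.

Lemma cnt_search B s g F r : r < cnt B s (F * g) ->
  let i := (\sum_(j < F) (cnt B s (j * g) <= r)).-1 in
  [/\ i < F, cnt B s (i * g) <= r & r - cnt B s (i * g) < cnt B (s + i * g) g].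
Proof.
move=> Hr i; have [] := @search_step (fun j => cnt B s (j * g)) F r _ _ Hr.
- by move=> j k Hjk; apply: cnt_mono; rewrite leq_mul2r Hjk orbT.
- by rewrite cnt0.
move=> + + + E; rewrite /i E /= => H1 H2 H3; split => //.
by move: H3; rewrite mulSn addnC cnt_cat; lia.
Qed.

Lemma cnt_search1 B s b r : r < cnt B s b ->
  let i := \sum_(j < b) (cnt B s j.+1 <= r) in
  [/\ i < b, cnt B s i = r & B (s + i)].
Proof.
move=> Hr i; have [] := @search_step (cnt B s) b r _ _ Hr.
- by move=> j k; apply: cnt_mono.
- by rewrite cnt0.
rewrite -/i => H1 H2 H3 _; move: H3; rewrite cntS.
by case: (B (s + i)) => /= ?; split=> //; lia.
Qed.

(** * Chunks and window sums *)

Lemma sum_drop (s : stream) k :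
  \sum_(b <- drop k s) b = cnt (nth false s) k (size s - k).
Proof.
rewrite (big_nth false) size_drop big_mkord; apply: eq_bigr => j _.
by rewrite nth_drop.
Qed.

(* Padding with [p] zeros in front makes every window of at most [p] elements
   complete. *)
Definition padded (p : nat) (s : stream) : nat -> bool :=
  fun i => nth false (nseq p false ++ s) i.

Lemma ss_padded p s i : i <= p ->
  ss s i = cnt (padded p s) (p + size s - i) i.
Proof.
move=> Hi; rewrite /ss sum_drop.
have E k l : cnt (nth false s) k l = cnt (padded p s) (p + k) l.
  apply: eq_bigr => j _.
  by rewrite /padded nth_cat size_nseq (_ : _ < p = false) ?addKn -?addnA ?addKn //; lia.
rewrite E; case: (leqP i (size s)) => Hs.
  by congr cnt; lia.
rewrite (_ : size s - i = 0); last by lia.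
rewrite (_ : i = (i - size s) + (size s - 0)); last by lia.
rewrite cnt_cat [X in _ = X + _]big1 ?add0n => [|j _]; first by congr cnt; lia.
have Hj := ltn_ord j.
rewrite /padded nth_cat size_nseq (_ : _ < p = true); last by lia.
by rewrite nth_nseq if_same.
Qed.

(** The answer [x.+1] is right when [iss (i - d) <= x < iss i], and for this it suffices that
    [i - d <= ss x < i]. So a position with good bounds on its suffix sum is all that issA needs. *)
Lemma issA_intro n d s i x :
  0 < i -> ss s x < i -> i <= ss s x + d -> i <= ss s n ->
  issA_answer n d s i x.+1.
Proof.
move=> Hi Hx Hd Hn; have mono j k : j <= k -> ss s j <= ss s k.
  move=> Hjk; rewrite (@ss_padded k) // (@ss_padded k) //.
  have := cnt_cat (padded k s) (k + size s - k) (k - j) j; rewrite subnK // => ->.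
  by rewrite (_ : k + size s - k + (k - j) = k + size s - j) ?leq_addl //; lia.
have ss0 : ss s 0 = 0 by rewrite /ss subn0 drop_size big_nil.
have Hxn : x < n by rewrite ltnNge; apply/negP => /mono; lia.
rewrite /issA_answer; apply/andP; split.
  rewrite /iss; case: ifP => // Hpos.
  rewrite ltnS ltnNge; apply/negP => Hf.
  (* The search of [iss] starts at 1. For [x = 0] the suffix sum is 0, so [i <= d], against
     [i - d > 0] in this branch. *)
  have x1 : 0 < x by rewrite lt0n; apply/eqP => E; rewrite E ss0 in Hd; lia.
  have := @before_find _ 0 (fun j => (i%:Z - d%:Z <= (ss s j)%:Z)%R) (iota 1 n) x.-1 _.
  rewrite nth_iota; last by lia.
  rewrite add1n prednK // => /(_ _)/negP; case => //; lia.
rewrite /iss ifF; last by lia.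
rewrite ltnS leqNgt; apply/negP => Hf.
have Hhas : has (fun j => (i%:Z <= (ss s j)%:Z)%R) (iota 1 n).
  by rewrite has_find size_iota; lia.
have := nth_find 0 Hhas; rewrite nth_iota; last by lia.
move: Hf; set f := find _ _ => Hf.
by have := @mono (1 + f) x; lia.
Qed.

Section Chunks.

Variables (d K e : nat) (P : nat -> nat) (c : nat -> bool).
Hypothesis d_gt0 : 0 < d.
Hypothesis P_step : forall x y, P x <= P (x + y) <= P x + y.
Hypothesis cP : forall k, k <= K -> cnt c 0 k = P (k * d) %/ d.

Lemma chunk_start k : k <= K ->
  cnt c 0 k * d <= P (k * d) < cnt c 0 k * d + d.
Proof.
move=> Hk; rewrite cP //.
by have := divn_eq (P (k * d)) d; have := ltn_pmod (P (k * d)) d_gt0; lia.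
Qed.

(** If [c k] is 0, [P] still lies below the next multiple of [d] at the end of the chunk, hence also
    inside it. If [c k] is 1, that multiple is reached by the end, and the remaining [d - a]
    elements supply at most [d - a] ones, so [a] ones beyond [q * d] are there already. *)
Lemma chunk_range k a : k < K -> a < d ->
  cnt c 0 k * d + c k * a <= P (k * d + a) < cnt c 0 k * d + d + c k * a.
Proof.
move=> Hk Ha; have := chunk_start (ltnW Hk); have := chunk_start Hk.
have := P_step (k * d) a; have := P_step (k * d + a) (d - a).
rewrite (_ : k * d + a + (d - a) = k.+1 * d); last by lia.
rewrite cntS add0n; case: (c k) => /=; nia.
Qed.

Let t := K * d + e.
(** [u] holds the ones of the open chunk plus the remainder of [P (K * d)] modulo [d], so it may
    exceed [d]; it stays below [d + e]. *)
Let u := P t - cnt c 0 K * d.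

Lemma Pt_eq : P t = cnt c 0 K * d + u.
Proof.
have := chunk_start (leqnn K); have := P_step (K * d) e; rewrite /u /t; lia.
Qed.

(** The window starts [a] elements into chunk [K - j]. From [P t] the largest value allowed there by
    [chunk_range] is subtracted; the ones recorded before that chunk cancel, and truncation at 0
    only improves the estimate. *)
Lemma ssA_chunks i j a : e < i -> j * d = i - e + a -> a < d -> j <= K ->
  let r := cnt c (K - j) j * d + u - (d.-1 + c (K - j) * a) in
  r <= P t - P (t - i) < r + d.
Proof.
move=> Hi Hj Ha HjK.
have j_gt0 : 0 < j by case: j Hj {HjK} => // ; lia.
have Hk : K - j < K by lia.
have := chunk_range Hk Ha.
have -> : (K - j) * d + a = t - i by rewrite mulnBl /t; nia.
have E : cnt c 0 K = cnt c 0 (K - j) + cnt c (K - j) j.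
  by rewrite -{1}(subnK HjK) cnt_cat.
move: Pt_eq; rewrite E mulnDl; set q := cnt c 0 (K - j).
by set x := c (K - j) * a; lia.
Qed.

(** [m] is [(i - u - 1) / d] rounded up and [a] the excess of the rounding. Evaluated [a] elements
    into the chunk of the [m]-th last one, the bounds of [chunk_range] turn exactly into the
    interval from [i - d] to [i - 1]. *)
Lemma issA_chunks i m a k : u.+1 < i -> m * d = i - u.+1 + a -> a < d ->
  i <= P t -> k < K -> c k -> cnt c k (K - k) = m ->
  P t - P (k * d + a) < i <= P t - P (k * d + a) + d.
Proof.
move=> Hi Hm Ha HiP Hk ck Hcnt.
have := chunk_range Hk Ha; rewrite ck mul1n.
have E : cnt c 0 K = cnt c 0 k + m.
  by rewrite -{1}(subnKC (ltnW Hk)) cnt_cat Hcnt.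
move: Pt_eq; rewrite E mulnDl Hm; lia.
Qed.

(** Selection must not run out of the array. The last [N] chunks and the open one contain at least
    [i] ones, so the recorded bits, worth [d] each, account for at least [i - u] of them. *)
Lemma issA_in_window i m a n N : u.+1 < i -> m * d = i - u.+1 + a -> a < d ->
  n <= t -> i <= P t - P (t - n) -> n <= N * d -> N <= K ->
  0 < m <= cnt c (K - N) N.
Proof.
move=> Hi Hm Ha Hn HiP HnN HNK.
have m_gt0 : 0 < m by case: m Hm => //; lia.
rewrite m_gt0 /=.
have E : cnt c 0 K = cnt c 0 (K - N) + cnt c (K - N) N.
  by rewrite -{1}(subnK HNK) cnt_cat.
have := chunk_start (leq_subr N K).
have Hx : (K - N) * d <= t - n by rewrite mulnBl /t; lia.
have := P_step ((K - N) * d) (t - n - (K - N) * d).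
rewrite (subnKC Hx); move: Pt_eq; rewrite E mulnDl.
set q := cnt c 0 _; set z := cnt c _ N; set x := P ((K - N) * d).
set y := P (t - n) in HiP *; set Y := P t in HiP *; move=> *.
rewrite -ltnS -(ltn_pmul2r d_gt0); lia.
Qed.

End Chunks.

(** * Memory layout and evaluation of programs *)

(* [b] bits in a leaf, [l] leaves in a word, [F] fields of [z] bits in a node;
   groups of [G] ones; a log of [Ls] rows and [Lsz] cells. *)
Record params := Params {
  par_n : nat; par_d : nat; par_N : nat;
  par_b : nat; par_z : nat; par_F : nat; par_l : nat;
  par_G : nat; par_Ls : nat; par_Lsz : nat }.

Section Layout.

Variable p : params.

Definition par_S := par_b p * par_F p.
Definition par_L := par_S * par_F p.
Definition par_lw := par_l p * par_b p.
Definition par_M := ((par_N p).-1 %/ par_L).+1.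
(** [N + 1] consecutive ones meet at most [N %/ G + 2] groups, so groups that are alive together
    have different entries modulo this number. *)
Definition par_Hs := par_N p %/ par_G p + 2.
(** A count modulo [Z] still determines the position in a group and the group modulo [Hs], because
    [G] divides [Z]; since [Z] exceeds [N], differences up to [N] can be recovered. *)
Definition par_Z := par_Hs * par_G p.

(* Region 0: argument, constants and state; 1: the chunk bits; 2 and 3: the lower
   and upper nodes; 4: ones in each block; 5: ones before each block, modulo
   [par_Z]; 6: group entries; 7: the log. *)
Definition region_sizes : seq nat :=
  [:: 40; (par_N p %/ par_lw).+1; (par_N p %/ par_S).+1;
      par_M; par_M; par_M; par_Hs; par_Lsz p].

Definition len k := nth 0 region_sizes k.
Definition base k := \sum_(j < k) len j.

Definition header : seq nat :=
  [:: 0; par_d p; par_N p; par_L; par_S; par_b p; par_F p; par_z p;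
      ones (par_z p) (par_F p); 2 ^ par_z p; 2 ^ (par_z p).-1;
      2 ^ par_z p - 1; (par_z p).-1;
      (par_b p).+1; ones (par_b p).+1 (par_b p); ones (par_b p) (par_b p);
      2 ^ (par_b p).+1 - 1; 2 ^ par_b p; 2 ^ ((par_b p).+1 * par_b p);
      par_M; par_G p; par_Z; par_Ls p; par_Lsz p; par_lw;
      base 1; base 2; base 3; base 4; base 5; base 6; base 7].

Definition cell (M : memory) k i := nth 0 M (base k + i).
Definition upd (M : memory) k i v : memory := set_nth 0 M (base k + i) v.

Lemma baseS k : base k.+1 = base k + len k.
Proof. by rewrite /base big_ord_recr. Qed.

Lemma base_le k k' : k <= k' -> base k <= base k'.
Proof. by move/subnKC <-; elim: (k' - k) => [|m IH]; rewrite ?addn0 // addnS baseS; lia. Qed.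

Lemma cell_lt k i : k < 8 -> i < len k -> base k + i < base 8.
Proof. by move=> Hk Hi; have := @base_le k.+1 8 Hk; rewrite baseS; lia. Qed.

Lemma size_upd M k i v :
  size M = base 8 -> k < 8 -> i < len k -> size (upd M k i v) = base 8.
Proof.
by move=> HM Hk Hi; rewrite size_set_nth HM; have := cell_lt Hk Hi; lia.
Qed.

Lemma cell_upd M k i v k' i' : i < len k -> i' < len k' ->
  cell (upd M k i v) k' i' = if (k' == k) && (i' == i) then v else cell M k' i'.
Proof.
move=> Hi Hi'; rewrite /cell /upd nth_set_nth /=.
have [->|Hk] := eqVneq k' k; first by rewrite eqn_add2l.
rewrite ifF //; apply/eqP => E.
have [lt|le] := ltnP k k'; first by have := base_le lt; rewrite baseS; lia.
have lt : k' < k by rewrite ltn_neqAle Hk.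
by have := base_le lt; rewrite baseS; lia.
Qed.

End Layout.

(** These inequalities keep intermediate values inside a word; [v_Lz] reserves the top bit of each
    field for comparisons. [v_log] is restricted to several blocks because with one block no group
    ever spills into the log. *)
Record valid (w : nat) (p : params) : Prop := Valid {
  v_d : 0 < par_d p <= par_n p;
  v_N : par_N p = ceil_div (par_n p) (par_d p);
  v_b : 0 < par_b p;
  v_F : 0 < par_F p;
  v_z : 1 < par_z p;
  v_l : 0 < par_l p;
  v_lw : par_lw p <= w;
  v_zF : par_z p * par_F p <= w;
  v_Lz : par_L p < 2 ^ (par_z p).-1;
  v_bw : 2 * ((par_b p).+1 * par_b p) <= w;
  v_G : 0 < par_G p;
  v_Ls : 0 < par_Ls p;
  v_Lsz : 0 < par_Lsz p;
  v_log : 1 < par_M p ->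
          par_Ls p = par_M p + 2 /\ par_Lsz p = par_Ls p * par_G p;
  v_total : base p 8 < 2 ^ w;
  v_big : 8 * par_n p + 100 < 2 ^ w;
  v_Z : 2 * par_Z p < 2 ^ w;
  v_GL : par_Ls p * par_G p < 2 ^ w;
  v_ML : par_M p + par_Ls p < 2 ^ w }.

(** * Addressing, constants and running time of programs *)

Definition V k := Read (Const k).
(** Cell [24 + k] of the header holds the base address of region [k], for [k] from 1 to 7. *)
Definition A k e := Read (Op Add (V (24 + k)) e).
Definition WV k e := Write (Const k) e.
Definition WA k i e := Write (Op Add (V (24 + k)) i) e.

Definition e_d := V 1.
Definition e_N := V 2.
Definition e_L := V 3.
Definition e_S := V 4.
Definition e_b := V 5.
Definition e_F := V 6.
Definition e_z := V 7.
Definition e_J := V 8.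
Definition e_2z := V 9.
Definition e_H := V 10.
Definition e_mz := V 11.
Definition e_z1 := V 12.
Definition e_b1 := V 13.
Definition e_J2 := V 14.
Definition e_K2 := V 15.
Definition e_mb := V 16.
Definition e_2b := V 17.
Definition e_cut := V 18.
Definition e_M := V 19.
Definition e_G := V 20.
Definition e_Z := V 21.
Definition e_Ls := V 22.
Definition e_Lsz := V 23.
Definition e_lw := V 24.

(** A time bound read off the syntax of loop-free programs, charging both branches of a conditional.
    Constant time then follows from the three programs being fixed. *)
Fixpoint ctime (c : cmd) : nat :=
  match c with
  | Skip => 1
  | Write a e => (expr_time a + expr_time e).+1
  | Seq c1 c2 => ctime c1 + ctime c2
  | If e c1 c2 => (expr_time e + (ctime c1 + ctime c2)).+1
  | While _ _ => 0
  end.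

Definition runs w c M M' := exists t, t <= ctime c /\ exec w c M M' t.

Lemma runs_skip w M : runs w Skip M M.
Proof. by exists 1; split=> //; constructor. Qed.

Lemma runs_seq w c1 c2 M M1 M2 :
  runs w c1 M M1 -> runs w c2 M1 M2 -> runs w (Seq c1 c2) M M2.
Proof.
move=> [t1 [H1 E1]] [t2 [H2 E2]]; exists (t1 + t2); split; first by rewrite leq_add.
exact: exec_Seq E1 E2.
Qed.

Lemma runs_if w e c1 c2 M M' v : eval w M e = Some v ->
  (v != 0 -> runs w c1 M M') -> (v = 0 -> runs w c2 M M') ->
  runs w (If e c1 c2) M M'.
Proof.
move=> He H1 H2; have [v0|v0] := eqVneq v 0.
  have [t [Ht Et]] := H2 v0; exists (expr_time e + t).+1; split; first by rewrite /=; lia.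
  by apply: exec_If_false => //; rewrite He v0.
have [t [Ht Et]] := H1 v0; exists (expr_time e + t).+1; split; first by rewrite /=; lia.
exact: exec_If_true He v0 Et.
Qed.

(** * Evaluation of expressions in a well-formed memory *)

Section Eval.

Variables (w : nat) (p : params).
Hypothesis ok : valid w p.

(* Cells 1 to 31 hold the constants of the structure, and cell 0 the argument
   or the result. *)
Definition wf (M : memory) : Prop :=
  size M = base p 8 /\
  forall i, 0 < i < 32 -> cell p M 0 i = nth 0 (header p) i.

Definition ev (M : memory) e v := eval w M e = Some v.

Lemma ev_eq M e v v' : ev M e v -> v = v' -> ev M e v'.
Proof. by move=> ? <-. Qed.

Lemma ev_const M k : k < 2 ^ w -> ev M (Const k) k.
Proof. by move=> Hk; rewrite /ev /= modn_small. Qed.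

Lemma ev_op M o e1 e2 x y : ev M e1 x -> ev M e2 y ->
  ev M (Op o e1 e2) (eval_op w o x y).
Proof. by rewrite /ev /= => -> ->. Qed.

Lemma ev_add M e1 e2 x y : ev M e1 x -> ev M e2 y -> x + y < 2 ^ w ->
  ev M (Op Add e1 e2) (x + y).
Proof. by move=> H1 H2 H; rewrite -(modn_small H); apply: ev_op. Qed.

Lemma ev_mul M e1 e2 x y : ev M e1 x -> ev M e2 y -> x * y < 2 ^ w ->
  ev M (Op Mul e1 e2) (x * y).
Proof. by move=> H1 H2 H; rewrite -(modn_small H); apply: ev_op. Qed.

Lemma ev_sub M e1 e2 x y : ev M e1 x -> ev M e2 y -> y <= x -> x < 2 ^ w ->
  ev M (Op Defs.Sub e1 e2) (x - y).
Proof.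
move=> H1 H2 Hy Hx; apply: ev_eq (ev_op _ H1 H2) _.
rewrite /= addnBA; last by lia.
rewrite addnC -addnBA // modnDl modn_small //; lia.
Qed.

Lemma ev_shl M e1 e2 x y : ev M e1 x -> ev M e2 y -> x * 2 ^ y < 2 ^ w ->
  ev M (Op Shl e1 e2) (x * 2 ^ y).
Proof. by move=> H1 H2 H; rewrite -(modn_small H); apply: ev_op. Qed.

Lemma ev_div M e1 e2 x y : ev M e1 x -> ev M e2 y -> ev M (Op Div e1 e2) (x %/ y).
Proof. exact: ev_op. Qed.

Lemma ev_mod M e1 e2 x y : ev M e1 x -> ev M e2 y -> ev M (Op Mod e1 e2) (x %% y).
Proof. exact: ev_op. Qed.

Lemma ev_and M e1 e2 x y :
  ev M e1 x -> ev M e2 y -> ev M (Op And e1 e2) (Nat.land x y).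
Proof. exact: ev_op. Qed.

Lemma ev_shr M e1 e2 x y :
  ev M e1 x -> ev M e2 y -> ev M (Op Shr e1 e2) (x %/ 2 ^ y).
Proof. exact: ev_op. Qed.

Lemma ev_lt M e1 e2 x y :
  ev M e1 x -> ev M e2 y -> ev M (Op Lt e1 e2) (x < y : nat).
Proof. exact: ev_op. Qed.

Lemma ev_eqn M e1 e2 x y :
  ev M e1 x -> ev M e2 y -> ev M (Op Eq e1 e2) (x == y : nat).
Proof. exact: ev_op. Qed.

Lemma w_100 : 100 < 2 ^ w.
Proof. by have := v_big ok; lia. Qed.

Variable M : memory.
Hypothesis wfM : wf M.

Lemma base0 : base p 0 = 0. Proof. by rewrite /base big_ord0. Qed.

Lemma ev_var i : i < 40 -> ev M (V i) (cell p M 0 i).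
Proof.
move=> Hi; have w100 := w_100.
have := @cell_lt p 0 i isT Hi; rewrite base0 add0n => Hlt.
by rewrite /ev /= modn_small ?wfM.1 ?Hlt /cell ?base0 //; lia.
Qed.

Lemma ev_par i v : 0 < i < 32 -> nth 0 (header p) i = v -> ev M (V i) v.
Proof. by move=> Hi <-; rewrite -wfM.2 //; apply: ev_var; lia. Qed.

Lemma ev_addr k e i : 0 < k < 8 -> ev M e i -> i < len p k ->
  ev M (Op Add (V (24 + k)) e) (base p k + i).
Proof.
move=> Hk He Hi; apply: ev_add => //; last first.
  by have := @cell_lt p k i; have := v_total ok; lia.
apply: ev_par; first lia.
by move: k Hk {Hi}; do 8?[case=> //].
Qed.

Lemma ev_arr k e i : 0 < k < 8 -> ev M e i -> i < len p k ->
  ev M (A k e) (cell p M k i).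
Proof.
move=> Hk He Hi; have := ev_addr Hk He Hi; rewrite /ev /= => ->.
by rewrite wfM.1 cell_lt //; lia.
Qed.

Lemma runs_wv i e v : ev M e v -> i < 40 -> runs w (WV i e) M (upd p M 0 i v).
Proof.
move=> He Hi; exists (expr_time (Const i) + expr_time e).+1; split=> //.
rewrite /upd base0; apply: exec_Write => //.
  by rewrite /= modn_small //; have := w_100; lia.
by rewrite wfM.1; have := @cell_lt p 0 i isT Hi; rewrite base0.
Qed.

Lemma runs_wa k ie i e v : 0 < k < 8 -> ev M ie i -> ev M e v -> i < len p k ->
  runs w (WA k ie e) M (upd p M k i v).
Proof.
move=> Hk Hie He Hi; eexists; split; last first.
  by apply: exec_Write (ev_addr Hk Hie Hi) He _; rewrite wfM.1 cell_lt //; lia.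
by [].
Qed.

Lemma wf_upd k i v : k < 8 -> i < len p k -> (k == 0) && (0 < i < 32) = false ->
  wf (upd p M k i v).
Proof.
move=> Hk Hi Hn; split; first exact: size_upd wfM.1 _ _.
move=> j Hj; rewrite cell_upd //; last by rewrite /len /=; lia.
case: andP => [[/eqP E1 /eqP E2]|_]; last exact: wfM.2.
by move: Hn; rewrite -E1 -E2 Hj.
Qed.

Lemma ev_d : ev M e_d (par_d p). Proof. exact: ev_par. Qed.
Lemma ev_N : ev M e_N (par_N p). Proof. exact: ev_par. Qed.
Lemma ev_L : ev M e_L (par_L p). Proof. exact: ev_par. Qed.
Lemma ev_S : ev M e_S (par_S p). Proof. exact: ev_par. Qed.
Lemma ev_b : ev M e_b (par_b p). Proof. exact: ev_par. Qed.
Lemma ev_F : ev M e_F (par_F p). Proof. exact: ev_par. Qed.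
Lemma ev_z : ev M e_z (par_z p). Proof. exact: ev_par. Qed.
Lemma ev_J : ev M e_J (ones (par_z p) (par_F p)). Proof. exact: ev_par. Qed.
Lemma ev_2z : ev M e_2z (2 ^ par_z p). Proof. exact: ev_par. Qed.
Lemma ev_H : ev M e_H (2 ^ (par_z p).-1). Proof. exact: ev_par. Qed.
Lemma ev_mz : ev M e_mz (2 ^ par_z p - 1). Proof. exact: ev_par. Qed.
Lemma ev_z1 : ev M e_z1 (par_z p).-1. Proof. exact: ev_par. Qed.
Lemma ev_b1 : ev M e_b1 (par_b p).+1. Proof. exact: ev_par. Qed.
Lemma ev_J2 : ev M e_J2 (ones (par_b p).+1 (par_b p)). Proof. exact: ev_par. Qed.
Lemma ev_K2 : ev M e_K2 (ones (par_b p) (par_b p)). Proof. exact: ev_par. Qed.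
Lemma ev_mb : ev M e_mb (2 ^ (par_b p).+1 - 1). Proof. exact: ev_par. Qed.
Lemma ev_2b : ev M e_2b (2 ^ par_b p). Proof. exact: ev_par. Qed.
Lemma ev_cut : ev M e_cut (2 ^ ((par_b p).+1 * par_b p)). Proof. exact: ev_par. Qed.
Lemma ev_M : ev M e_M (par_M p). Proof. exact: ev_par. Qed.
Lemma ev_G : ev M e_G (par_G p). Proof. exact: ev_par. Qed.
Lemma ev_Z : ev M e_Z (par_Z p). Proof. exact: ev_par. Qed.
Lemma ev_Ls : ev M e_Ls (par_Ls p). Proof. exact: ev_par. Qed.
Lemma ev_Lsz : ev M e_Lsz (par_Lsz p). Proof. exact: ev_par. Qed.
Lemma ev_lw : ev M e_lw (par_lw p). Proof. exact: ev_par. Qed.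

End Eval.

(** Evaluates an expression along its syntax and leaves the range conditions as goals. Known values
    are tried first, so facts about subexpressions established beforehand are reused instead of
    unfolding them. *)
Ltac evs :=
  first [eassumption |
  lazymatch goal with
  | |- ev _ _ (Op Add _ _) _ => eapply ev_add; [evs | evs | idtac]
  | |- ev _ _ (Op Mul _ _) _ => eapply ev_mul; [evs | evs | idtac]
  | |- ev _ _ (Op Defs.Sub _ _) _ => eapply ev_sub; [evs | evs | idtac | idtac]
  | |- ev _ _ (Op Shl _ _) _ => eapply ev_shl; [evs | evs | idtac]
  | |- ev _ _ (Op Div _ _) _ => eapply ev_div; [evs | evs]
  | |- ev _ _ (Op Mod _ _) _ => eapply ev_mod; [evs | evs]
  | |- ev _ _ (Op And _ _) _ => eapply ev_and; [evs | evs]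
  | |- ev _ _ (Op Shr _ _) _ => eapply ev_shr; [evs | evs]
  | |- ev _ _ (Op Lt _ _) _ => eapply ev_lt; [evs | evs]
  | |- ev _ _ (Op Eq _ _) _ => eapply ev_eqn; [evs | evs]
  | |- ev _ _ (Const _) _ => eapply ev_const
  | |- ev _ _ e_d _ => eapply ev_d; eassumption
  | |- ev _ _ e_N _ => eapply ev_N; eassumption
  | |- ev _ _ e_L _ => eapply ev_L; eassumption
  | |- ev _ _ e_S _ => eapply ev_S; eassumption
  | |- ev _ _ e_b _ => eapply ev_b; eassumption
  | |- ev _ _ e_F _ => eapply ev_F; eassumption
  | |- ev _ _ e_z _ => eapply ev_z; eassumption
  | |- ev _ _ e_J _ => eapply ev_J; eassumption
  | |- ev _ _ e_2z _ => eapply ev_2z; eassumption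
  | |- ev _ _ e_H _ => eapply ev_H; eassumption
  | |- ev _ _ e_mz _ => eapply ev_mz; eassumption
  | |- ev _ _ e_z1 _ => eapply ev_z1; eassumption
  | |- ev _ _ e_b1 _ => eapply ev_b1; eassumption
  | |- ev _ _ e_J2 _ => eapply ev_J2; eassumption
  | |- ev _ _ e_K2 _ => eapply ev_K2; eassumption
  | |- ev _ _ e_mb _ => eapply ev_mb; eassumption
  | |- ev _ _ e_2b _ => eapply ev_2b; eassumption
  | |- ev _ _ e_cut _ => eapply ev_cut; eassumption
  | |- ev _ _ e_M _ => eapply ev_M; eassumption
  | |- ev _ _ e_G _ => eapply ev_G; eassumption
  | |- ev _ _ e_Z _ => eapply ev_Z; eassumption
  | |- ev _ _ e_Ls _ => eapply ev_Ls; eassumption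
  | |- ev _ _ e_Lsz _ => eapply ev_Lsz; eassumption
  | |- ev _ _ e_lw _ => eapply ev_lw; eassumption
  | |- ev _ _ (A _ _) _ => eapply ev_arr; [eassumption | eassumption | by [] | evs | idtac]
  end].

(** * Rank and select inside a block *)

Definition fieldE X i := Op Mod (Op Shr X (Op Mul e_z i)) e_2z.
Definition bitE e := Op Mod (Op Shr (A 1 (Op Div e e_lw)) (Op Mod e e_lw)) (Const 2).
Definition leafE e :=
  Op Mod (Op Shr (A 1 (Op Div e e_lw)) (Op Mul (Op Div (Op Mod e e_lw) e_b) e_b)) e_2b.
Definition spreadE y := Op And (Op Mul y e_K2) e_J2.
Definition countE X r :=
  Op Mod (Op And (Op Shr (Op Defs.Sub (Op Mul (Op Add r e_H) e_J) X) e_z1) e_J) e_mz.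
(** A leaf is spread over fields of width [b + 1], one product turns the bits into inclusive prefix
    counts, and these are compared with [r] as in [countE], with [2 ^ b] as the top bit. *)
Definition count1E y r :=
  Op Mod (Op And (Op Shr (Op Defs.Sub (Op Mul (Op Add r e_2b) e_J2)
     (Op Mod (Op Mul (spreadE y) e_J2) e_cut)) e_b) e_J2) e_mb.
(** Ones of the block strictly before position [e]: one field per node on the path, and for the leaf
    the spread bits below the position, cut by a remainder and added up by a second one. *)
Definition rankE e :=
  Op Add (Op Add (fieldE (A 3 (Op Div e e_L)) (Op Mod (Op Div e e_S) e_F))
                 (fieldE (A 2 (Op Div e e_S)) (Op Mod (Op Div e e_b) e_F)))
    (Op Mod (Op Mod (spreadE (leafE e)) (Op Shl (Const 1) (Op Mul e_b1 (Op Mod e e_b)))) e_mb).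
(** One is subtracted from the counts at both nodes because the field of child 0 is 0 and always
    counts; the leaf works with inclusive counts and needs no correction. *)
Definition selE s r :=
  let i2 := Op Defs.Sub (countE (A 3 s) r) (Const 1) in
  let r2 := Op Defs.Sub r (fieldE (A 3 s) i2) in
  let j := Op Add (Op Mul s e_F) i2 in
  let i1 := Op Defs.Sub (countE (A 2 j) r2) (Const 1) in
  let r1 := Op Defs.Sub r2 (fieldE (A 2 j) i1) in
  let x := Op Mul (Op Add (Op Mul j e_F) i1) e_b in
  Op Add x (count1E (leafE x) r1).

(* State: elements in the current chunk; ones seen since the last recorded
   multiple of [d]; position of the next chunk bit; number of ones among the
   chunk bits, modulo [par_Z]; log row and entry of the current group; two
   scratch cells. *)
Definition e_e := V 32.
Definition e_u := V 33.
Definition e_h := V 34.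
Definition e_Q := V 35.
Definition e_lam := V 36.
Definition e_ci := V 37.
Definition e_v := V 38.
Definition e_old := V 39.

Definition maskE i :=
  let sh := Op Mul e_z (Op Add i (Const 1)) in Op Shl (Op Shr e_J sh) sh.
Definition node_setE X i :=
  Op Add (Op Defs.Sub X (Op Mul e_old (maskE i))) (Op Mul e_v (maskE i)).
Definition set_node2 :=
  WA 3 (Op Div e_h e_L)
     (node_setE (A 3 (Op Div e_h e_L)) (Op Mod (Op Div e_h e_S) e_F)).
Definition set_node1 :=
  WA 2 (Op Div e_h e_S)
     (node_setE (A 2 (Op Div e_h e_S)) (Op Mod (Op Div e_h e_b) e_F)).
Definition set_total :=
  WA 4 (Op Div e_h e_L) (Op Add (Op Defs.Sub (A 4 (Op Div e_h e_L)) e_old) e_v).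
Definition set_word :=
  WA 1 (Op Div e_h e_lw)
     (Op Add (Op Defs.Sub (A 1 (Op Div e_h e_lw)) (Op Shl e_old (Op Mod e_h e_lw)))
             (Op Shl e_v (Op Mod e_h e_lw))).
(** The old bit is saved first; the four words that depend on it are then corrected by old and new
    contribution, with no recounting. *)
Definition set_bit :=
  Seq (WV 39 (bitE e_h)) (Seq set_node2 (Seq set_node1 (Seq set_total set_word))).

Section Tree.

Variables (w : nat) (p : params).
Hypothesis ok : valid w p.

Local Notation N := (par_N p).
Local Notation L := (par_L p).
Local Notation S1 := (par_S p).
Local Notation b := (par_b p).
Local Notation F := (par_F p).
Local Notation z := (par_z p).
Local Notation lw := (par_lw p).

Record tree (M : memory) (B : nat -> bool) : Prop := Tree {
  tree_bits : forall i, i <= N %/ lw -> cell p M 1 i = bits B (i * lw) lw;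
  tree_node1 : forall j, j <= N %/ S1 -> cell p M 2 j = prefixes B (j * S1) b z F;
  tree_node2 : forall s, s < par_M p -> cell p M 3 s = prefixes B (s * L) S1 z F;
  tree_total : forall s, s < par_M p -> cell p M 4 s = cnt B (s * L) L;
  tree_out : forall i, N <= i -> B i = false }.

Lemma N_gt0 : 0 < N.
Proof.
have [d0 dn] := andP (v_d ok); rewrite (v_N ok) /ceil_div divn_gt0 //; lia.
Qed.

Lemma S_gt0 : 0 < S1. Proof. by rewrite muln_gt0 (v_b ok) (v_F ok). Qed.
Lemma L_gt0 : 0 < L. Proof. by rewrite muln_gt0 S_gt0 (v_F ok). Qed.
Lemma lw_gt0 : 0 < lw. Proof. by rewrite muln_gt0 (v_b ok) (v_l ok). Qed.

Lemma slot_lt x : x < N -> x %/ L < par_M p.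
Proof. by move=> Hx; rewrite /par_M ltnS leq_div2r //; lia. Qed.

Lemma N_bound : 8 * N + 100 < 2 ^ w.
Proof.
have [d0 dn] := andP (v_d ok).
have HN : N <= par_n p.
  by rewrite (v_N ok) /ceil_div -ltnS ltn_divLR // mulSn; have := leq_pmulr (par_n p) d0; lia.
by have := v_big ok; lia.
Qed.

Lemma exp2_w k : k <= w -> 2 ^ k <= 2 ^ w.
Proof. by move=> Hk; rewrite leq_exp2l. Qed.

Lemma b_w : b.+1 * b <= w. Proof. by have := v_bw ok; lia. Qed.

Lemma b_exp : b < 2 ^ b. Proof. exact: ltn_expl. Qed.

Lemma prefixes_lt B s g : g * F <= L -> prefixes B s g z F < 2 ^ w.
Proof.
move=> Hg; apply: leq_trans (exp2_w (v_zF ok)); apply: fsum_lt => j Hj.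
have := cnt_le B s (j * g); have := v_Lz ok.
have : 2 ^ z.-1 <= 2 ^ z by rewrite leq_exp2l //; lia.
by nia.
Qed.

Lemma cnt_field_lt B s g j : g * F <= L -> j < F -> cnt B s (j * g) < 2 ^ z.-1.
Proof. by move=> Hg Hj; have := cnt_le B s (j * g); have := v_Lz ok; nia. Qed.

Lemma SF_L : S1 * F <= L. Proof. by []. Qed.
Lemma bF_L : b * F <= L. Proof. by have := v_F ok; rewrite /par_L -/(par_S p); nia. Qed.

Section Query.

Variables (M : memory) (B : nat -> bool).
Hypothesis wfM : wf p M.
Hypothesis treeM : tree M B.

Lemma ev_word e x : ev w M e x -> x < N ->
  ev w M (A 1 (Op Div e e_lw)) (bits B (x %/ lw * lw) lw).
Proof.
move=> He Hx; have Hd : x %/ lw <= N %/ lw by rewrite leq_div2r // ltnW.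
rewrite -(tree_bits treeM) //; evs; rewrite /len /=; lia.
Qed.

Lemma ev_bit e x : ev w M e x -> x < N -> ev w M (bitE e) (B x).
Proof.
move=> He Hx; have Hw := ev_word He Hx; have := w_100 ok => w100.
eapply ev_eq; first by rewrite /bitE; evs; lia.
rewrite -[2]/(2 ^ 1) bits_sub; last by rewrite addn1 ltn_pmod ?lw_gt0.
by rewrite bits1 -divn_eq.
Qed.

Lemma ev_leaf e x : ev w M e x -> x < N ->
  ev w M (leafE e) (bits B (x %/ b * b) b).
Proof.
move=> He Hx; have Hw := ev_word He Hx; have := w_100 ok => w100.
have Hm := ltn_pmod x lw_gt0.
have Hb := v_b ok.
have E1 : x %% lw %/ b < par_l p by rewrite ltn_divLR.
have lww : 2 ^ lw <= 2 ^ w by apply: exp2_w; exact: v_lw.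
have lwe := ltn_expl lw (isT : 1 < 2).
have lel : x %% lw %/ b * b <= x %% lw by exact: leq_trunc_div.
eapply ev_eq; first by rewrite /leafE; evs; lia.
rewrite bits_sub; last by rewrite -[X in _ + X]mul1n -mulnDl addn1 leq_mul2r E1 orbT.
congr bits; rewrite [in RHS](divn_eq x lw) {2 4}/par_lw mulnA divnMDl //; lia.
Qed.

Lemma ev_field X i g s n : g * F <= L -> i < F ->
  ev w M X (prefixes B s g z F) -> ev w M n i -> ev w M (fieldE X n) (cnt B s (i * g)).
Proof.
move=> Hg Hi HX Hn.
have zi : z * i < 2 ^ w.
  have := ltn_expl w (isT : 1 < 2); have := v_zF ok; have := v_z ok; nia.
eapply ev_eq; first by rewrite /fieldE; evs.
rewrite fsum_field // => j Hj.
have := cnt_field_lt B s Hg Hj.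
have : 2 ^ z.-1 <= 2 ^ z by rewrite leq_exp2l //; lia.
lia.
Qed.

Lemma ev_count X r g s n : g * F <= L -> r < 2 ^ z.-1 ->
  ev w M X (prefixes B s g z F) -> ev w M n r ->
  ev w M (countE X n) (\sum_(j < F) (cnt B s (j * g) <= r)).
Proof.
move=> Hg Hr HX Hn.
have z0 : 0 < z by have := v_z ok; lia.
have zE : 2 ^ z = 2 * 2 ^ z.-1 by rewrite -{1}(prednK z0) expnS.
have zw : 2 ^ z <= 2 ^ w.
  by apply: exp2_w; have := v_zF ok; have := v_F ok; nia.
have e1 : 0 < 2 ^ z.-1 by rewrite expn_gt0.
have Hlt : (r + 2 ^ z.-1) * ones z F < 2 ^ w.
  apply: leq_trans (exp2_w (v_zF ok)); rewrite /ones fsumM; apply: fsum_lt => j _; lia.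
have Hle : prefixes B s g z F <= (r + 2 ^ z.-1) * ones z F.
  rewrite /ones fsumM /prefixes; apply: leq_sum => j _; rewrite leq_mul2r.
  by have := cnt_field_lt B s Hg (ltn_ord j); lia.
eapply ev_eq; first by rewrite /countE; evs; lia.
rewrite fsum_count_le //.
  have := v_Lz ok; have := S_gt0; have := v_F ok; rewrite /par_L; nia.
by move=> j Hj; exact: cnt_field_lt.
Qed.

Lemma ev_spread e s : ev w M e (bits B s b) ->
  ev w M (spreadE e) (fsum b.+1 b (fun j => B (s + j))).
Proof.
move=> He; eapply ev_eq; first (rewrite /spreadE; evs).
  apply: (@leq_trans (2 ^ (b * b))); last by apply: exp2_w; have := b_w; lia.
  by rewrite /ones fsumM; apply: fsum_lt => j _; rewrite muln1 bits_lt.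
exact: land_spread (v_b ok).
Qed.

Lemma cnt_b_lt s j : j <= b -> cnt B s j < 2 ^ b.
Proof. by move=> Hj; have := cnt_le B s j; have := b_exp; lia. Qed.

Lemma ev_count1 e n s r : ev w M e (bits B s b) -> ev w M n r -> r < 2 ^ b ->
  ev w M (count1E e n) (\sum_(j < b) (cnt B s j.+1 <= r)).
Proof.
move=> He Hn Hr; have Hs := ev_spread He.
have cut : 2 ^ (b.+1 * b) <= 2 ^ w by apply/exp2_w/b_w.
have b2 : 2 ^ b.+1 = 2 * 2 ^ b by rewrite expnS.
have b2w : 2 ^ b.+1 <= 2 ^ w by apply: exp2_w; have := b_w; have := v_b ok; nia.
have sp_lt : fsum b.+1 b (fun j => B (s + j)) < 2 ^ (b.+1 * b).
  by apply: fsum_lt => j _; case: (B _) => /=; have := expn_gt0 2 b; lia.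
have J_lt : ones b.+1 b < 2 ^ (b.+1 * b).
  by apply: fsum_lt => j _; have := expn_gt0 2 b; lia.
have E : fsum b.+1 b (fun j => B (s + j)) * ones b.+1 b %% 2 ^ (b.+1 * b)
       = fsum b.+1 b (fun j => cnt B s j.+1).
  rewrite fsum_prefix // => j Hj.
  by have := cnt_b_lt s Hj; rewrite /cnt b2; lia.
eapply ev_eq; first (rewrite /count1E; evs).
- by lia.
- apply: (leq_trans _ cut); rewrite /ones fsumM; apply: fsum_lt => j _; lia.
(* The product is formed before it is cut and must not overflow; this is the origin of the factor 2
   in [v_bw]. *)
- apply: (@leq_trans (2 ^ (b.+1 * b) * 2 ^ (b.+1 * b))); first by nia.
  by rewrite -expnD; apply: exp2_w; have := v_bw ok; lia.
- rewrite E /ones fsumM; apply: leq_sum => j _; rewrite leq_mul2r.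
  by have := cnt_b_lt s (ltn_ord j); lia.
- apply: (leq_trans _ cut); rewrite /ones fsumM; apply: fsum_lt => j _; lia.
rewrite E (@fsum_count_le b.+1 b r (fun j => cnt B s j.+1)) //.
- by have := b_exp; have := v_b ok; lia.
- by move=> j; exact: cnt_b_lt.
Qed.

Lemma ev_node1 e j : ev w M e j -> j <= N %/ S1 ->
  ev w M (A 2 e) (prefixes B (j * S1) b z F).
Proof. by move=> He Hj; rewrite -(tree_node1 treeM) //; evs; rewrite /len /=; lia. Qed.

Lemma ev_node2 e s : ev w M e s -> s < par_M p ->
  ev w M (A 3 e) (prefixes B (s * L) S1 z F).
Proof. by move=> He Hs; rewrite -(tree_node2 treeM) //; evs; rewrite /len /=; lia. Qed.

Lemma ev_total e s : ev w M e s -> s < par_M p -> ev w M (A 4 e) (cnt B (s * L) L).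
Proof. by move=> He Hs; rewrite -(tree_total treeM) //; evs; rewrite /len /=; lia. Qed.

Lemma ev_rank e x : ev w M e x -> x < N ->
  ev w M (rankE e) (cnt B (x %/ L * L) (x %% L)).
Proof.
move=> He Hx; have Hy := ev_spread (ev_leaf He Hx).
have H3 : ev w M (A 3 (Op Div e e_L)) (prefixes B (x %/ L * L) S1 z F).
  by apply: ev_node2; [evs | exact: slot_lt].
have H2 : ev w M (A 2 (Op Div e e_S)) (prefixes B (x %/ S1 * S1) b z F).
  by apply: ev_node1; [evs | rewrite leq_div2r // ltnW].
have Hf3 : ev w M (fieldE (A 3 (Op Div e e_L)) (Op Mod (Op Div e e_S) e_F))
             (cnt B (x %/ L * L) (x %/ S1 %% F * S1)).
  by apply: ev_field H3 _; [exact: SF_L | rewrite ltn_pmod // (v_F ok) | evs].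
have Hf2 : ev w M (fieldE (A 2 (Op Div e e_S)) (Op Mod (Op Div e e_b) e_F))
             (cnt B (x %/ S1 * S1) (x %/ b %% F * b)).
  by apply: ev_field H2 _; [exact: bF_L | rewrite ltn_pmod // (v_F ok) | evs].
have xb := ltn_pmod x (v_b ok).
have Hl : ev w M (Op Mod (Op Mod (spreadE (leafE e))
            (Op Shl (Const 1) (Op Mul e_b1 (Op Mod e e_b)))) e_mb)
            (cnt B (x %/ b * b) (x %% b)).
  have Hw := ltn_expl w (isT : 1 < 2); have bw := b_w.
  eapply ev_eq; first evs.
  - by have := w_100 ok; lia.
  - by nia.
  - by rewrite mul1n ltn_exp2l //; nia.
  rewrite mul1n fsum_low ?(ltnW xb) // => [|j _]; last first.
    by case: (B _) => /=; rewrite expnS; have := expn_gt0 2 b; lia.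
  rewrite fsum_mod //; have := cnt_le B (x %/ b * b) (x %% b); rewrite /cnt.
  by have := b_exp; rewrite expnS; lia.
have E := cnt_descend B x (v_b ok) (v_F ok); rewrite -/(par_S p) in E.
have E' := cnt_descend B x S_gt0 (v_F ok); rewrite -/(par_L p) in E'.
have := cnt_le B (x %/ L * L) (x %% L).
have := leq_mod x L; have := N_bound.
by rewrite E' E addnA => *; rewrite /rankE; evs; lia.
Qed.

Lemma ev_select se re s r : ev w M se s -> ev w M re r ->
  s < par_M p -> r < cnt B (s * L) L ->
  exists2 x, ev w M (selE se re) x &
    [/\ x < N, B x, x %/ L = s & cnt B (s * L) (x %% L) = r].
Proof.
move=> Hs Hr sM rlt; have NB := N_bound; have w100 := w_100 ok.
have Lw : L < 2 ^ z.-1 := v_Lz ok.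
have zw : 2 ^ z.-1 <= 2 ^ w.
  by apply: exp2_w; have := v_zF ok; have := v_F ok; nia.
have rL : r < L by have := cnt_le B (s * L) L; lia.
have H3 := ev_node2 Hs sM.
have in_N x : B x -> x < N.
  by move=> Bx; rewrite ltnNge; apply/negP => /(tree_out treeM); rewrite Bx.
(* A range containing a one begins before [N]. This keeps every node and leaf visited by the search
   inside its region. *)
have some k l : 0 < cnt B k l -> k < N.
  move=> Hc; rewrite ltnNge; apply/negP => Hk; move: Hc.
  rewrite /cnt big1 // => j _; rewrite (tree_out treeM) //; lia.
have rlt' : r < cnt B (s * L) (F * S1) by rewrite [F * _]mulnC.
have [] := cnt_search rlt'.
have r_z : r < 2 ^ z.-1 by lia.
have Hc3 := ev_count SF_L r_z H3 Hr.
have H1 : ev w M (Const 1) 1 by evs; lia.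
set c3 := \sum_(j < F) _ in Hc3 *; move=> i2F Hle3 Hlt3.
have c3F : c3 <= F by exact: (sum_nat_le F (fun j => cnt B (s * L) (j * S1) <= r)).
have c3_gt0 : 0 < c3.
  rewrite /c3; case: (F) (v_F ok) => // F' _.
  by rewrite big_ord_recl mul0n cnt0.
have sL : s * L < N by apply: (some _ L); lia.
have Fw : F <= L by rewrite /par_L; have := S_gt0; nia.
have c3w : c3 < 2 ^ w by lia.
have Hi2 := ev_sub Hc3 H1 c3_gt0 c3w; rewrite subn1 in Hi2.
have Hf3 := ev_field SF_L i2F H3 Hi2.
have rw : r < 2 ^ w by lia.
have Hr2 := ev_sub Hr Hf3 Hle3 rw.
set j := s * F + c3.-1; set r2 := r - _ in Hr2 Hlt3.
have jS : s * L + c3.-1 * S1 = j * S1 by rewrite /j /par_L; ring.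
rewrite jS in Hlt3.
have jN : j * S1 < N by apply: (some _ S1); lia.
have jlt : j <= N %/ S1 by rewrite leq_divRL ?S_gt0 // ltnW.
have jN' : j < N by apply: leq_ltn_trans jN; rewrite leq_pmulr // S_gt0.
have sFw : s * F < 2 ^ w by lia.
have jw : s * F + c3.-1 < 2 ^ w by lia.
have Hj := ev_add (ev_mul Hs (ev_F ok wfM) sFw) Hi2 jw; rewrite -/j in Hj.
have H2 := ev_node1 Hj jlt.
have Hlt2' : r2 < cnt B (j * S1) (F * b) by rewrite [F * _]mulnC.
have [] := cnt_search Hlt2'.
have r2_z : r2 < 2 ^ z.-1 by lia.
have Hc2 := ev_count bF_L r2_z H2 Hr2.
set c2 := \sum_(j < F) _ in Hc2 *; move=> i1F Hle2 Hlt2.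
have c2F : c2 <= F by exact: (sum_nat_le F (fun i => cnt B (j * S1) (i * b) <= r2)).
have c2_gt0 : 0 < c2.
  rewrite /c2; case: (F) (v_F ok) => // F' _.
  by rewrite big_ord_recl mul0n cnt0.
have c2w : c2 < 2 ^ w by lia.
have Hi1 := ev_sub Hc2 H1 c2_gt0 c2w; rewrite subn1 in Hi1.
have Hf2 := ev_field bF_L i1F H2 Hi1.
have r2w : r2 < 2 ^ w by lia.
have Hr1 := ev_sub Hr2 Hf2 Hle2 r2w.
set l := j * F + c2.-1; set r1 := r2 - _ in Hr1 Hlt2.
have lb : j * S1 + c2.-1 * b = l * b by rewrite /l /par_S; ring.
rewrite lb in Hlt2.
have lN : l * b < N by apply: (some _ b); lia.
have lN' : l < N by apply: leq_ltn_trans lN; rewrite leq_pmulr // (v_b ok).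
have jFw : j * F < 2 ^ w by lia.
have lw' : j * F + c2.-1 < 2 ^ w by lia.
have lbw : l * b < 2 ^ w by lia.
have Hl := ev_mul (ev_add (ev_mul Hj (ev_F ok wfM) jFw) Hi1 lw') (ev_b ok wfM) lbw.
have r1b : r1 < 2 ^ b by have := cnt_b_lt (l * b) (leqnn b); lia.
have Hy := ev_leaf Hl lN; rewrite mulnK ?(v_b ok) // in Hy.
have Hc1 := ev_count1 Hy Hr1 r1b.
have [] := cnt_search1 Hlt2.
set o := \sum_(j0 < b) _ in Hc1 *; move=> ob Hcnt Bo.
have xN := in_N _ Bo.
have low : l * b + o < 2 ^ w by lia.
exists (l * b + o); first exact: ev_add Hl Hc1 low.
have xL : l * b + o = s * L + (c3.-1 * S1 + c2.-1 * b + o).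
  by rewrite addnA addnA jS lb.
have oL : c3.-1 * S1 + c2.-1 * b + o < L.
  have : c2.-1.+1 * b <= S1 by rewrite /par_S mulnC leq_mul2l i1F orbT.
  have : c3.-1.+1 * S1 <= L by rewrite /par_L mulnC leq_mul2l i2F orbT.
  by rewrite !mulSn; lia.
split=> //.
  by rewrite xL divnMDl ?L_gt0 // divn_small // addn0.
rewrite xL modnMDl modn_small // !cnt_cat addnA jS lb Hcnt; lia.
Qed.

End Query.

End Tree.

(** * Setting a bit *)

Section Tree.

Variables (w : nat) (p : params).
Hypothesis ok : valid w p.

Local Notation N := (par_N p).
Local Notation L := (par_L p).
Local Notation S1 := (par_S p).
Local Notation b := (par_b p).
Local Notation F := (par_F p).
Local Notation z := (par_z p).
Local Notation lw := (par_lw p).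

Lemma ev_state M i v : wf p M -> i < 40 -> cell p M 0 i = v -> ev w M (V i) v.
Proof. by move=> wfM Hi <-; apply: ev_var. Qed.

Lemma ev_mask M n i : wf p M -> ev w M n i -> i < F ->
  ev w M (maskE n) (fsum z F (fun j => i < j)).
Proof.
move=> wfM Hn Hi; have w100 := w_100 ok.
have z0 : 0 < z by have := v_z ok; lia.
have iz : z * (i + 1) <= w by have := v_zF ok; nia.
have Fw := ltn_expl w (isT : 1 < 2).
rewrite mask_above // -(addn1 i); cbv beta zeta delta [maskE]; evs; try nia.
apply: leq_ltn_trans (leq_trunc_div _ _) _.
apply: leq_trans (exp2_w (v_zF ok)); apply: fsum_lt => j _.
by rewrite -{1}(expn0 2) ltn_exp2l.
Qed.

Lemma ev_node_set M X n (B : nat -> bool) h s g (v : bool) : wf p M ->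
  cell p M 0 38 = v -> cell p M 0 39 = B h -> 0 < g -> g * F <= L ->
  s <= h < s + F * g ->
  ev w M X (prefixes B s g z F) -> ev w M n ((h - s) %/ g) ->
  ev w M (node_setE X n) (prefixes (bset B h v) s g z F).
Proof.
move=> wfM Ev Eo g0 gL /andP[sh hs] HX Hn.
have iF : (h - s) %/ g < F by rewrite ltn_divLR //; lia.
have Hm := ev_mask wfM Hn iF.
have Hv := ev_state wfM (isT : 38 < 40) Ev.
have Ho := ev_state wfM (isT : 39 < 40) Eo.
have E b' := prefixes_bset B b' z g0 sh hs.
set m := fsum z F _ in E Hm.
have lt1 := prefixes_lt ok (bset B h v) s gL; have lt2 := prefixes_lt ok B s gL.
(* For the bit [false] the equation shows that the old contribution is at most the stored word, so
   the subtraction does not wrap around. *)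
have E0 := E false; have Ev' := E v; rewrite mul0n addn0 in E0.
have mw : m < 2 ^ w.
  apply: leq_trans (exp2_w (v_zF ok)); apply: fsum_lt => j _.
  have : 1 < 2 ^ z by rewrite -{1}(expn0 2) ltn_exp2l //; have := v_z ok; lia.
  by move=> z1; apply: leq_ltn_trans (leq_b1 _) z1.
have Hom := ev_mul Ho Hm; have Hvm := ev_mul Hv Hm.
have bm (b' : bool) : b' * m <= m by case: b'; rewrite ?mul1n.
have := bm v; have := bm (B h) => ? ?.
by eapply ev_eq; first (rewrite /node_setE; evs); lia.
Qed.

Lemma bits_bset_out B h v s l : (s <= h < s + l) = false -> bits (bset B h v) s l = bits B s l.
Proof. by move=> E; have := bits_bset B h v s l; rewrite E !mul0n !addn0. Qed.

Lemma cnt_bset_out B h v s l : (s <= h < s + l) = false -> cnt (bset B h v) s l = cnt B s l.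
Proof. by move=> E; have := cnt_bset B h v s l; rewrite E !mul0n !addn0. Qed.

Lemma prefixes_bset_out B h v s g : (s <= h < s + F * g) = false ->
  prefixes (bset B h v) s g z F = prefixes B s g z F.
Proof.
move=> E; apply: eq_fsum => j Hj; apply: cnt_bset_out.
have : j * g <= F * g by rewrite leq_mul2r ltnW ?orbT.
by lia.
Qed.

Lemma block_mem h g j : 0 < g -> (j * g <= h < j * g + g) = (j == h %/ g).
Proof.
move=> g0; rewrite addnC -mulSn -ltn_divLR // -leq_divRL // ltnS.
by rewrite eqn_leq.
Qed.

Lemma tree_frame M M' B :
  (forall k i, 0 < k < 5 -> i < len p k -> cell p M' k i = cell p M k i) ->
  tree p M B -> tree p M' B.
Proof.
move=> E [H1 H2 H3 H4 H5]; split => //.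
- by move=> i Hi; rewrite E // H1.
- by move=> i Hi; rewrite E // H2.
- by move=> i Hi; rewrite E // H3.
- by move=> i Hi; rewrite E // H4.
Qed.

Lemma runs_set M B h (v : bool) : wf p M -> tree p M B -> h < N ->
  cell p M 0 34 = h -> cell p M 0 38 = v ->
  exists M', [/\ runs w set_bit M M', wf p M', tree p M' (bset B h v) &
    forall k i, k < 8 -> ~~ (0 < k < 5) -> i < len p k ->
      (k == 0) && (i == 39) = false -> cell p M' k i = cell p M k i].
Proof.
move=> wfM tM hN Eh Ev.
have Hh0 := ev_state wfM (isT : 34 < 40) Eh.
have w100 := w_100 ok; have NB := N_bound ok.
have R0 := runs_wv ok wfM (ev_bit ok wfM tM Hh0 hN) (isT : 39 < 40).
set M0 := upd p M 0 39 _ in R0.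
have wf0 : wf p M0 by apply: wf_upd.
have sM := slot_lt hN.
have jN : h %/ S1 < (N %/ S1).+1 by rewrite ltnS leq_div2r // ltnW.
have iN : h %/ lw < (N %/ lw).+1 by rewrite ltnS leq_div2r // ltnW.
have C0 k i : k < 8 -> i < len p k -> cell p M0 k i =
    if (k == 0) && (i == 39) then B h : nat else cell p M k i.
  by move=> Hk Hi; rewrite cell_upd.
pose good M1 := [/\ wf p M1, cell p M1 0 34 = h, cell p M1 0 38 = v & cell p M1 0 39 = B h].
have good0 : good M0 by split=> //; rewrite C0.
have step M1 k i x : good M1 -> 0 < k < 8 -> i < len p k ->
    good (upd p M1 k i x) /\ forall k' i', i' < len p k' ->
    cell p (upd p M1 k i x) k' i' = if (k' == k) && (i' == i) then x else cell p M1 k' i'.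
  move=> [wf1 G1 G2 G3] Hk Hi; split; last by move=> k' i' Hi'; exact: cell_upd.
  have k0 : (0 == k) = false by move: Hk; clear; case: k.
  have k8 : k < 8 by case/andP: Hk.
  by split; [apply: wf_upd => //; rewrite eq_sym k0 | rewrite cell_upd // k0 ..].
have evh M1 : good M1 -> ev w M1 e_h h by case=> *; exact: ev_state.
have evS (k := h %/ S1 * S1) : h - k = h %% S1 by rewrite /k {1}(divn_eq h S1) addKn.
have evL (k := h %/ L * L) : h - k = h %% L by rewrite /k {1}(divn_eq h L) addKn.
pose B' := bset B h v.
have E3 : ev w M0 (node_setE (A 3 (Op Div e_h e_L)) (Op Mod (Op Div e_h e_S) e_F))
           (prefixes B' (h %/ L * L) S1 z F).
  have Hh := evh _ good0; have [_ _ G2 G3] := good0.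
  apply: (@ev_node_set _ _ _ B) => //; first exact: (S_gt0 ok).
  - by rewrite [F * _]mulnC -/(par_L p) block_mem ?(L_gt0 ok).
  - have E : cell p M0 3 (h %/ L) = cell p M 3 (h %/ L) by rewrite C0.
    by rewrite -(tree_node2 tM) // -E; evs.
  - by eapply ev_eq; first evs; rewrite evL modn_divl [F * _]mulnC.
have R3 := runs_wa ok wf0 (isT : 0 < 3 < 8) (ev_div (evh _ good0) (ev_L ok wf0)) E3 sM.
have [good3 C3] := step _ 3 _ (prefixes B' (h %/ L * L) S1 z F) good0 isT sM.
set M3 := upd p M0 3 _ _ in R3 good3 C3.
have wf3 : wf p M3 by case: good3.
have E2 : ev w M3 (node_setE (A 2 (Op Div e_h e_S)) (Op Mod (Op Div e_h e_b) e_F))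
           (prefixes B' (h %/ S1 * S1) b z F).
  have Hh := evh _ good3; have [_ _ G2 G3] := good3.
  apply: (@ev_node_set _ _ _ B) => //; first exact: (v_b ok).
  - exact: (bF_L ok).
  - by rewrite [F * _]mulnC -/(par_S p) block_mem ?(S_gt0 ok).
  - have E : cell p M3 2 (h %/ S1) = cell p M 2 (h %/ S1) by rewrite C3 // C0.
    by rewrite -(tree_node1 tM) // -E; evs.
  - by eapply ev_eq; first evs; rewrite evS modn_divl [F * _]mulnC.
have R2 := runs_wa ok wf3 (isT : 0 < 2 < 8) (ev_div (evh _ good3) (ev_S ok wf3)) E2 jN.
have [good2 C2] := step _ 2 _ (prefixes B' (h %/ S1 * S1) b z F) good3 isT jN.
set M2 := upd p M3 2 _ _ in R2 good2 C2.
have wf2 : wf p M2 by case: good2.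
have E4 : ev w M2 (Op Add (Op Defs.Sub (A 4 (Op Div e_h e_L)) e_old) e_v)
            (cnt B' (h %/ L * L) L).
  have Hh := evh _ good2; have [_ _ G2 G3] := good2.
  have Hv := ev_state wf2 (isT : 38 < 40) G2.
  have Ho := ev_state wf2 (isT : 39 < 40) G3.
  have HX : ev w M2 (A 4 (Op Div e_h e_L)) (cnt B (h %/ L * L) L).
    have E : cell p M2 4 (h %/ L) = cell p M 4 (h %/ L) by rewrite C2 // C3 // C0.
    by rewrite -(tree_total tM) // -E; evs.
  have E := cnt_bset B h v (h %/ L * L) L.
  have E0 := cnt_bset B h false (h %/ L * L) L.
  have hin := block_mem h (h %/ L) (L_gt0 ok); rewrite eqxx in hin.
  rewrite hin !mul1n in E E0; rewrite -/B' in E.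
  have le1 := cnt_le B (h %/ L * L) L; have le2 := cnt_le B' (h %/ L * L) L.
  have lz := v_Lz ok.
  have zw : 2 ^ z.-1 <= 2 ^ w.
    by apply: exp2_w; have := v_zF ok; have := v_F ok; clear; nia.
  eapply ev_eq; first (evs; move: E E0 le1 le2 lz zw (leq_b1 v) (leq_b1 (B h)); clear; lia).
  by move: E E0 le1 le2 lz zw (leq_b1 v) (leq_b1 (B h)); clear; lia.
have R4 := runs_wa ok wf2 (isT : 0 < 4 < 8) (ev_div (evh _ good2) (ev_L ok wf2)) E4 sM.
have [good4 C4] := step _ 4 _ (cnt B' (h %/ L * L) L) good2 isT sM.
set M4 := upd p M2 4 _ _ in R4 good4 C4.
have wf4 : wf p M4 by case: good4.
have E1 : ev w M4 (Op Add (Op Defs.Sub (A 1 (Op Div e_h e_lw)) (Op Shl e_old (Op Mod e_h e_lw)))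
             (Op Shl e_v (Op Mod e_h e_lw))) (bits B' (h %/ lw * lw) lw).
  have Hh := evh _ good4; have [_ _ G2 G3] := good4.
  have Hv := ev_state wf4 (isT : 38 < 40) G2.
  have Ho := ev_state wf4 (isT : 39 < 40) G3.
  have HX : ev w M4 (A 1 (Op Div e_h e_lw)) (bits B (h %/ lw * lw) lw).
    have E : cell p M4 1 (h %/ lw) = cell p M 1 (h %/ lw) by rewrite C4 // C2 // C3 // C0.
    by rewrite -(tree_bits tM) // -E; evs.
  have E := bits_bset B h v (h %/ lw * lw) lw.
  have E0 := bits_bset B h false (h %/ lw * lw) lw.
  have hin := block_mem h (h %/ lw) (lw_gt0 ok); rewrite eqxx in hin.
  have hm : h - h %/ lw * lw = h %% lw by rewrite {1}(divn_eq h lw) addKn.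
  rewrite hin !mul1n hm in E E0; rewrite -/B' in E; rewrite mul0n addn0 in E0.
  have le1 := bits_lt B (h %/ lw * lw) lw; have le2 := bits_lt B' (h %/ lw * lw) lw.
  have lww := exp2_w (v_lw ok).
  have hlt : 2 ^ (h %% lw) < 2 ^ w.
    by rewrite ltn_exp2l //; apply: leq_trans (v_lw ok); rewrite ltn_pmod // (lw_gt0 ok).
  have bm (b' : bool) : b' * 2 ^ (h %% lw) <= 2 ^ (h %% lw) by case: b'; rewrite ?mul1n.
  eapply ev_eq; first (evs; move: E E0 le1 le2 lww hlt (bm v) (bm (B h)); clear; lia).
  by move: E E0 le1 le2 lww hlt (bm v) (bm (B h)); clear; lia.
have R1 := runs_wa ok wf4 (isT : 0 < 1 < 8) (ev_div (evh _ good4) (ev_lw ok wf4)) E1 iN.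
have [good1 C1] := step _ 1 _ (bits B' (h %/ lw * lw) lw) good4 isT iN.
set M1 := upd p M4 1 _ _ in R1 good1 C1.
exists M1; split.
- by do 4?[apply: runs_seq; first eassumption].
- by case: good1.
- split.
  + move=> i Hi; rewrite C1 // C4 // C2 // C3 // C0 //=; case: eqP => [->//|ne].
    rewrite (tree_bits tM) // bits_bset_out // block_mem ?(lw_gt0 ok) //; exact/eqP.
  + move=> i Hi; rewrite C1 // C4 // C2 // C3 // C0 //=; case: eqP => [->//|ne].
    rewrite (tree_node1 tM) // prefixes_bset_out // [F * _]mulnC block_mem ?(S_gt0 ok) //; exact/eqP.
  + move=> i Hi; rewrite C1 // C4 // C2 // C3 // C0 //=; case: eqP => [->//|ne].
    rewrite (tree_node2 tM) // prefixes_bset_out // [F * _]mulnC block_mem ?(L_gt0 ok) //; exact/eqP.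
  + move=> i Hi; rewrite C1 // C4 // C2 // C3 // C0 //=; case: eqP => [->//|ne].
    rewrite (tree_total tM) // cnt_bset_out // block_mem ?(L_gt0 ok) //; exact/eqP.
  + move=> i Hi; rewrite bset_neq ?(tree_out tM) //; by apply/eqP; move: Hi hN; clear; lia.
move=> k i Hk nk Hi n0; rewrite C1 // C4 // C2 // C3 // C0 // n0.
have {nk} : (k == 0) || (4 < k) by move: nk; clear; lia.
by case: k Hk Hi n0 => [|[|[|[|[|k]]]]].
Qed.

End Tree.

(** * The directory of ones *)

(** A history is a total function of which the first [K] values matter; appending overwrites the
    value at [K] and leaves all earlier counts alone. *)
Lemma bset_cnt c K v k : k <= K -> cnt (bset c K v) 0 k = cnt c 0 k.
Proof. by move=> Hk; apply: eq_cnt => j Hj; rewrite bset_neq //; lia. Qed.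

Lemma bset_cntS c K (v : bool) : cnt (bset c K v) 0 K.+1 = cnt c 0 K + v.
Proof. by rewrite cntS bset_cnt // bset_eq. Qed.

Lemma pred_divn q G : 0 < G -> q %% G != 0 -> q.-1 %/ G = q %/ G.
Proof.
move=> G0 nz; have := divn_eq q G; have := ltn_pmod q G0.
case: (q %% G) nz => // r _ rG {1}->.
by rewrite addnS /= divnMDl // (divn_small (ltnW rG)) addn0.
Qed.

Lemma pred_divn_lt q G : 0 < G -> q %% G = 0 -> 0 < q -> q.-1 %/ G < q %/ G.
Proof.
by move=> G0 r0 q0; rewrite ltn_divLR // divnK ?prednK //; apply/eqP.
Qed.

Section Directory.

Variables (w : nat) (p : params).
Hypothesis ok : valid w p.

Local Notation N := (par_N p).
Local Notation L := (par_L p).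
Local Notation M := (par_M p).
Local Notation G := (par_G p).
Local Notation Hs := (par_Hs p).
Local Notation Ls := (par_Ls p).
Local Notation Lsz := (par_Lsz p).

Definition slot k := k %% N %/ L.
(** Blocks numbered along the whole history, [M] per turn of the array. This number never wraps, so
    it can count boundaries; its residue modulo [M] is the slot. *)
Definition blk k := k %/ N * M + slot k.

Lemma slot_ltM k : slot k < M.
Proof. by apply: slot_lt; rewrite ltn_pmod // (N_gt0 ok). Qed.

Lemma blk_slot k : blk k %% M = slot k.
Proof. by rewrite modnMDl modn_small // slot_ltM. Qed.

Lemma blk_addN k : blk (k + N) = blk k + M.
Proof. by rewrite /blk /slot divnDr ?dvdnn // divnn (N_gt0 ok) modnDr addn1 mulSn; lia. Qed.

Lemma blk_mono k k' : k <= k' -> blk k <= blk k'.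
Proof.
move=> Hk; have Hd := leq_div2r N Hk; rewrite /blk.
have [lt|le] := ltnP (k %/ N) (k' %/ N).
  have := slot_ltM k; have : (k %/ N).+1 * M <= k' %/ N * M by rewrite leq_mul2r lt orbT.
  by rewrite mulSn; lia.
have E : k %/ N = k' %/ N by lia.
rewrite E leq_add2l /slot leq_div2r //.
by have := divn_eq k N; have := divn_eq k' N; rewrite E; lia.
Qed.

(* Ones are numbered in order of arrival and put into groups of [G].  [X g] is
   the number of groups before [g] that meet several blocks, [E g] tells
   whether [g] itself does; [x], [e] are their values at the latest group and
   [bl] is the block of the latest one.  An entry below [M] is a block, others
   are log rows.  [d_potential] bounds the rows alive by the block boundaries. *)
Record dir (info log : nat -> nat) (lam ci : nat) (c : nat -> bool) (K : nat)
    (X : nat -> nat) (E : nat -> bool) (x : nat) (e : bool) (bl : nat) : Prop := Dir {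
  d_lam : lam = x %% Ls;
  d_ci : ci = if e then M + lam else ci;
  d_ciM : ~~ e -> ci < M;
  d_eM : e -> 1 < M;
  d_bl : bl <= blk K;
  d_blci : ~~ e -> 0 < cnt c 0 K -> bl %% M = ci;
  d_cur : forall k, k < K -> c k -> cnt c 0 k %/ G = (cnt c 0 K).-1 %/ G ->
    [/\ X (cnt c 0 k %/ G) = x, E (cnt c 0 k %/ G) = e & ~~ e -> slot k = ci];
  d_old : forall k, k < K -> c k -> cnt c 0 k %/ G != (cnt c 0 K).-1 %/ G ->
    X (cnt c 0 k %/ G) + E (cnt c 0 k %/ G) <= x;
  d_potential : forall k, k < K -> c k ->
    x + e + blk k <= X (cnt c 0 k %/ G) + 1 + bl;
  d_info : forall k, k < K -> c k -> K <= k + N ->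
    info ((cnt c 0 k %/ G) %% Hs) =
      if E (cnt c 0 k %/ G) then M + X (cnt c 0 k %/ G) %% Ls else slot k;
  d_log : forall k, k < K -> c k -> K <= k + N -> 1 < M ->
    E (cnt c 0 k %/ G) || (cnt c 0 k %/ G == (cnt c 0 K).-1 %/ G) ->
    log (X (cnt c 0 k %/ G) %% Ls * G + cnt c 0 k %% G) = k %% N;
  d_EM : forall k, k < K -> c k -> E (cnt c 0 k %/ G) -> 1 < M }.

Lemma cnt_one_lt (c : nat -> bool) k K : k < K -> c k -> cnt c 0 k < cnt c 0 K.
Proof.
by move=> Hk ck; apply: leq_trans (cnt_mono c 0 Hk); rewrite cntS add0n ck addn1.
Qed.

Lemma cnt_window c k K : k <= K -> cnt c 0 K <= cnt c 0 k + (K - k).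
Proof.
by move=> Hk; rewrite -{1}(subnKC Hk) cnt_cat leq_add2l cnt_le.
Qed.

Lemma group_dist a q : a <= q -> q <= a + N -> q %/ G < a %/ G + Hs.
Proof.
move=> H1 H2; have := leq_div2r G H2; have G0 := v_G ok.
rewrite /par_Hs; have : (a + N) %/ G <= a %/ G + N %/ G + 1.
  by rewrite divnD // leq_add2l leq_b1.
by lia.
Qed.

Lemma group_mod_neq a q : a <= q -> q <= a + N -> a %/ G != q %/ G ->
  (a %/ G) %% Hs != (q %/ G) %% Hs.
Proof.
move=> H1 H2; have := group_dist H1 H2; have := leq_div2r G H1.
move=> le lt ne; apply/eqP => Em; case/eqP: ne.
have := congr1 (modn^~ Hs) Em => /=.
have Ed : q %/ G - a %/ G = 0 %[mod Hs].
  by apply/eqP; rewrite mod0n -/(dvdn _ _) -eqn_mod_dvd // Em.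
by move: Ed; rewrite mod0n modn_small; move: le lt; move: (q %/ G) (a %/ G) Hs => x y u; clear; lia.
Qed.

Lemma row_neq a x : 1 < M -> a < x -> x < a + Ls -> a %% Ls != x %% Ls.
Proof.
move=> M1 H1 H2; apply/eqP => Em.
have : x - a = 0 %[mod Ls].
  by apply/eqP; rewrite mod0n -/(dvdn _ _) -eqn_mod_dvd ?Em // ltnW.
by rewrite mod0n modn_small; move: H1 H2; clear; lia.
Qed.

Lemma dir_zero info log lam ci c K X E x e bl :
  dir info log lam ci c K X E x e bl ->
  dir info log lam ci (bset c K false) K.+1 X E x e bl.
Proof.
case=> *; have CK : cnt (bset c K false) 0 K.+1 = cnt c 0 K by rewrite bset_cntS addn0.
have old k : k < K.+1 -> bset c K false k -> [/\ k < K, c k & cnt (bset c K false) 0 k = cnt c 0 k].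
  move=> Hk; rewrite bset_cnt // /bset; case: eqP => // ne ck; split=> //; lia.
split=> //; rewrite ?CK //.
- by apply: leq_trans (blk_mono (leqnSn K)).
- by move=> k Hk /(old _ Hk)[? ? ->]; auto.
- by move=> k Hk /(old _ Hk)[? ? ->]; auto.
- by move=> k Hk /(old _ Hk)[? ? ->]; auto.
- by move=> k Hk /(old _ Hk)[? ? ->] ?; have ? : K <= k + N by [lia]; auto.
- by move=> k Hk /(old _ Hk)[? ? ->] ?; have ? : K <= k + N by [lia]; auto.
- by move=> k Hk /(old _ Hk)[? ? ->]; eauto.
Qed.

(** A new group moves to the next row only if the closing group spilled, that is if [ci] is at least
    [M]. The row of a group that stayed in one block is simply overwritten by the next group. *)
Definition next_lam lam ci q := if q %% G == 0 then (lam + (M.-1 < ci)) %% Ls else lam.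
Definition next_ci lam ci q s :=
  if q %% G == 0 then s else if ci == s then ci else M + lam.

Definition fset (f : nat -> nat) i v := fun j => if j == i then v else f j.

Lemma dir_one info log lam ci c K X E x e bl q :
  q = cnt c 0 K ->
  dir info log lam ci c K X E x e bl ->
  let ci' := next_ci lam ci q (slot K) in
  let lam' := next_lam lam ci q in
  exists X' E' x' e' bl',
  dir (fset info ((q %/ G) %% Hs) ci')
      (fset log ((lam' * G + q %% G) %% Lsz) (K %% N)) lam' ci'
      (bset c K true) K.+1 X' E' x' e' bl'.
Proof.
move=> Eq D ci' lam'; have [dlam dci dciM deM dbl dblci dcur dold dpot dinfo dlog dEM] := D; rewrite -Eq in dcur dold dblci dlog.
have G0 := v_G ok; have Ls0 := v_Ls ok.
move Enew : (q %% G == 0) => new.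
(* Opening a group closes the previous one, which [x'] counts if it met several blocks. A group that
   has left its first block has [ci] at least [M], so the comparison with the slot keeps [e']
   true. *)
have [x' Ex'] : exists x', x' = if new then x + e else x by eexists.
have [e' Ee'] : exists e', e' = if new then false else ci != slot K by eexists.
have [X' EX'] : exists X', X' = fset X (q %/ G) x' by eexists.
have [E' EE'] : exists E', E' = fun g => if g == q %/ G then e' else E g by eexists.
have sK := slot_ltM K.
have Mci : (M.-1 < ci) = e.
  by move: dci dciM sK; clear; case: e => [-> _|_ /(_ isT)]; lia.
have Hlam : lam' = x' %% Ls.
  rewrite /lam' /next_lam Ex' Enew; case: (new) => //.
  by rewrite Mci dlam modnDml.
have lam'Ls : lam' < Ls by rewrite Hlam ltn_pmod.
have e_ci : e -> ci != slot K.
  by move: dci sK; clear; case: e => // ->; lia.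
have He : ~~ e' -> ci' = slot K.
  by rewrite Ee' /ci' /next_ci Enew; case: (new) => //; rewrite negbK => /eqP ->; rewrite eqxx.
have He1 : e' -> ci' = M + lam'.
  by rewrite Ee' /ci' /next_ci /lam' /next_lam Enew; case: (new) => // /negPf ->.
have CK : cnt (bset c K true) 0 K.+1 = q.+1 by rewrite bset_cntS addn1 Eq.
have cur : ~~ new -> q.-1 %/ G = q %/ G by rewrite -Enew; exact: pred_divn.
have curN : new -> 0 < q -> q.-1 %/ G < q %/ G.
  by rewrite -Enew => /eqP; exact: pred_divn_lt.
have eM' : e' -> 1 < M.
  rewrite Ee'; case: (new) => // /eqP ne; case: (boolP e) => [/deM //|/dciM].
  by move: ne sK; clear; lia.
exists X', E', x', e', (blk K).
have old k : k < K.+1 -> bset c K true k ->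
    cnt (bset c K true) 0 k = cnt c 0 k /\ (k = K \/ [/\ k < K, c k & cnt c 0 k < q]).
  move=> Hk; rewrite bset_cnt // /bset; case: eqP => [->|ne ck]; first by split=> //; left.
  split=> //; right; have lt : k < K by move: Hk ne; clear; lia.
  by split=> //; rewrite Eq; apply: cnt_one_lt.
have XE : X' (q %/ G) = x' /\ E' (q %/ G) = e' by rewrite EX' /fset EE' eqxx.
have XEo g : g != q %/ G -> X' g = X g /\ E' g = E g.
  by rewrite EX' /fset EE' => /negPf ->.
(* At most [M] blocks separate a position of the window from the head, so [d_potential] allows at
   most [M + 1] spilled groups in between. *)
have le_pot k : k < K -> c k -> K <= k + N -> x' <= X (cnt c 0 k %/ G) + M + 1.
  move=> k1 k2 k3; have H1 := dpot k k1 k2.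
  have H2 : blk K <= blk k + M by rewrite -blk_addN blk_mono.
  by rewrite Ex'; move: H1 H2 dbl; clear; case: new; lia.
(* When a group leaves its first block, the latest one lies in an earlier block than [K]; this
   boundary pays for the increase of [e] in [d_potential]. *)
have slotE : ~~ e -> 0 < q -> ci != slot K -> bl < blk K.
  move=> e0 q0 ne; rewrite ltn_neqAle dbl andbT; apply: contraNneq ne => Eb.
  by rewrite -blk_slot -Eb dblci.
have grp k : cnt c 0 k < q -> new -> cnt c 0 k %/ G != q %/ G.
  move=> lt nw; have := curN nw; have := leq_div2r G (_ : cnt c 0 k <= q.-1).
  by move=> H1 H2; rewrite neq_ltn; apply/orP; left; apply: leq_ltn_trans (H1 _) (H2 _); move: lt; clear; lia.
have row : 1 < M -> (lam' * G + q %% G) %% Lsz = lam' * G + q %% G.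
  move=> /(v_log ok)[_ ->]; rewrite modn_small //.
  have : lam'.+1 * G <= Ls * G by rewrite leq_mul2r lam'Ls orbT.
  by have := ltn_pmod q G0; rewrite mulSn; clear; lia.
split; rewrite ?CK //=.
- by case: (boolP e') => // /He1.
- by move=> /He ->.
- exact: blk_mono.
- by move=> /He -> _; exact: blk_slot.
- move=> k Hk ck; have [Ek [EK|[k1 k2 k3]]] := old k Hk ck; rewrite Ek.
    by rewrite EK -Eq; case: XE => -> -> _; split => // /He ->.
  move=> Eg; case: (boolP new) => nw; first by have := grp k k3 nw; rewrite Eg eqxx.
  rewrite Eg; case: XE => -> ->; split=> // ne'.
  have [|_ _ Hs'] := dcur k k1 k2; first by rewrite cur.
  have /eqP Eci : ci == slot K by move: ne'; rewrite Ee' (negPf nw) negbK.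
  have e0 : ~~ e by apply/negP => /e_ci; rewrite Eci eqxx.
  by rewrite (Hs' e0) (He ne').
- move=> k Hk ck; have [Ek [EK|[k1 k2 k3]]] := old k Hk ck; rewrite Ek.
    by rewrite EK -Eq eqxx.
  move=> ne; have [-> ->] := XEo _ ne.
  have Hx : x <= x' by rewrite Ex'; case: (new) => //; exact: leq_addr.
  have [Ec|nc] := eqVneq (cnt c 0 k %/ G) (q.-1 %/ G).
    have nw : new by apply/negPn/negP => /cur Ec'; rewrite Ec Ec' eqxx in ne.
    by have [-> -> _] := dcur k k1 k2 Ec; rewrite Ex' nw.
  by apply: leq_trans (dold k k1 k2 nc) Hx.
- move=> k Hk ck; have [Ek [EK|[k1 k2 k3]]] := old k Hk ck; rewrite Ek.
    by rewrite EK -Eq; case: XE => -> _; have := leq_b1 e'; clear; lia.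
  have Hp := dpot k k1 k2; have bk := blk_mono (ltnW k1).
  have [Eg|ne] := eqVneq (cnt c 0 k %/ G) (q %/ G).
    by rewrite Eg; case: XE => -> _; have := leq_b1 e'; move: bk; clear; lia.
  have [-> _] := XEo _ ne; rewrite Ex' Ee'; case: (boolP new) => nw; first by move: Hp dbl; clear; rewrite addn0; lia.
  have [Eci|nci] := eqVneq ci (slot K) => /=; first by move: Hp dbl (leq0n e); clear; lia.
  case: (boolP e) => [e1|e0]; first by move: Hp dbl; rewrite e1; clear; lia.
  by have := slotE e0 (leq_ltn_trans (leq0n _) k3) nci; move: Hp; clear; lia.
- move=> k Hk ck; have [Ek [EK|[k1 k2 k3]]] := old k Hk ck; rewrite Ek => win.
    rewrite EK -Eq /fset eqxx; case: XE => -> ->.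
    by case: (boolP e') => [/He1 ->|/He ->] //; rewrite Hlam.
  have [Eg|ne] := eqVneq (cnt c 0 k %/ G) (q %/ G).
    rewrite Eg /fset eqxx; case: XE => -> ->.
    case: (boolP e') => [/He1 ->|ne']; first by rewrite Hlam.
    have nw : ~~ new by apply/negP => nw; have := grp k k3 nw; rewrite Eg eqxx.
    have [|_ _ Hs'] := dcur k k1 k2; first by rewrite cur.
    have /eqP Eci : ci == slot K by move: ne'; rewrite Ee' (negPf nw) negbK.
    have e0 : ~~ e by apply/negP => /e_ci; rewrite Eci eqxx.
    by rewrite (Hs' e0) (He ne').
  have [-> ->] := XEo _ ne; rewrite /fset ifF; first by apply: dinfo => //; move: win; clear; lia.
  apply/negbTE/group_mod_neq => //; first exact: ltnW.
  by have := @cnt_window c k K (ltnW k1); rewrite -Eq; move: win; clear; lia.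
- move=> k Hk ck; have [Ek [EK|[k1 k2 k3]]] := old k Hk ck; rewrite Ek => win M1.
    by rewrite EK -Eq; case: XE => -> _ _; rewrite /fset row // Hlam eqxx.
  have win' : K <= k + N by move: win; clear; lia.
  have [Eg|ne] := eqVneq (cnt c 0 k %/ G) (q %/ G).
    rewrite Eg; case: XE => -> _ _; rewrite /fset row // -Hlam eqn_add2l ifF.
      have nw : ~~ new by apply/negP => nw; have := grp k k3 nw; rewrite Eg eqxx.
      have Ec : cnt c 0 k %/ G = q.-1 %/ G by rewrite cur.
      have [Hx _ _] := dcur k k1 k2 Ec.
      have := dlog k k1 k2 win' M1; rewrite -Ec eqxx orbT Hx => /(_ isT).
      by rewrite Hlam Ex' (negPf nw).
    apply/negP => /eqP Em; have := divn_eq q G; have := divn_eq (cnt c 0 k) G.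
    by rewrite Eg Em => E1 E2; move: k3; rewrite E1 -E2 ltnn.
  have [-> ->] := XEo _ ne; rewrite orbF => Eg; rewrite /fset row // ifF.
    by apply: dlog; rewrite // Eg.
  have [LsE _] := v_log ok M1.
  have Xx : X (cnt c 0 k %/ G) < x'.
    have [Ec|nc] := eqVneq (cnt c 0 k %/ G) (q.-1 %/ G).
      have nw : new by apply/negPn/negP => /cur Ec'; rewrite Ec Ec' eqxx in ne.
      by have [-> Ee _] := dcur k k1 k2 Ec; rewrite Ex' nw -Ee Eg addn1.
    have := dold k k1 k2 nc; rewrite Eg Ex'; clear; case: new; lia.
  (* Spilled groups older than the current one and still in the window have row numbers from
     [x' - (M + 1)] to [x' - 1], so with [M + 2] rows none of them is the row being written. *)
  have xX : x' < X (cnt c 0 k %/ G) + Ls by have := le_pot k k1 k2 win'; rewrite LsE; clear; lia.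
  have := row_neq M1 Xx xX; rewrite -Hlam => nr.
  apply/negP => /eqP Em; case/eqP: nr.
  have := congr1 (divn^~ G) Em => /=.
  by rewrite !divnMDl // !(divn_small (ltn_pmod _ G0)) !addn0.
- move=> k Hk ck; have [Ek [EK|[k1 k2 k3]]] := old k Hk ck; rewrite Ek.
    by rewrite EK -Eq; case: XE => _ ->; exact: eM'.
  have [->|ne] := eqVneq (cnt c 0 k %/ G) (q %/ G); first by case: XE => _ ->; exact: eM'.
  by have [_ ->] := XEo _ ne; exact: dEM.
Qed.

End Directory.

(** * The window of chunk bits: counting *)

Definition posE j := Op Mod (Op Defs.Sub (Op Add e_h e_N) j) e_N.
Definition next_slotE s := Op Mod (Op Add s (Const 1)) e_M.
Definition diffE q r := Op Mod (Op Defs.Sub (Op Add q e_Z) r) e_Z.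

(** Second names for the two scratch cells, used as operand and result of the queries. *)
Definition e_x := V 38.
Definition e_y := V 39.

(** [h mod L] bits precede the head in its own block. A longer range is split at the end of the
    block of its first bit: block total minus rank up to there, then [Q] minus the count stored for
    the next block. A shorter range is a difference of two ranks in one block. *)
Definition count_cmd :=
  let s := Op Div (posE e_x) e_L in
  If (Op Lt (Op Mod e_h e_L) e_x)
    (WV 39 (Op Defs.Sub (Op Add (diffE e_Q (A 5 (next_slotE s))) (A 4 s)) (rankE (posE e_x))))
    (WV 39 (Op Defs.Sub (rankE e_h) (rankE (Op Defs.Sub e_h e_x)))).

(** [q] is the arrival number of the wanted one, modulo [Z]. Its rank in block [v] is the block
    total minus the ones from it to the end of the block, so newer bits at the beginning of the
    block are counted correctly too. *)
Definition select_cmd :=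
  let q := diffE e_Q e_x in
  let v := A 6 (Op Div q e_G) in
  If (Op Lt (rankE e_h) e_x)
    (If (Op Lt v e_M)
      (WV 39 (selE v (Op Defs.Sub (A 4 v) (diffE (A 5 (next_slotE v)) q))))
      (WV 39 (A 7 (Op Mod (Op Add (Op Mul (Op Defs.Sub v e_M) e_G) (Op Mod q e_G)) e_Lsz))))
    (WV 39 (selE (Op Div e_h e_L) (Op Defs.Sub (rankE e_h) e_x))).

Lemma mod_sub Z a b : b <= a -> a - b < Z -> (a %% Z + Z - b %% Z) %% Z = a - b.
Proof.
move=> Hb Hab; have Z0 : 0 < Z by lia.
have E : a = (a - b) + b by lia.
have bZ := ltn_pmod b Z0.
rewrite -addnBA; last exact: ltnW.
rewrite modnDml {1}E -addnA -modnDmr.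
have -> : (b + (Z - b %% Z)) %% Z = 0.
  rewrite -modnDml addnBA; last exact: ltnW.
  by rewrite addnC addnK modnn.
by rewrite addn0 modn_small.
Qed.

Section Window.

Variables (w : nat) (p : params).
Hypothesis ok : valid w p.

Local Notation N := (par_N p).
Local Notation L := (par_L p).
Local Notation M := (par_M p).
Local Notation G := (par_G p).
Local Notation Hs := (par_Hs p).
Local Notation Ls := (par_Ls p).
Local Notation Lsz := (par_Lsz p).
Local Notation Z := (par_Z p).

(* [m] stores the last [N] bits [c (K - N), ..., c (K - 1)] of a history; bit
   [c k] is at position [k %% N] of a circular array. *)
Record win (m : memory) (c : nat -> bool) (K : nat) : Prop := Win {
  win_wf : wf p m;
  win_K : N <= K;
  win_h : cell p m 0 34 = K %% N;
  win_Q : cell p m 0 35 = cnt c 0 K %% Z;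
  win_tree : exists2 B, tree p m B &
    forall k, k < K -> K <= k + N -> B (k %% N) = c k;
  win_start : forall k, k <= K -> K < k + N -> k %% N %% L = 0 ->
    cell p m 5 (slot p k) = cnt c 0 k %% Z;
  win_dir : exists X E x e bl,
    dir p (cell p m 6) (cell p m 7) (cell p m 0 36) (cell p m 0 37) c K X E x e bl }.

Lemma L_bound : 2 * L < 2 ^ w.
Proof.
have Fz : 0 < par_F p := v_F ok; have z1 := v_z ok; have zF := v_zF ok.
apply: (@leq_trans (2 * 2 ^ (par_z p).-1)); first by rewrite ltn_mul2l /= (v_Lz ok).
rewrite -expnS prednK; last exact: ltnW.
by rewrite leq_exp2l //; apply: leq_trans zF; rewrite leq_pmulr.
Qed.

Lemma NZ : N < Z.
Proof.
rewrite /par_Z /par_Hs mulnDl; have := divn_eq N G; have := ltn_pmod N (v_G ok).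
by lia.
Qed.

(** * From positions in the circular array to the history *)

Section Physical.

Variables (m : memory) (c : nat -> bool) (K : nat) (B : nat -> bool).
Hypothesis treeB : tree p m B.
Hypothesis BE : forall k, k < K -> K <= k + N -> B (k %% N) = c k.

Lemma cnt_physical k l : K <= k + N -> k + l <= K -> k %% N + l <= N ->
  cnt B (k %% N) l = cnt c k l.
Proof.
move=> H1 H2 H3; apply: eq_bigr => -[j Hj] _ /=.
have H4 : k + j < K by lia.
have H5 : K <= k + j + N by lia.
have E : (k + j) %% N = k %% N + j by rewrite -modnDml; apply: modn_small; lia.
by rewrite -BE // E.
Qed.

(* [k'] is the end of the block of [k]; bits beyond position [N] are zero. *)
Lemma block_end k : k < K -> K <= k + N -> K %% N %% L < K - k ->
  exists k', [/\ k < k' <= K, k' %% N %% L = 0, slot p k' = (slot p k).+1 %% M &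
    cnt B (k %% N) (L - k %% N %% L) = cnt c k (k' - k)].
Proof.
move=> k1 k2 k3; have N0 := N_gt0 ok; have L0 := L_gt0 ok.
have xN := ltn_pmod k N0; have xL := ltn_pmod (k %% N) L0.
have Ex := divn_eq (k %% N) L; rewrite -/(slot p k) in Ex.
(* The last block ends at [N], where the array wraps around, even if it is shorter than [L]. *)
have [bend Eb] : exists y, y = minn ((slot p k).+1 * L) N by eexists.
have bN : bend <= N by rewrite Eb geq_minr.
have bS : bend <= slot p k * L + L by rewrite Eb mulSn addnC geq_minl.
have bx : k %% N < bend by rewrite Eb leq_min xN mulSn andbT; move: Ex xL; clear; lia.
(* Otherwise the head would lie in the block of [k], exactly [K - k] positions further on, and
   [K %% N %% L] would be at least [K - k]. *)
have k'K : k + (bend - k %% N) <= K.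
  rewrite leqNgt; apply/negP => gt.
  have lt : k %% N + (K - k) < N by move: gt bN k1 bx; clear; lia.
  have Kx : K %% N = k %% N + (K - k).
    by rewrite -(modn_small lt) modnDml subnKC // ltnW.
  have lt' : k %% N %% L + (K - k) < L by move: gt bS k1 bx Ex; clear; lia.
  have E : K %% N %% L = k %% N %% L + (K - k).
    by rewrite Kx Ex -addnA !modnMDl modn_mod modn_small.
  by move: k3; rewrite E; clear; lia.
have E' : (k + (bend - k %% N)) %% N = bend %% N.
  by rewrite -modnDml subnKC // ltnW.
have sM := slot_ltM ok k.
exists (k + (bend - k %% N)); split; first by rewrite k'K; move: bx; clear; lia.
- rewrite E' Eb; case: leqP => H; last by rewrite modnn mod0n.
  have [->|ne] := eqVneq ((slot p k).+1 * L) N; first by rewrite modnn mod0n.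
  have lt : (slot p k).+1 * L < N by rewrite ltn_neqAle ne.
  by rewrite (modn_small lt) modnMl.
- rewrite /slot E' Eb; have [lt|ge] := ltnP (slot p k).+1 M.
    have H : (slot p k).+1 * L < N.
      move: lt; rewrite /par_M ltnS leq_divRL // => H.
      by rewrite -(prednK N0) ltnS.
    by rewrite (minn_idPl (ltnW H)) modn_small // mulnK // modn_small.
  have EM : (slot p k).+1 = M by apply/eqP; rewrite eqn_leq sM.
  have H : N <= M * L.
    by rewrite /par_M mulSn; have := divn_eq N.-1 L; have := ltn_pmod N.-1 L0; move: N0; clear; lia.
  by rewrite EM (minn_idPr H) !modnn div0n.
rewrite addKn -cnt_physical //; last by rewrite subnKC // ltnW.
have le : bend - k %% N <= L - k %% N %% L by move: bS Ex; clear; lia.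
rewrite -{1}(subnKC le) cnt_cat [X in _ + X]big1 ?addn0 // => -[j Hj] _ /=.
rewrite subnKC; last exact: ltnW.
have [bEN|ltN] := leqP N bend.
  by rewrite (tree_out treeB) //; apply: leq_trans bEN (leq_addr _ _).
have E : bend = (slot p k).+1 * L.
  by move: Eb ltN; rewrite /minn; case: ifP => // _ ->; rewrite ltnn.
by move: Hj; rewrite E mulSn; move: Ex xL; clear; lia.
Qed.

End Physical.

Section Query.

Variables (m : memory) (c : nat -> bool) (K : nat).
Hypothesis winm : win m c K.

Let wfm := win_wf winm.

Lemma ev_h : ev w m e_h (K %% N).
Proof. exact: (ev_state ok wfm (isT : 34 < 40) (win_h winm)). Qed.

Lemma ev_Q : ev w m e_Q (cnt c 0 K %% Z).
Proof. exact: (ev_state ok wfm (isT : 35 < 40) (win_Q winm)). Qed.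

Lemma ev_pos e j : ev w m e j -> j <= N -> ev w m (posE e) ((K - j) %% N).
Proof.
move=> He Hj; have NB := N_bound ok; have hN := ltn_pmod K (N_gt0 ok).
have Hh := ev_h; have KN := win_K winm.
eapply ev_eq; first (rewrite /posE; evs; lia).
rewrite -addnBA // modnDml addnBA // -[in RHS](modnDr (K - j)); congr (_ %% _).
by lia.
Qed.

Lemma ev_next e s : ev w m e s -> s < M -> ev w m (next_slotE e) (s.+1 %% M).
Proof.
move=> He Hs; have MLs := v_ML ok; have Ls0 := v_Ls ok; have w100 := w_100 ok.
by eapply ev_eq; first (rewrite /next_slotE; evs; lia); rewrite addn1.
Qed.

Lemma ev_diff e1 e2 a b : ev w m e1 (a %% Z) -> ev w m e2 (b %% Z) ->
  b <= a -> a - b < Z -> ev w m (diffE e1 e2) (a - b).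
Proof.
move=> H1 H2 Hb Hab; have Z2 := v_Z ok; have Z0 : 0 < Z by lia.
have := ltn_pmod a Z0; have := ltn_pmod b Z0 => *.
by eapply ev_eq; first (rewrite /diffE; evs; lia); rewrite mod_sub.
Qed.

Lemma ev_start e k : ev w m e (slot p k) -> k <= K -> K < k + N -> k %% N %% L = 0 ->
  ev w m (A 5 e) (cnt c 0 k %% Z).
Proof.
move=> He k1 k2 k3; rewrite -(win_start winm k1 k2 k3); evs.
exact: (slot_ltM ok k).
Qed.

Lemma cnt_sub k : k <= K -> cnt c 0 K - cnt c 0 k = cnt c k (K - k).
Proof. by move=> Hk; rewrite -{1}(subnKC Hk) cnt_cat addKn. Qed.

Lemma cnt_slot_split B x : cnt B (x %/ L * L) L =
  cnt B (x %/ L * L) (x %% L) + cnt B x (L - x %% L).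
Proof.
have xL := ltn_pmod x (L_gt0 ok).
by rewrite -{3}(subnKC (ltnW xL)) cnt_cat -divn_eq.
Qed.

Lemma runs_count j : cell p m 0 38 = j -> 0 < j <= N ->
  runs w count_cmd m (upd p m 0 39 (cnt c (K - j) j)).
Proof.
move=> Ej /andP[j0 jN]; have [B tB BE] := win_tree winm.
have NB := N_bound ok; have LB := L_bound; have KN := win_K winm.
have Hx := ev_state ok wfm (isT : 38 < 40) Ej; rewrite -/e_x in Hx.
have Hh := ev_h; have N0 := N_gt0 ok; have hN := ltn_pmod K N0.
have hL := leq_mod (K %% N) L.
apply: (runs_if (v := (K %% N %% L < j : nat))) => [|lt|ge].
- by rewrite -/(ev w m _ _); evs.
- have {}lt : K %% N %% L < j by case: leqP lt.
  apply: (runs_wv ok wfm) => //.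
  have [k Ek] : exists k, k = K - j by eexists.
  have Ekj : K - k = j by move: Ek KN jN; clear; lia.
  have [k1 k2] : k < K /\ K <= k + N by move: Ek KN j0 jN; clear; lia.
  have lt' : K %% N %% L < K - k by rewrite Ekj.
  have [k' [/andP[k3 k4] k5 k6 Et]] := block_end tB BE k1 k2 lt'.
  have Hp := ev_pos Hx jN; rewrite -Ek in Hp.
  have Hs : ev w m (Op Div (posE e_x) e_L) (slot p k) by evs.
  have sM := slot_ltM ok k.
  have Hn := ev_next Hs sM; rewrite -k6 in Hn.
  have k7 : K < k' + N by move: k2 k3; clear; lia.
  have Hc := ev_start Hn k4 k7 k5.
  have lC : cnt c 0 k' <= cnt c 0 K by apply: cnt_mono.
  have dC : cnt c 0 K - cnt c 0 k' <= N.
    by rewrite cnt_sub //; have := cnt_le c k' (K - k'); move: k2 k3; clear; lia.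
  have Hd := ev_diff ev_Q Hc lC (leq_ltn_trans dC NZ).
  have Ht := ev_total ok wfm tB Hs sM.
  have xN := ltn_pmod k N0.
  have Hr := ev_rank ok wfm tB Hp xN.
  have Esp := cnt_slot_split B (k %% N); rewrite -/(slot p k) Et in Esp.
  have tL := cnt_le B (slot p k * L) L.
  rewrite -/(slot p k) in Hr.
  have k31 := ltnW k3.
  have Ej' : j = (k' - k) + (K - k') by move: Ekj k3 k4; clear; lia.
  have Esum : cnt c k j = cnt c k (k' - k) + (cnt c 0 K - cnt c 0 k').
    by rewrite cnt_sub // {1}Ej' cnt_cat subnKC.
  rewrite -Ek Esum; clear Ej' Esum.
  move: Hd Ht Hr; set x1 := cnt c 0 K - _ in dC *; set x2 := cnt B _ L in Esp tL *.
  set x3 := cnt B _ (_ %% L) in Esp *; set x4 := cnt c k _ in Esp *.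
  move=> Hd Ht Hr; eapply ev_eq; first (evs; move: Esp tL dC NB LB; clear; lia).
  by move: Esp; clear; lia.
- have {}ge : j <= K %% N %% L by case: leqP ge.
  apply: (runs_wv ok wfm) => //.
  have jh : j <= K %% N := leq_trans ge hL.
  have Hhj : ev w m (Op Defs.Sub e_h e_x) (K %% N - j) by evs; move: ge hL hN NB; clear; lia.
  have Hr1 := ev_rank ok wfm tB Hh hN.
  have hjN : K %% N - j < N by move: hN; clear; lia.
  have Hr2 := ev_rank ok wfm tB Hhj hjN.
  have Eh := divn_eq (K %% N) L.
  have Ed : (K %% N - j) = K %% N %/ L * L + (K %% N %% L - j) by rewrite {1}Eh addnBA.
  have hL' := ltn_pmod (K %% N) (L_gt0 ok).
  have lt : K %% N %% L - j < L by apply: leq_ltn_trans hL'; exact: leq_subr.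
  have E1 : (K %% N - j) %/ L = K %% N %/ L.
    by rewrite Ed divnMDl ?(L_gt0 ok) // (divn_small lt) addn0.
  have E2 : (K %% N - j) %% L = K %% N %% L - j by rewrite Ed modnMDl (modn_small lt).
  rewrite E1 E2 in Hr2.
  have Esp : cnt B (K %% N %/ L * L) (K %% N %% L) =
      cnt B (K %% N %/ L * L) (K %% N %% L - j) + cnt B (K %% N - j) j.
    by rewrite -{1}(subnK ge) cnt_cat Ed.
  have rL := cnt_le B (K %% N %/ L * L) (K %% N %% L).
  have -> : cnt c (K - j) j = cnt B (K %% N - j) j.
    have Ek : (K - j) %% N = K %% N - j.
      by rewrite {1}(divn_eq K N) -addnBA // modnMDl modn_small.
    rewrite -Ek (cnt_physical BE) // ?Ek; move: jh KN j0 jN hN; clear; lia.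
  move: Hr1 Hr2; set x1 := cnt B _ (K %% N %% L) in Esp rL *.
  set x2 := cnt B _ (_ - _) in Esp *; set x3 := cnt B _ j in Esp *.
  have hL2 := ltn_pmod (K %% N) (L_gt0 ok).
  move=> Hr1 Hr2; eapply ev_eq; first (evs; move: Esp rL hL2 NB LB; clear; lia).
  by move: Esp; clear; lia.
Qed.

End Query.

End Window.

(** * The window of chunk bits: selection *)

Section Window.

Variables (w : nat) (p : params).
Hypothesis ok : valid w p.

Local Notation N := (par_N p).
Local Notation L := (par_L p).
Local Notation M := (par_M p).
Local Notation G := (par_G p).
Local Notation Hs := (par_Hs p).
Local Notation Ls := (par_Ls p).
Local Notation Lsz := (par_Lsz p).
Local Notation Z := (par_Z p).


Lemma Hs_gt0 : 0 < Hs.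
Proof. by rewrite /par_Hs addn2. Qed.

Lemma log_lt a q : 1 < M -> a %% Ls * G + q %% G < Lsz.
Proof.
move=> /(v_log ok)[_ ->]; apply: (@leq_trans ((a %% Ls).+1 * G)).
  by rewrite mulSn addnC ltn_add2r ltn_pmod // (v_G ok).
by rewrite leq_mul2r ltn_pmod ?orbT // (v_Ls ok).
Qed.

Lemma dir_ext info log info' log' lam ci c K X E x e bl :
  (forall i, i < Hs -> info' i = info i) -> (forall i, i < Lsz -> log' i = log i) ->
  dir p info log lam ci c K X E x e bl -> dir p info' log' lam ci c K X E x e bl.
Proof.
move=> Hi Hl [*]; split=> //.
  by move=> k *; rewrite Hi ?ltn_pmod ?Hs_gt0 //; auto.
by move=> k *; rewrite Hl ?log_lt //; auto.
Qed.

Lemma win_frame m m' c K : win p m c K -> wf p m' ->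
  (forall k i, k < 8 -> i < len p k ->
    (k == 0) && (i \in [:: 0; 32; 33; 38; 39]) = false -> cell p m' k i = cell p m k i) ->
  win p m' c K.
Proof.
move=> [wfm KN Hh HQ [B tB BE] Hst [X [E [x [e [bl D]]]]]] wf' fr.
split=> //.
- by rewrite fr.
- by rewrite fr.
- exists B => //; apply: tree_frame tB => k i /andP[k0 k5] Hi.
  by rewrite fr //; [apply: ltn_trans k5 _ | case: k k0 {k5 Hi}].
- by move=> k k1 k2 k3; rewrite fr ?Hst // /len /=; exact: (slot_ltM ok).
exists X, E, x, e, bl; rewrite !(fr 0) //.
by apply: dir_ext D => i Hi; rewrite fr.
Qed.

Lemma cnt_inj (B : nat -> bool) s i j :
  B (s + i) -> B (s + j) -> cnt B s i = cnt B s j -> i = j.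
Proof.
wlog le : i j / i <= j => [wl Bi Bj Ec|].
  by case: (leqP i j) => H; [exact: wl | apply/esym/wl => //; exact: ltnW].
move=> Bi Bj Ec; apply/eqP; rewrite eqn_leq le /= leqNgt; apply/negP => lt.
by have := cnt_mono B s lt; rewrite cntS Bi Ec addn1 ltnn.
Qed.

Lemma last_one (c : nat -> bool) K mm : N <= K -> 0 < mm <= cnt c (K - N) N ->
  exists k, [/\ k < K, K <= k + N, c k & cnt c k (K - k) = mm].
Proof.
move=> KN /andP[m0 mle].
have lt : cnt c (K - N) N - mm < cnt c (K - N) N by move: m0 mle; clear; lia.
have [] := cnt_search1 lt; set i := \sum_(j < N) _ => iN Ei ci.
exists (K - N + i); split=> //; try by move: KN iN; clear; lia.
have EN : N = i + (K - (K - N + i)) by move: KN iN; clear; lia.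
have := cnt_cat c (K - N) i (K - (K - N + i)); rewrite -EN Ei.
by move: mle; clear; lia.
Qed.

Section Select.

Variables (m : memory) (c : nat -> bool) (K : nat).
Hypothesis winm : win p m c K.

Let wfm := win_wf winm.

Lemma ev_diff_mod e1 e2 a b : ev w m e1 (a %% Z) -> ev w m e2 b ->
  b <= a -> b <= Z -> ev w m (diffE e1 e2) ((a - b) %% Z).
Proof.
move=> H1 H2 Hb Hz; have Z2 := v_Z ok; have Z0 : 0 < Z := leq_ltn_trans (leq0n _) (NZ ok).
have := ltn_pmod a Z0 => aZ.
eapply ev_eq; first (rewrite /diffE; evs; move: aZ Z2 Hz; clear; lia).
rewrite -addnBA // modnDml addnBA // addnC -addnBA // modnDl //.
Qed.

Lemma runs_select mm : cell p m 0 38 = mm -> 0 < mm <= cnt c (K - N) N ->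
  exists k, [/\ k < K, K <= k + N, c k & cnt c k (K - k) = mm] /\
    runs w select_cmd m (upd p m 0 39 (k %% N)).
Proof.
move=> Em Hm; have [k [k1 k2 ck Ek]] := last_one (win_K winm) Hm.
exists k; split=> //.
have [B tB BE] := win_tree winm.
have [X [E [x [e [bl D]]]]] := win_dir winm.
have N0 := N_gt0 ok; have L0 := L_gt0 ok; have NZ' := NZ ok.
have NB := N_bound ok; have LB := L_bound ok; have KN := win_K winm.
have Hx := ev_state ok wfm (isT : 38 < 40) Em; rewrite -/e_x in Hx.
have Hh := ev_h ok winm; have hN := ltn_pmod K N0.
have Hr := ev_rank ok wfm tB Hh hN.
have mN : mm <= N by case/andP: Hm => _ /leq_trans; apply; exact: cnt_le.
have hL := leq_mod (K %% N) L; have hL' := ltn_pmod (K %% N) L0.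
have xN := ltn_pmod k N0.
have Bx : B (k %% N) by rewrite BE.
set h := K %% N in hL hL' Hh Hr hN *; set rh := cnt B _ _ in Hr.
have Erh : rh = cnt c (K - h %% L) (h %% L).
  have E0 : (K - h %% L) %% N = h %/ L * L.
    rewrite {1}(divn_eq K N) -/h -addnBA // modnMDl modn_small.
      by rewrite {1}(divn_eq h L) addnK.
    exact: leq_ltn_trans (leq_subr _ _) hN.
  have hK : h <= K by exact: leq_mod.
  rewrite -(cnt_physical BE); first by rewrite /rh E0.
  - by move: hL hN hK; clear; lia.
  - by rewrite subnK // (leq_trans hL).
  - by rewrite E0 -divn_eq ltnW.
(* The program does not know [k] yet, so it compares ranks instead of positions. The two tests agree
   because position [k] itself holds a one. *)
have cmpE : (rh < mm) = (h %% L < K - k).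
  rewrite -Ek Erh; have [lt|ge] := ltnP (h %% L) (K - k).
    have kK : k < K - h %% L by move: lt; clear; lia.
    have -> : K - k = (K - h %% L - k) + h %% L by move: lt; clear; lia.
    rewrite cnt_cat subnKC; last exact: ltnW.
    rewrite -add1n leq_add2r; have d1 : 0 < K - h %% L - k by rewrite subn_gt0.
    by apply: leq_trans (cnt_mono c k d1); rewrite cntS cnt0 addn0 ck.
  apply/negbTE; rewrite -leqNgt.
  have hK : h %% L <= K by apply: leq_trans hL _; exact: leq_mod.
  have E1 : h %% L = (k - (K - h %% L)) + (K - k) by move: ge k1 hK; clear; lia.
  have Hk : K - h %% L <= k by move: ge k1; clear; lia.
  have := cnt_cat c (K - h %% L) (k - (K - h %% L)) (K - k).
  by rewrite -E1 subnKC // => ->; exact: leq_addl.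
have found x' : x' < N -> B x' -> x' %/ L = k %% N %/ L ->
    cnt B (k %% N %/ L * L) (x' %% L) = cnt B (k %% N %/ L * L) (k %% N %% L) ->
    x' = k %% N.
  move=> _ Bx' Ed Ec; rewrite (divn_eq x' L) Ed [RHS](divn_eq _ L); congr (_ + _).
  by apply: cnt_inj Ec; rewrite -?divn_eq // -Ed -divn_eq.
apply: (runs_if (v := (rh < mm : nat))) => [|lt|ge].
- by rewrite -/(ev w m _ _); evs.
- have {}lt : h %% L < K - k by rewrite -cmpE; case: (rh < mm) lt.
  have [k' [/andP[k3 k4] k5 k6 Et]] := block_end ok tB BE k1 k2 lt.
  have CK : cnt c 0 K - mm = cnt c 0 k.
    have := cnt_cat c 0 k (K - k); rewrite subnKC ?Ek; last exact: ltnW.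
    by move=> ->; rewrite addnK.
  have mK : mm <= cnt c 0 K.
    have := cnt_cat c 0 k (K - k); rewrite subnKC ?Ek; last exact: ltnW.
    by move=> ->; exact: leq_addl.
  have Hq := ev_diff_mod (ev_Q ok winm) Hx mK (leq_trans mN (ltnW NZ')).
  rewrite CK in Hq; set qE := diffE e_Q e_x in Hq *.
  have Edq : cnt c 0 k %% Z %/ G = (cnt c 0 k %/ G) %% Hs by rewrite modn_divl.
  have Hv : ev w m (A 6 (Op Div qE e_G)) (cell p m 6 ((cnt c 0 k %/ G) %% Hs)).
    rewrite -Edq; evs; rewrite Edq; exact: ltn_pmod Hs_gt0.
  rewrite (d_info D k1 ck k2) in Hv; set vE := A 6 _ in Hv *.
  have sM := slot_ltM ok k.
  case: (boolP (E (cnt c 0 k %/ G))) => Eg; rewrite ?Eg ?(negbTE Eg) in Hv.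
    have M1 := d_EM D k1 ck Eg.
    apply: (runs_if (v := 0)) => // [|_].
      by rewrite -/(ev w m _ _); eapply ev_eq; first evs; rewrite ltnNge leq_addr.
    apply: (runs_wv ok wfm) => //.
    have Xl : X (cnt c 0 k %/ G) %% Ls < Ls by rewrite ltn_pmod // (v_Ls ok).
    have rG := ltn_pmod (cnt c 0 k) (v_G ok).
    have GL := v_GL ok; have ML := v_ML ok; have MLs : M + X (cnt c 0 k %/ G) %% Ls < 2 ^ w.
      by move: ML Xl; clear; lia.
    have HL : ev w m (Op Mod (Op Add (Op Mul (Op Defs.Sub vE e_M) e_G) (Op Mod qE e_G)) e_Lsz)
       (X (cnt c 0 k %/ G) %% Ls * G + cnt c 0 k %% G).
      have dG : G %| Z by rewrite /par_Z dvdn_mull.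
      have llt := log_lt (X (cnt c 0 k %/ G)) (cnt c 0 k) M1.
      have lltw : X (cnt c 0 k %/ G) %% Ls * G + cnt c 0 k %% G < 2 ^ w.
        by apply: ltn_trans llt _; have [_ ->] := v_log ok M1.
      eapply ev_eq.
        evs; rewrite ?leq_addr // ?addKn ?modn_dvdm //.
        by apply: leq_ltn_trans lltw; exact: leq_addr.
      by rewrite addKn modn_dvdm // modn_small.
    rewrite -(d_log D k1 ck k2 M1); last by rewrite Eg.
    by evs; exact: log_lt.
  apply: (runs_if (v := 1)) => // [|_].
    by rewrite -/(ev w m _ _); eapply ev_eq; first evs; rewrite sM.
  apply: (runs_wv ok wfm) => //.
  have Hn := ev_next ok winm Hv sM; rewrite -k6 in Hn.
  have k7 : K < k' + N by move: k2 k3; clear; lia.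
  have Hc := ev_start ok winm Hn k4 k7 k5.
  have lC : cnt c 0 k <= cnt c 0 k' by apply: cnt_mono; exact: ltnW.
  have dC : cnt c 0 k' - cnt c 0 k = cnt c k (k' - k).
    by rewrite -{1}(subnKC (ltnW k3)) cnt_cat addKn.
  have dN : cnt c 0 k' - cnt c 0 k < Z.
    by rewrite dC; have := cnt_le c k (k' - k); move: k2 k3 k4 NZ'; clear; lia.
  have Hd := ev_diff ok winm Hc Hq lC dN.
  have Ht := ev_total ok wfm tB Hv sM.
  have Esp := cnt_slot_split ok B (k %% N); rewrite Et -/(slot p k) in Esp.
  have tL := cnt_le B (slot p k * L) L.
  have Hi : ev w m (Op Defs.Sub (A 4 vE) (diffE (A 5 (next_slotE vE)) qE))
     (cnt B (slot p k * L) (k %% N %% L)).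
    rewrite dC in Hd; move: Hd Ht Esp tL; set x1 := cnt c k _; set x2 := cnt B _ L.
    set x3 := cnt B _ _ => Hd Ht Esp tL.
    eapply ev_eq; first (evs; move: Esp tL LB; clear; lia).
    by rewrite Esp addnK.
  have ilt : cnt B (slot p k * L) (k %% N %% L) < cnt B (slot p k * L) L.
    apply: leq_trans (cnt_mono B _ (ltn_pmod (k %% N) L0)).
    by rewrite cntS /slot -divn_eq Bx addn1.
  have [x' Hx' [x'N Bx' x'L x'c]] := ev_select ok wfm tB Hv Hi sM ilt.
  by rewrite -(found x').
have {}ge : K - k <= h %% L by rewrite leqNgt -cmpE; case: (rh < mm) ge.
have mrh : mm <= rh by rewrite leqNgt cmpE -leqNgt.
apply: (runs_wv ok wfm) => //.
have sM := slot_lt hN.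
have Hs : ev w m (Op Div e_h e_L) (h %/ L) by evs.
have Ekh : k %% N = h - (K - k).
  have [j Ej] : exists j, j = K - k by eexists.
  have Ek' : k = K - j by rewrite Ej subKn // ltnW.
  have jh : j <= h by rewrite Ej (leq_trans ge).
  rewrite -Ej Ek' {1}(divn_eq K N) -/h -addnBA // modnMDl modn_small //.
  exact: leq_ltn_trans (leq_subr _ _) hN.
have Eh := divn_eq h L.
have Ekh' : k %% N = h %/ L * L + (h %% L - (K - k)) by rewrite Ekh {1}Eh addnBA.
have lt : h %% L - (K - k) < L by apply: leq_ltn_trans hL'; exact: leq_subr.
have EdL : k %% N %/ L = h %/ L by rewrite Ekh' divnMDl // (divn_small lt) addn0.
have EmL : k %% N %% L = h %% L - (K - k) by rewrite Ekh' modnMDl (modn_small lt).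
have Esum : rh = cnt B (h %/ L * L) (k %% N %% L) + mm.
  rewrite -Ek /rh -{1}(subnK ge) cnt_cat EmL -Ekh' (cnt_physical BE) //.
    by rewrite subnKC // ltnW.
  by rewrite Ekh subnK ?(ltnW hN) // (leq_trans ge).
have rL := cnt_le B (h %/ L * L) (h %% L); rewrite -/rh in rL.
have Hi : ev w m (Op Defs.Sub (rankE e_h) e_x) (rh - mm).
  by evs; move: mrh rL hL' LB; clear; lia.
have ilt : rh - mm < cnt B (h %/ L * L) L.
  rewrite Esum addnK; apply: leq_trans (cnt_mono B _ (ltn_pmod (k %% N) L0)).
  by rewrite cntS -EdL -divn_eq Bx addn1.
have [x' Hx' [x'N Bx' x'L x'c]] := ev_select ok wfm tB Hs Hi sM ilt.
rewrite -(found x') //; first by rewrite EdL.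
by rewrite EdL x'c Esum addnK.
Qed.

End Select.

End Window.

(** * Appending a bit *)

Definition rows_cmd :=
  If (Op Eq (Op Mod e_Q e_G) (Const 0))
    (Seq (WV 36 (Op Mod (Op Add e_lam (Op Lt (Op Defs.Sub e_M (Const 1)) e_ci)) e_Ls))
         (WV 37 (Op Div e_h e_L)))
    (If (Op Eq e_ci (Op Div e_h e_L)) Skip (WV 37 (Op Add e_M e_lam))).

Definition dir_cmd :=
  If e_v
    (Seq rows_cmd
    (Seq (WA 6 (Op Div e_Q e_G) e_ci)
    (Seq (WA 7 (Op Mod (Op Add (Op Mul e_lam e_G) (Op Mod e_Q e_G)) e_Lsz) e_h)
         (WV 35 (Op Mod (Op Add e_Q (Const 1)) e_Z)))))
    Skip.

Definition start_cmd :=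
  If (Op Eq (Op Mod e_h e_L) (Const 0)) (WA 5 (Op Div e_h e_L) e_Q) Skip.

(** [dir_cmd] comes first since it needs the position and the arrival number of the new bit, that is
    the head and [Q] before they move. The count at the start of a block is recorded after both have
    moved. *)
Definition append_cmd :=
  Seq dir_cmd (Seq set_bit (Seq (WV 34 (Op Mod (Op Add e_h (Const 1)) e_N)) start_cmd)).

Section Window.

Variables (w : nat) (p : params).
Hypothesis ok : valid w p.

Local Notation N := (par_N p).
Local Notation L := (par_L p).
Local Notation M := (par_M p).
Local Notation G := (par_G p).
Local Notation Hs := (par_Hs p).
Local Notation Ls := (par_Ls p).
Local Notation Lsz := (par_Lsz p).
Local Notation Z := (par_Z p).


Lemma mod_neq a b : a < b -> b < a + N -> a %% N != b %% N.
Proof.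
move=> H1 H2; apply/eqP => E.
have : b - a = 0 %[mod N] by apply/eqP; rewrite mod0n -/(dvdn _ _) -eqn_mod_dvd ?E // ltnW.
by rewrite mod0n modn_small; move: H1 H2; clear; lia.
Qed.

Lemma runs_rows m h lam ci q : wf p m -> cell p m 0 34 = h ->
  cell p m 0 35 = q %% Z -> cell p m 0 36 = lam -> cell p m 0 37 = ci -> lam < Ls ->
  exists m', [/\ runs w rows_cmd m m', wf p m',
    cell p m' 0 36 = next_lam p lam ci q, cell p m' 0 37 = next_ci p lam ci q (h %/ L) &
    forall k i, i < len p k -> (k == 0) && ((i == 36) || (i == 37)) = false ->
      cell p m' k i = cell p m k i].
Proof.
move=> wfm Eh EQ El Ec lamLs.
have Hh := ev_state ok wfm (isT : 34 < 40) Eh; rewrite -/e_h in Hh.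
have Hq := ev_state ok wfm (isT : 35 < 40) EQ; rewrite -/e_Q in Hq.
have Hl := ev_state ok wfm (isT : 36 < 40) El; rewrite -/e_lam in Hl.
have Hc := ev_state ok wfm (isT : 37 < 40) Ec; rewrite -/e_ci in Hc.
have ML := v_ML ok; have w100 := w_100 ok; have Ls0 := v_Ls ok.
have dG : G %| Z by rewrite /par_Z dvdn_mull.
have HqG : ev w m (Op Mod e_Q e_G) (q %% G) by eapply ev_eq; [evs | rewrite modn_dvdm].
rewrite /next_lam /next_ci; case: (boolP (q %% G == 0)) => r0.
  have Hl' : ev w m (Op Mod (Op Add e_lam (Op Lt (Op Defs.Sub e_M (Const 1)) e_ci)) e_Ls)
      ((lam + (M.-1 < ci)) %% Ls).
    have b1 := leq_b1 (M - 1 < ci); have M0 : 0 < M by [].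
    eapply ev_eq; first (evs; move: b1 lamLs ML w100 M0; clear; move: (nat_of_bool _) => y; lia).
    by rewrite subn1.
  have R1 := runs_wv ok wfm Hl' (isT : 36 < 40).
  set m1 := upd p m 0 36 _ in R1.
  have wf1 : wf p m1 by apply: wf_upd.
  have C1 k i : i < len p k -> cell p m1 k i = 
      if (k == 0) && (i == 36) then (lam + (M.-1 < ci)) %% Ls else cell p m k i.
    by move=> Hi; rewrite cell_upd.
  have Hh1 : ev w m1 e_h h by apply: (ev_state ok wf1) => //; rewrite C1.
  have Hs1 : ev w m1 (Op Div e_h e_L) (h %/ L) by evs.
  have R2 := runs_wv ok wf1 Hs1 (isT : 37 < 40).
  exists (upd p m1 0 37 (h %/ L)); split.
  - apply: (runs_if (v := 1)) => // [|_]; last exact: runs_seq R1 R2.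
    by rewrite -/(ev w m _ _); eapply ev_eq; first (evs; move: w100; clear; lia); rewrite r0.
  - exact: wf_upd.
  - by rewrite cell_upd // C1.
  - by rewrite cell_upd.
  - move=> k i Hi; rewrite cell_upd // C1 //.
    by case: (k == 0) => //=; case: (i == 36); case: (i == 37).
have Hcond : ev w m (Op Eq (Op Mod e_Q e_G) (Const 0)) 0.
  by eapply ev_eq; first (evs; move: w100; clear; lia); rewrite (negbTE r0).
have Hs : ev w m (Op Div e_h e_L) (h %/ L) by evs.
have [E|ne] := eqVneq ci (h %/ L).
  exists m; split=> //.
  apply: (runs_if (v := 0)) => // _; apply: (runs_if (v := 1)) => // [|_]; last exact: runs_skip.
  by rewrite -/(ev w m _ _); eapply ev_eq; first evs; rewrite E eqxx.
have Hml : ev w m (Op Add e_M e_lam) (M + lam) by evs; move: lamLs ML; clear; lia.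
have R2 := runs_wv ok wfm Hml (isT : 37 < 40).
exists (upd p m 0 37 (M + lam)); split.
- have H2 : ev w m (Op Eq e_ci (Op Div e_h e_L)) 0.
    by eapply ev_eq; first evs; rewrite (negbTE ne).
  by apply: (runs_if Hcond) => // _; apply: (runs_if H2).
- exact: wf_upd.
- by rewrite cell_upd.
- by rewrite cell_upd.
- move=> k i Hi; rewrite cell_upd //.
  by case: (k == 0) => //=; case: (i == 36); case: (i == 37).
Qed.

Lemma runs_dir m h lam ci q (v : bool) : wf p m -> cell p m 0 34 = h ->
  cell p m 0 35 = q %% Z -> cell p m 0 36 = lam -> cell p m 0 37 = ci ->
  cell p m 0 38 = v -> lam < Ls -> next_lam p lam ci q < Ls ->
  exists m', [/\ runs w dir_cmd m m', wf p m', cell p m' 0 35 = (q + v) %% Z,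
    [/\ cell p m' 0 36 = if v then next_lam p lam ci q else lam,
        cell p m' 0 37 = if v then next_ci p lam ci q (h %/ L) else ci,
        forall i, i < Hs -> cell p m' 6 i =
          if v then fset (cell p m 6) ((q %/ G) %% Hs) (next_ci p lam ci q (h %/ L)) i
          else cell p m 6 i &
        forall i, i < Lsz -> cell p m' 7 i =
          if v then fset (cell p m 7) ((next_lam p lam ci q * G + q %% G) %% Lsz) h i
          else cell p m 7 i] &
    forall k i, k < 6 -> i < len p k ->
      (k == 0) && [|| i == 35, i == 36 | i == 37] = false -> cell p m' k i = cell p m k i].
Proof.
move=> wfm Eh EQ El Ec Ev lamLs lamLs'.
have Hv := ev_state ok wfm (isT : 38 < 40) Ev; rewrite -/e_v in Hv.
case: v Ev Hv => Ev Hv; last first.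
  exists m; split=> //; last by rewrite addn0.
  by apply: (runs_if Hv) => // _; exact: runs_skip.
have [m1 [R1 wf1 El1 Ec1 C1]] := runs_rows wfm Eh EQ El Ec lamLs.
have Eh1 : cell p m1 0 34 = h by rewrite C1.
have Eq1 : cell p m1 0 35 = q %% Z by rewrite C1.
set lam' := next_lam p lam ci q in lamLs' El1 *.
set ci' := next_ci p lam ci q (h %/ L) in Ec1 *.
have Z2 := v_Z ok; have GL := v_GL ok; have w100 := w_100 ok.
have Z0 : 0 < Z := leq_ltn_trans (leq0n _) (NZ ok).
have dG : G %| Z by rewrite /par_Z dvdn_mull.
have Hq := ev_state ok wf1 (isT : 35 < 40) Eq1; rewrite -/e_Q in Hq.
have Hc := ev_state ok wf1 (isT : 37 < 40) Ec1; rewrite -/e_ci in Hc.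
have HqG : ev w m1 (Op Div e_Q e_G) ((q %/ G) %% Hs).
  by eapply ev_eq; [evs | rewrite modn_divl].
have iH : (q %/ G) %% Hs < len p 6 by exact: ltn_pmod (Hs_gt0 p).
have R2 := runs_wa ok wf1 (isT : 0 < 6 < 8) HqG Hc iH.
set m2 := upd p m1 6 _ _ in R2.
have wf2 : wf p m2 by apply: wf_upd.
have C2 k i : i < len p k -> cell p m2 k i = if (k == 6) && (i == (q %/ G) %% Hs) then ci' else cell p m1 k i.
  by move=> Hi; rewrite cell_upd.
have Hq2 : ev w m2 e_Q (q %% Z) by apply: (ev_state ok wf2) => //; rewrite C2.
have Hl2 : ev w m2 e_lam lam' by apply: (ev_state ok wf2) => //; rewrite C2.
have Hh2 : ev w m2 e_h h by apply: (ev_state ok wf2) => //; rewrite C2.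
have idx : lam' * G + q %% G < 2 ^ w.
  apply: leq_trans (ltnW GL); apply: (@leq_trans (lam'.+1 * G)); last by rewrite leq_mul2r lamLs' orbT.
  by rewrite mulSn addnC ltn_add2r ltn_pmod // (v_G ok).
have HL : ev w m2 (Op Mod (Op Add (Op Mul e_lam e_G) (Op Mod e_Q e_G)) e_Lsz)
    ((lam' * G + q %% G) %% Lsz).
  eapply ev_eq; first (evs; rewrite ?modn_dvdm //).
    by apply: leq_ltn_trans idx; exact: leq_addr.
  by rewrite modn_dvdm.
have iL : (lam' * G + q %% G) %% Lsz < len p 7 by exact: ltn_pmod (v_Lsz ok).
have R3 := runs_wa ok wf2 (isT : 0 < 7 < 8) HL Hh2 iL.
set m3 := upd p m2 7 _ _ in R3.
have wf3 : wf p m3 by apply: wf_upd.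
have C3 k i : i < len p k -> cell p m3 k i =
    if (k == 7) && (i == (lam' * G + q %% G) %% Lsz) then h else cell p m2 k i.
  by move=> Hi; rewrite cell_upd.
have Hq3 : ev w m3 e_Q (q %% Z) by apply: (ev_state ok wf3) => //; rewrite C3 // C2.
have HQ : ev w m3 (Op Mod (Op Add e_Q (Const 1)) e_Z) ((q + 1) %% Z).
  eapply ev_eq; first (evs; have := ltn_pmod q Z0; move: Z2 w100; clear; lia).
  by rewrite modnDml.
have R4 := runs_wv ok wf3 HQ (isT : 35 < 40).
set m4 := upd p m3 0 35 _ in R4.
have C4 k i : i < len p k -> cell p m4 k i = if (k == 0) && (i == 35) then (q + 1) %% Z else cell p m3 k i.
  by move=> Hi; rewrite cell_upd.
exists m4; split.
- apply: (runs_if Hv) => // _.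
  exact: runs_seq R1 (runs_seq R2 (runs_seq R3 R4)).
- exact: wf_upd.
- by rewrite C4.
- split.
  + by rewrite C4 // C3 // C2.
  + by rewrite C4 // C3 // C2.
  + by move=> i Hi; rewrite C4 // C3 // C2 //= /fset; case: eqP => // _; rewrite C1.
  + by move=> i Hi; rewrite C4 // C3 // /fset /=; case: eqP => // _; rewrite C2 //= C1.
move=> k i Hk Hi H.
have [k6 k7] : (k == 6) = false /\ (k == 7) = false by move: Hk; clear; lia.
rewrite C4 // C3 // C2 // k6 k7 /= C1 //.
  by move: H; case: (k == 0) => //=; case: (i == 35).
by move: H; case: (k == 0) => //=; case: (i == 35); case: (i == 36).
Qed.

Lemma runs_append m c K (v : bool) : win p m c K -> cell p m 0 38 = v ->
  exists m', [/\ runs w append_cmd m m', win p m' (bset c K v) K.+1,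
    cell p m' 0 32 = cell p m 0 32 & cell p m' 0 33 = cell p m 0 33].
Proof.
move=> winm Ev; have [wfm KN Eh EQ [B tB BE] Hst [X [E [x [e [bl D]]]]]] := winm.
have N0 := N_gt0 ok; have L0 := L_gt0 ok; have hN := ltn_pmod K N0.
set q := cnt c 0 K in EQ *; set lam := cell p m 0 36 in D *; set ci := cell p m 0 37 in D *.
have lamLs : lam < Ls by rewrite (d_lam D) ltn_pmod // (v_Ls ok).
have lamLs' : next_lam p lam ci q < Ls.
  by rewrite /next_lam; case: ifP => // _; rewrite ltn_pmod // (v_Ls ok).
have [m1 [R1 wf1 EQ1 [El1 Ec1 E6 E7] C1]] :=
  runs_dir wfm Eh EQ (erefl lam) (erefl ci) Ev lamLs lamLs'.
have tB1 : tree p m1 B.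
  apply: tree_frame tB => k i /andP[k0 k5] Hi; rewrite C1 //; first exact: ltn_trans k5 _.
  by case: k k0 {k5 Hi}.
have Eh1 : cell p m1 0 34 = K %% N by rewrite C1.
have Ev1 : cell p m1 0 38 = v by rewrite C1.
have [m2 [R2 wf2 tB2 C2]] := runs_set ok wf1 tB1 hN Eh1 Ev1.
have Hh2 : ev w m2 e_h (K %% N) by apply: (ev_state ok wf2) => //; rewrite C2.
have NB := N_bound ok; have w100 := w_100 ok.
have HK : ev w m2 (Op Mod (Op Add e_h (Const 1)) e_N) (K.+1 %% N).
  eapply ev_eq; first (evs; move: hN NB; clear; lia).
  by rewrite modnDml addn1.
have R3 := runs_wv ok wf2 HK (isT : 34 < 40).
set m3 := upd p m2 0 34 _ in R3.
have wf3 : wf p m3 by apply: wf_upd.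
have C3 k i : i < len p k -> cell p m3 k i = if (k == 0) && (i == 34) then K.+1 %% N else cell p m2 k i.
  by move=> Hi; rewrite cell_upd.
have Hh3 : ev w m3 e_h (K.+1 %% N) by apply: (ev_state ok wf3) => //; rewrite C3.
have HQ3 : ev w m3 e_Q ((q + v) %% Z) by apply: (ev_state ok wf3) => //; rewrite C3 // C2.
have sM := slot_ltM ok K.+1.
have Hs3 : ev w m3 (Op Div e_h e_L) (slot p K.+1) by evs.
have R4 := runs_wa ok wf3 (isT : 0 < 5 < 8) Hs3 HQ3 sM.
have [m4 [R4' wf4 C4]] : exists m4, [/\ runs w start_cmd m3 m4, wf p m4 &
    forall k i, k < 8 -> i < len p k -> cell p m4 k i =
      if [&& k == 5, i == slot p K.+1 & K.+1 %% N %% L == 0] then (q + v) %% Z else cell p m3 k i].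
  have Hc : ev w m3 (Op Eq (Op Mod e_h e_L) (Const 0)) (K.+1 %% N %% L == 0 : nat).
    by evs; move: w100; clear; lia.
  case: (boolP (K.+1 %% N %% L == 0)) Hc => H0 Hc.
    exists (upd p m3 5 (slot p K.+1) ((q + v) %% Z)); split.
    - by apply: (runs_if Hc).
    - exact: wf_upd.
    - by move=> k i Hk Hi; rewrite cell_upd // andbT.
  exists m3; split=> //; first by apply: (runs_if Hc) => // _; exact: runs_skip.
  by move=> k i Hk Hi; rewrite !andbF.
have C k i : k < 8 -> i < len p k -> ~~ (0 < k < 6) -> (k == 0) && ((i == 34) || (i == 39)) = false ->
    cell p m4 k i = cell p m1 k i.
  move=> Hk Hi k5 H; have k5' : (k == 5) = false by move: k5; clear; lia.
  rewrite C4 // k5' /= C3 // ifF; last by move: H; case: (k == 0) => //=; case: (i == 34).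
  rewrite C2 //; first by move: k5; clear; lia.
  by move: H; case: (k == 0) => //=; case: (i == 34).
exists m4; split.
- exact: runs_seq R1 (runs_seq R2 (runs_seq R3 R4')).
- split=> //.
  + exact: leqW.
  + by rewrite C4 //= C3.
  + by rewrite C // EQ1 bset_cntS.
  + exists (bset B (K %% N) v).
      apply: tree_frame tB2 => k i /andP[k0 k5] Hi.
      have [k5' k0'] : (k == 5) = false /\ (k == 0) = false by move: k0 k5; clear; lia.
      by rewrite C4 // ?k5' /= ?C3 ?k0' //; apply: ltn_trans k5 _.
    move=> k k1 k2; have [->|ne] := eqVneq k K; first by rewrite !bset_eq.
    have kK : k < K by rewrite ltn_neqAle ne.
    by rewrite !bset_neq ?mod_neq ?BE //; apply: ltnW.
  + move=> k k1 k2 k3; rewrite C4 //; last exact: (slot_ltM ok).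
    have [Ek|ne] := eqVneq k K.+1.
      by rewrite Ek eqxx -Ek k3 eqxx Ek bset_cntS.
    have kK : k <= K by rewrite -ltnS ltn_neqAle ne.
    rewrite bset_cnt // ifF; last first.
      (* Two block starts in one slot are the same array position, which is impossible for indices
         less than [N] apart. *)
      apply/negP => /and3P[_ /eqP Es /eqP E0].
      have := mod_neq (_ : k < K.+1) k2; rewrite ltnS => /(_ kK)/eqP; apply.
      by rewrite (divn_eq (k %% N) L) k3 (divn_eq (K.+1 %% N) L) E0 -/(slot p k) Es.
    rewrite C3 //=; last exact: (slot_ltM ok).
    rewrite C2 //; last exact: (slot_ltM ok).
    rewrite C1 //; last exact: (slot_ltM ok).
    by rewrite Hst // ltnW.
  rewrite !(C 0) // El1 Ec1.
  case: v {Ev Ev1 EQ1 R1 HQ3 R4 R4' C4 tB2 R2 C2 C3} E6 E7 El1 Ec1 => E6 E7 _ _; last first.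
    exists X, E, x, e, bl; apply: (dir_ext ok) (dir_zero ok D) => i Hi; rewrite C // ?E6 ?E7 //.
  have [X' [E' [x' [e' [bl' D']]]]] := dir_one ok (erefl q) D.
  exists X', E', x', e', bl'.
  by apply: (dir_ext ok) D' => i Hi; rewrite C // ?E6 ?E7.
- by rewrite C // C1.
- by rewrite C // C1.
Qed.

End Window.

(** * The three operations *)

Definition e_arg := V 0.
(** Machine subtraction wraps around; the factor given by the comparison restores truncation at
    0. *)
Definition monusE a b := Op Mul (Op Lt b (Op Add a (Const 1))) (Op Defs.Sub a b).
Definition ceilE a := Op Div (Op Add a (Op Defs.Sub e_d (Const 1))) e_d.
Definition excessE a := Op Defs.Sub (Op Mul e_x e_d) a.
(** The distance from position [y] forward to the head, taken between 1 and [N]: a chunk found at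
    the head position is the oldest one, at distance [N] and not 0. *)
Definition distE := Op Add (Op Mod (Op Defs.Sub (Op Defs.Sub (Op Add e_h e_N) e_y) (Const 1)) e_N) (Const 1).

(** For [i <= e] the window lies in the open chunk and has fewer than [d] ones, so 0 is accurate.
    Otherwise the estimate of [ssA_chunks] is evaluated. *)
Definition ssA_cmd :=
  let a := Op Defs.Sub e_arg e_e in
  If (Op Lt e_e e_arg)
    (Seq (WV 38 (ceilE a))
    (Seq count_cmd
         (WV 0 (monusE (Op Add (Op Mul e_y e_d) e_u)
                  (Op Add (Op Defs.Sub e_d (Const 1))
                          (Op Mul (bitE (posE e_x)) (excessE a)))))))
    (WV 0 (Const 0)).

(** For [i <= d] the choice [x = 0] satisfies [issA_intro]. For larger [i] up to [u + 1] the start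
    of the open chunk does, [x = e]: its sum is at most [e], below [i] thanks to the first test, and
    at least [u + 1 - d]. The remaining case is [issA_chunks]. *)
Definition issA_cmd :=
  let a := Op Defs.Sub e_arg (Op Add e_u (Const 1)) in
  If (Op Lt e_d e_arg)
    (If (Op Lt (Op Add e_u (Const 1)) e_arg)
      (Seq (WV 38 (ceilE a))
      (Seq select_cmd
           (WV 0 (Op Defs.Sub (Op Add (Op Add (Op Mul distE e_d) e_e) (Const 1)) (excessE a)))))
      (WV 0 (Op Add e_e (Const 1))))
    (WV 0 (Const 1)).

Definition update_cmd :=
  Seq (WV 33 (Op Add e_u e_arg))
  (Seq (WV 32 (Op Add e_e (Const 1)))
  (If (Op Eq e_e e_d)
    (Seq (WV 38 (Op Lt (Op Defs.Sub e_d (Const 1)) e_u))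
    (Seq (WV 33 (Op Defs.Sub e_u (Op Mul e_v e_d)))
    (Seq (WV 32 (Const 0)) append_cmd)))
    Skip)).

Section Window.

Variables (w : nat) (p : params).
Hypothesis ok : valid w p.

Local Notation N := (par_N p).
Local Notation L := (par_L p).
Local Notation M := (par_M p).
Local Notation G := (par_G p).
Local Notation Hs := (par_Hs p).
Local Notation Ls := (par_Ls p).
Local Notation Lsz := (par_Lsz p).
Local Notation Z := (par_Z p).


Local Notation n := (par_n p).
Local Notation d := (par_d p).
Local Notation pad := (par_N p * par_d p).

Definition pcount s x := cnt (padded pad s) 0 x.

(** The padding consists of [N] whole chunks of zeros. It does not move the chunk boundaries, and it
    provides a full window of chunk bits from the beginning. *)
Definition rep (m : memory) (s : stream) : Prop :=
  exists c K, [/\ win p m c K,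
    pad + size s = K * d + cell p m 0 32, cell p m 0 32 < d,
    pcount s (pad + size s) = cnt c 0 K * d + cell p m 0 33 &
    forall k, k <= K -> cnt c 0 k = pcount s (k * d) %/ d].

Lemma d_gt0 : 0 < d. Proof. by case/andP: (v_d ok). Qed.
Lemma d_le_n : d <= n. Proof. by case/andP: (v_d ok). Qed.

Lemma ceil_spec x : x <= (x + d.-1) %/ d * d < x + d.
Proof.
have d0 := d_gt0; have := divn_eq (x + d.-1) d; have := ltn_pmod (x + d.-1) d0.
by move: d0; clear; lia.
Qed.

Lemma n_le_pad : n <= pad < 2 * n.
Proof.
have := ceil_spec n; rewrite -/(ceil_div n d) -(v_N ok); have := d_le_n; clear; lia.
Qed.

Lemma ceil_le x : x <= n -> (x + d.-1) %/ d <= N.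
Proof. by move=> Hx; rewrite (v_N ok) leq_div2r // leq_add2r. Qed.

Lemma pcount_step s x y : pcount s x <= pcount s (x + y) <= pcount s x + y.
Proof. by rewrite /pcount cnt_cat leq_addr leq_add2l cnt_le. Qed.

Lemma ss_pcount s i : i <= pad ->
  ss s i = pcount s (pad + size s) - pcount s (pad + size s - i).
Proof.
move=> Hi; rewrite (ss_padded s Hi) /pcount.
have le : i <= pad + size s by apply: leq_trans (leq_addr _ _).
have := cnt_cat (padded pad s) 0 (pad + size s - i) i.
by rewrite subnK // => ->; rewrite addKn.
Qed.

Lemma win_upd m c K i v : win p m c K -> i \in [:: 0; 32; 33; 38; 39] ->
  win p (upd p m 0 i v) c K.
Proof.
move=> winm Hi.
have i40 : i < 40 by move: Hi; rewrite !inE => /or4P[|||/orP[]] /eqP ->.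
apply: (win_frame ok winm).
  apply: (wf_upd (win_wf winm)) => //; apply/negbTE; rewrite /= .
  by move: Hi; rewrite !inE => /or4P[|||/orP[]] /eqP ->.
move=> k j Hk Hj H; rewrite cell_upd //; case: andP => // -[/eqP k0 /eqP Ej].
by rewrite k0 Ej Hi in H.
Qed.

Lemma rep_arg m s x : rep m s -> rep (upd p m 0 0 x) s.
Proof.
move=> [c [K [winm E1 E2 E3 E4]]]; exists c, K.
by split=> //; [apply: win_upd | rewrite cell_upd ..].
Qed.

Lemma ev_monus m e1 e2 a b : ev w m e1 a -> ev w m e2 b -> a.+1 < 2 ^ w -> b <= 2 ^ w ->
  ev w m (monusE e1 e2) (a - b).
Proof.
move=> H1 H2 Ha Hb; have w100 := w_100 ok.
have Hlt : ev w m (Op Lt e2 (Op Add e1 (Const 1))) (b < a + 1).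
  by evs; move: Ha w100; clear; lia.
have [le|gt] := leqP b a.
  rewrite addn1 ltnS le in Hlt.
  eapply ev_eq; first (rewrite /monusE; evs; move: le Ha; clear; lia).
  by rewrite mul1n.
rewrite addn1 ltnS leqNgt gt in Hlt.
apply: ev_eq (ev_op Mul Hlt (ev_op Defs.Sub H1 H2)) _.
by rewrite [LHS]/= mul0n mod0n; move: gt; clear; lia.
Qed.

Lemma ev_ceil m e x : wf p m -> ev w m e x -> x <= n ->
  ev w m (ceilE e) ((x + d.-1) %/ d).
Proof.
move=> wfm He Hx; have d0 := d_gt0; have dn := d_le_n; have B := v_big ok.
by eapply ev_eq; first (rewrite /ceilE; evs; move: d0 dn B Hx; clear; lia); rewrite subn1.
Qed.

Lemma ev_excess m e x : wf p m -> cell p m 0 38 = (x + d.-1) %/ d -> ev w m e x -> x <= n ->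
  ev w m (excessE e) ((x + d.-1) %/ d * d - x).
Proof.
move=> wfm E38 He Hx; have Hj := ev_state ok wfm (isT : 38 < 40) E38; rewrite -/e_x in Hj.
have := ceil_spec x; have dn := d_le_n; have B := v_big ok; move: Hj.
set j := _ %/ d => Hj /andP[H1 H2].
by rewrite /excessE; evs; move: H1 H2 dn B Hx; clear; lia.
Qed.

Lemma runs_ssA m s i : rep m s -> cell p m 0 0 = i -> 0 < i <= n ->
  exists m', [/\ runs w ssA_cmd m m', rep m' s &
    cell p m' 0 0 <= ss s i < cell p m' 0 0 + d].
Proof.
move=> [c [K [winm Et eP Pu cP]]] Ei /andP[i0 iN].
have wfm := win_wf winm; have KN := win_K winm.
have d0 := d_gt0; have dn := d_le_n; have B := v_big ok; have w100 := w_100 ok.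
have padn := n_le_pad; have ipad : i <= pad by move: padn iN; clear; lia.
set t := pad + size s in Et Pu *.
set e := cell p m 0 32 in Et eP *; set u := cell p m 0 33 in Pu *.
have Hi := ev_state ok wfm (isT : 0 < 40) Ei; rewrite -/e_arg in Hi.
have He := ev_state ok wfm (isT : 32 < 40) (erefl e); rewrite -/e_e in He.
have Hlt : ev w m (Op Lt e_e e_arg) (e < i) by evs.
have [lt|ge] := ltnP e i; last first.
  have H0 : ev w m (Const 0) 0 by evs; move: w100; clear; lia.
  have R := runs_wv ok wfm H0 (isT : 0 < 40).
  exists (upd p m 0 0 0); split.
  - by apply: (runs_if Hlt) => //; rewrite ltnNge ge.
  - by apply: rep_arg; exists c, K.
  rewrite cell_upd //= add0n; apply: leq_ltn_trans eP; apply: leq_trans ge.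
  by rewrite (ss_padded s ipad); exact: cnt_le.
have Ha : ev w m (Op Defs.Sub e_arg e_e) (i - e).
  by evs; move: lt iN B; clear; lia.
have an : i - e <= n by apply: leq_trans iN; exact: leq_subr.
have R1 := runs_wv ok wfm (ev_ceil wfm Ha an) (isT : 38 < 40).
set j := (i - e + d.-1) %/ d in R1; set m1 := upd p m 0 38 _ in R1.
have win1 : win p m1 c K by exact: win_upd.
have C1 k : k < 40 -> cell p m1 0 k = if k == 38 then j else cell p m 0 k.
  by move=> Hk; rewrite cell_upd.
have Ej : cell p m1 0 38 = j by rewrite C1.
have /andP[aj ja] := ceil_spec (i - e); rewrite -/j in aj ja.
have j0 : 0 < j by move: lt aj; clear; case: j => //; lia.
have jN : j <= N by exact: ceil_le.
have jr : 0 < j <= N by rewrite j0.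
have R2 := runs_count ok win1 Ej jr.
set y := cnt c (K - j) j in R2; set m2 := upd p m1 0 39 _ in R2.
have win2 : win p m2 c K by exact: win_upd.
have C2 k : k < 40 -> cell p m2 0 k = if k == 39 then y else cell p m1 0 k.
  by move=> Hk; rewrite cell_upd.
have wf2 := win_wf win2.
have S k v : k < 40 -> cell p m2 0 k = v -> ev w m2 (V k) v by exact: (ev_state ok wf2).
have Hi2 : ev w m2 e_arg i by apply: S; rewrite // C2 // C1.
have He2 : ev w m2 e_e e by apply: S; rewrite // C2 // C1.
have Hu2 : ev w m2 e_u u by apply: S; rewrite // C2 // C1.
have Hy2 : ev w m2 e_y y by apply: S; rewrite // C2.
have Hx2 : ev w m2 e_x j by apply: S; rewrite // C2 // C1.
have Ha2 : ev w m2 (Op Defs.Sub e_arg e_e) (i - e).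
  by evs; move: lt iN B; clear; lia.
have Ej2 : cell p m2 0 38 = j by rewrite C2 // C1.
have Hexc := ev_excess wf2 Ej2 Ha2 an; rewrite -/j in Hexc.
have Hp := ev_pos ok win2 Hx2 jN.
have [Bf tB BE] := win_tree win2.
have N0 := N_gt0 ok.
have Hb := ev_bit ok wf2 tB Hp (ltn_pmod _ N0).
have k1 : K - j < K by move: j0 jN KN; clear; lia.
have k2 : K <= K - j + N by move: jN; clear; lia.
rewrite (BE _ k1 k2) in Hb.
have P_step := pcount_step s.
have Hc0 := chunk_start d0 cP (leqnn K).
have u2 : u < 2 * d.
  have := P_step (K * d) e; rewrite -Et Pu; move: Hc0 eP; clear.
  by move: (pcount _ _) => x; lia.
have yd : y * d <= pad.
  by rewrite leq_mul2r; apply/orP; right; apply: leq_trans jN; exact: cnt_le.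
have bx : c (K - j) * (j * d - (i - e)) < d.
  by move: ja; case: (c (K - j)) => /=; rewrite ?mul1n ?mul0n; move: d0; clear; lia.
have jK : j <= K by exact: leq_trans KN.
have Hja : j * d = i - e + (j * d - (i - e)) by rewrite subnKC.
have ad : j * d - (i - e) < d by move: ja aj; clear; lia.
have u_eq : pcount s t - cnt c 0 K * d = u by rewrite Pu addKn.
have Hmath := ssA_chunks d0 P_step cP lt Hja ad jK.
rewrite /= -Et u_eq -/y -(ss_pcount _ ipad) in Hmath.
have Hr : ev w m2 (monusE (Op Add (Op Mul e_y e_d) e_u)
            (Op Add (Op Defs.Sub e_d (Const 1))
               (Op Mul (bitE (posE e_x)) (excessE (Op Defs.Sub e_arg e_e)))))
            (y * d + u - (d.-1 + c (K - j) * (j * d - (i - e)))).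
  move: Hexc bx; set a := j * d - _ => Hexc bx.
  have b1 := leq_b1 (c (K - j)).
  rewrite -subn1; apply: ev_monus; last 2 first.
  - by move: yd u2 padn dn B; clear; lia.
  - by move: bx d0 dn B; clear; lia.
  - by evs; move: yd u2 padn dn B; clear; lia.
  by evs; move: bx d0 dn B; clear; lia.
have R3 := runs_wv ok wf2 Hr (isT : 0 < 40).
exists (upd p m2 0 0 (y * d + u - (d.-1 + c (K - j) * (j * d - (i - e))))); split.
- apply: (runs_if Hlt) => [_|]; last by rewrite lt.
  exact: runs_seq R1 (runs_seq R2 R3).
- apply: rep_arg; exists c, K; rewrite !C2 // !C1 //.
by rewrite cell_upd.
Qed.

(** The structure works with an error capped at [n], while the requested error [d'] may be larger;
    passing to it only weakens the premise [i <= ss s x + d'] of [issA_intro]. *)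
Lemma runs_issA m s i d' : rep m s -> cell p m 0 0 = i -> 0 < i <= ss s n -> d <= d' ->
  exists m', [/\ runs w issA_cmd m m', rep m' s & issA_answer n d' s i (cell p m' 0 0)].
Proof.
move=> [c [K [winm Et eP Pu cP]]] Ei /andP[i0 iS] dd'.
have wfm := win_wf winm; have KN := win_K winm.
have d0 := d_gt0; have dn := d_le_n; have B := v_big ok; have w100 := w_100 ok.
have padn := n_le_pad; have npad : n <= pad by case/andP: padn.
have iN : i <= n by apply: leq_trans iS _; rewrite (ss_padded s npad); exact: cnt_le.
set t := pad + size s in Et Pu *.
set e := cell p m 0 32 in Et eP *; set u := cell p m 0 33 in Pu *.
have P_step := pcount_step s.
have Hc0 := chunk_start d0 cP (leqnn K).
have u2 : u < d + e.
  have := P_step (K * d) e; rewrite -Et Pu; move: Hc0; clear.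
  by move: (pcount _ _) => x; lia.
have Hi := ev_state ok wfm (isT : 0 < 40) Ei; rewrite -/e_arg in Hi.
have He := ev_state ok wfm (isT : 32 < 40) (erefl e); rewrite -/e_e in He.
have Hu := ev_state ok wfm (isT : 33 < 40) (erefl u); rewrite -/e_u in Hu.
have Hlt : ev w m (Op Lt e_d e_arg) (d < i) by evs.
have [lt|ge] := ltnP d i; last first.
  have H1 : ev w m (Const 1) 1 by evs; move: w100; clear; lia.
  have R := runs_wv ok wfm H1 (isT : 0 < 40).
  exists (upd p m 0 0 1); split.
  - by apply: (runs_if Hlt) => //; rewrite ltnNge ge.
  - by apply: rep_arg; exists c, K.
  rewrite cell_upd //=; apply: issA_intro => //; rewrite /ss subn0 drop_size big_nil //.
  by rewrite add0n (leq_trans ge).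
have Hlt2 : ev w m (Op Lt (Op Add e_u (Const 1)) e_arg) (u + 1 < i).
  by evs; move: u2 eP dn B; clear; lia.
have [lt2|ge2] := ltnP (u + 1) i; last first.
  have H1 : ev w m (Op Add e_e (Const 1)) (e + 1) by evs; move: eP dn B; clear; lia.
  have R := runs_wv ok wfm H1 (isT : 0 < 40).
  have epad : e <= pad by move: eP dn npad; clear; lia.
  have Hss := ss_pcount s epad; rewrite -/t Pu Et addnK in Hss.
  exists (upd p m 0 0 (e + 1)); split.
  - apply: (runs_if Hlt) => [_|]; last by rewrite lt.
    by apply: (runs_if Hlt2) => //; rewrite ltnNge ge2.
  - by apply: rep_arg; exists c, K.
  rewrite cell_upd //= addn1; apply: issA_intro => //; rewrite Hss.
    have := P_step (K * d) e; rewrite -Et Pu; move: Hc0 eP lt ge2; clear.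
    by move: (pcount _ _) => x; lia.
  by move: Hc0 ge2 dd'; clear; move: (pcount _ _) => x; lia.
have Ha : ev w m (Op Defs.Sub e_arg (Op Add e_u (Const 1))) (i - u.+1).
  by eapply ev_eq; first (evs; move: lt2 iN u2 eP dn B; clear; lia); rewrite addn1.
have an : i - u.+1 <= n by apply: leq_trans iN; exact: leq_subr.
have R1 := runs_wv ok wfm (ev_ceil wfm Ha an) (isT : 38 < 40).
set j := (i - u.+1 + d.-1) %/ d in R1; set m1 := upd p m 0 38 _ in R1.
have win1 : win p m1 c K by exact: win_upd.
have C1 k : k < 40 -> cell p m1 0 k = if k == 38 then j else cell p m 0 k.
  by move=> Hk; rewrite cell_upd.
have Ej : cell p m1 0 38 = j by rewrite C1.
have /andP[aj ja] := ceil_spec (i - u.+1); rewrite -/j in aj ja.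
have Hja : j * d = i - u.+1 + (j * d - (i - u.+1)) by rewrite subnKC.
have ad : j * d - (i - u.+1) < d by move: ja aj; clear; lia.
have lt3 : u.+1 < i by move: lt2; rewrite addn1.
have u_eq : pcount s (K * d + e) - cnt c 0 K * d = u by rewrite -Et Pu addKn.
have iS' := iS; rewrite ss_pcount // -/t in iS'.
have nt : n <= t by apply: leq_trans npad (leq_addr _ _).
have iP : i <= pcount s t by apply: leq_trans iS' (leq_subr _ _).
have lt3' : (pcount s (K * d + e) - cnt c 0 K * d).+1 < i by rewrite u_eq.
have Hja' : j * d = i - (pcount s (K * d + e) - cnt c 0 K * d).+1 + (j * d - (i - u.+1)).
  by rewrite u_eq.
have nt' := nt; have iS'' := iS'; have iP' := iP; rewrite Et in nt' iS'' iP'.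
have jr := issA_in_window d0 P_step cP lt3' Hja' ad nt' iS'' npad KN.
have [k [[k1 k2 ck Ek] R2]] := runs_select ok win1 Ej jr.
set m2 := upd p m1 0 39 _ in R2.
have win2 : win p m2 c K by exact: win_upd.
have C2 x : x < 40 -> cell p m2 0 x = if x == 39 then k %% N else cell p m1 0 x.
  by move=> Hx; rewrite cell_upd.
have wf2 := win_wf win2.
have S x v : x < 40 -> cell p m2 0 x = v -> ev w m2 (V x) v by exact: (ev_state ok wf2).
have Hi2 : ev w m2 e_arg i by apply: S; rewrite // C2 // C1.
have He2 : ev w m2 e_e e by apply: S; rewrite // C2 // C1.
have Hu2 : ev w m2 e_u u by apply: S; rewrite // C2 // C1.
have Hy2 : ev w m2 e_y (k %% N) by apply: S; rewrite // C2.
have Ha2 : ev w m2 (Op Defs.Sub e_arg (Op Add e_u (Const 1))) (i - u.+1).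
  by eapply ev_eq; first (evs; move: lt2 iN u2 eP dn B; clear; lia); rewrite addn1.
have Ej2 : cell p m2 0 38 = j by rewrite C2 // C1.
have Hexc := ev_excess wf2 Ej2 Ha2 an; rewrite -/j in Hexc.
have N0 := N_gt0 ok; have NB := N_bound ok.
have Hdist : ev w m2 distE (K - k).
  have Hh := ev_h ok win2; have xN := ltn_pmod k N0; have hN := ltn_pmod K N0.
  have dN : K - k - 1 < N by move: k1 k2; clear; lia.
  eapply ev_eq; first (rewrite /distE; evs; last (move: (ltn_pmod (K %% N + N - k %% N - 1) N0) NB));
    try (move: xN hN N0 NB; clear; lia).
    by clear; lia.
  have -> : (K %% N + N - k %% N - 1) %% N = K - k - 1.
    rewrite -(modn_small dN); apply/eqP.
    rewrite -(eqn_modDr (k %% N + 1)).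
    have -> : K %% N + N - k %% N - 1 + (k %% N + 1) = K %% N + N by move: xN; clear; lia.
    have -> : K - k - 1 + (k %% N + 1) = K - k + k %% N by move: k1; clear; lia.
    by rewrite modnDr modn_mod modnDmr subnK // ltnW.
  by rewrite subn1 addn1 prednK // subn_gt0.
have Hmath := issA_chunks d0 P_step cP lt3' Hja' ad iP' k1 ck Ek.
set a := j * d - (i - u.+1) in ad Hexc Hmath.
have Kk : K * d = k * d + (K - k) * d by rewrite -mulnDl subnKC // ltnW.
have dK : d <= (K - k) * d by rewrite leq_pmull // subn_gt0.
have Kkpad : (K - k) * d <= pad.
  by rewrite leq_mul2r; apply/orP; right; move: k1 k2; clear; lia.
pose x := (K - k) * d + e - a.
have Ex : t - x = k * d + a by rewrite /x Et Kk; move: ad dK; clear; lia.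
have Hr : ev w m2 (Op Defs.Sub (Op Add (Op Add (Op Mul distE e_d) e_e) (Const 1))
             (excessE (Op Defs.Sub e_arg (Op Add e_u (Const 1))))) x.+1.
  eapply ev_eq; first (evs; move: Kkpad padn eP ad dK dn B; clear; lia).
  by rewrite /x; move: ad dK; clear; lia.
have R3 := runs_wv ok wf2 Hr (isT : 0 < 40).
exists (upd p m2 0 0 x.+1); split.
- apply: (runs_if Hlt) => [_|]; last by rewrite lt.
  apply: (runs_if Hlt2) => [_|]; last by rewrite lt2.
  exact: runs_seq R1 (runs_seq R2 R3).
- by apply: rep_arg; exists c, K; rewrite !C2 // !C1.
rewrite cell_upd //=.
rewrite -Et in Hmath.
(* For [x >= n] the last [x] elements would include the whole window and so contain at least [i]
   ones, against the choice of [k]. *)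
have xn : x < n.
  rewrite ltnNge; apply/negP => nx.
  have le : k * d + a <= t - n by rewrite -Ex leq_sub2l.
  have := P_step (k * d + a) (t - n - (k * d + a)); rewrite subnKC //.
  case/andP: Hmath => Hm _ /andP[Hle _]; move: Hm Hle iS' i0; clear; lia.
have xpad : x <= pad by apply: leq_trans npad; exact: ltnW.
have /andP[H1 H2] := Hmath.
by apply: issA_intro; rewrite ?(ss_pcount s xpad) -/t ?Ex // (leq_trans H2) // leq_add2l.
Qed.

Lemma pcount_rcons s b x : x <= pad + size s -> pcount (rcons s b) x = pcount s x.
Proof.
move=> Hx; apply: eq_cnt => j Hj.
rewrite /padded -!rcons_cat nth_rcons size_cat size_nseq ifT // add0n.
exact: leq_trans Hj Hx.
Qed.

Lemma pcount_rconsS s b :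
  pcount (rcons s b) (pad + size (rcons s b)) = pcount s (pad + size s) + b.
Proof.
rewrite size_rcons addnS /pcount cntS -/(pcount _ _) pcount_rcons // add0n.
by rewrite /padded -rcons_cat nth_rcons size_cat size_nseq ltnn eqxx.
Qed.

Lemma runs_update m s (b : bool) : rep m s -> cell p m 0 0 = b ->
  exists m', runs w update_cmd m m' /\ rep m' (rcons s b).
Proof.
move=> [c [K [winm Et eP Pu cP]]] Eb.
have wfm := win_wf winm; have KN := win_K winm.
have d0 := d_gt0; have dn := d_le_n; have B := v_big ok; have w100 := w_100 ok.
have P_step := pcount_step s.
set t := pad + size s in Et Pu *.
set e := cell p m 0 32 in Et eP *; set u := cell p m 0 33 in Pu *.
have Hc0 := chunk_start d0 cP (leqnn K).
have u2 : u < d + e.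
  have := P_step (K * d) e; rewrite -Et Pu; move: Hc0; clear.
  by move: (pcount _ _) => x; lia.
have b1 := leq_b1 b.
have Hb := ev_state ok wfm (isT : 0 < 40) Eb; rewrite -/e_arg in Hb.
have Hu := ev_state ok wfm (isT : 33 < 40) (erefl u); rewrite -/e_u in Hu.
have Hub : ev w m (Op Add e_u e_arg) (u + b) by evs; move: u2 b1 eP dn B; clear; lia.
have R1 := runs_wv ok wfm Hub (isT : 33 < 40); set m1 := upd p m 0 33 _ in R1.
have win1 : win p m1 c K by exact: win_upd.
have wf1 := win_wf win1.
have He1 : ev w m1 e_e e by apply: (ev_state ok wf1); rewrite // cell_upd.
have HeS : ev w m1 (Op Add e_e (Const 1)) e.+1.
  by eapply ev_eq; first (evs; move: eP dn B; clear; lia); rewrite addn1.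
have R2 := runs_wv ok wf1 HeS (isT : 32 < 40); set m2 := upd p m1 0 32 _ in R2.
have win2 : win p m2 c K by exact: win_upd.
have wf2 := win_wf win2.
have C2 k : k < 40 -> cell p m2 0 k = if k == 32 then e.+1 else if k == 33 then u + b else cell p m 0 k.
  by move=> Hk; rewrite !cell_upd.
have He2 : ev w m2 e_e e.+1 by apply: (ev_state ok wf2); rewrite // C2.
have Hcond : ev w m2 (Op Eq e_e e_d) (e.+1 == d) by evs.
have Et' : pad + size (rcons s b) = K * d + e.+1 by rewrite size_rcons !addnS -/t Et.
have Pu' : pcount (rcons s b) (pad + size (rcons s b)) = cnt c 0 K * d + (u + b).
  by rewrite pcount_rconsS -/t Pu addnA.
have cP' k : k <= K -> cnt c 0 k = pcount (rcons s b) (k * d) %/ d.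
  move=> Hk; rewrite pcount_rcons ?cP // -/t Et; apply: leq_trans (leq_addr _ _).
  by rewrite leq_mul2r Hk orbT.
have [Ed|ne] := eqVneq e.+1 d; last first.
  exists m2; split.
    apply: runs_seq R1 (runs_seq R2 _); apply: (runs_if Hcond); rewrite (negbTE ne) // => _.
    exact: runs_skip.
  exists c, K; rewrite !C2 //=; split=> //.
  by rewrite ltn_neqAle ne.
have [v Ev] : exists v : bool, v = (d.-1 < u + b) by eexists.
have Hu2 : ev w m2 e_u (u + b) by apply: (ev_state ok wf2); rewrite // C2.
have Hv2 : ev w m2 (Op Lt (Op Defs.Sub e_d (Const 1)) e_u) v.
  by eapply ev_eq; first (evs; move: d0 dn B; clear; lia); rewrite subn1 Ev.
have R3 := runs_wv ok wf2 Hv2 (isT : 38 < 40); set m3 := upd p m2 0 38 _ in R3.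
have win3 : win p m3 c K by exact: win_upd.
have wf3 := win_wf win3.
(* Since [u < d + e] and [e.+1 = d], the sum [u + b] is below [2 * d]. So [v] is its whole quotient
   by [d], and one bit per chunk suffices. *)
have vu : v * d <= u + b.
  by move: Ev d0; clear; case: v => [/esym|]; rewrite ?mul1n ?mul0n //; lia.
have uv : u + b < v * d + d.
  move: Ev u2 b1 Ed; clear; case: v => /esym; rewrite ?mul1n ?mul0n; lia.
have Hu3 : ev w m3 e_u (u + b) by apply: (ev_state ok wf3); rewrite // cell_upd // C2.
have Hv3 : ev w m3 e_v v by apply: (ev_state ok wf3); rewrite // cell_upd.
have Huv : ev w m3 (Op Defs.Sub e_u (Op Mul e_v e_d)) (u + b - v * d).
  by evs; move: vu u2 b1 eP dn B; clear; lia.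
have R4 := runs_wv ok wf3 Huv (isT : 33 < 40); set m4 := upd p m3 0 33 _ in R4.
have win4 : win p m4 c K by exact: win_upd.
have wf4 := win_wf win4.
have H0 : ev w m4 (Const 0) 0 by evs; move: w100; clear; lia.
have R5 := runs_wv ok wf4 H0 (isT : 32 < 40); set m5 := upd p m4 0 32 _ in R5.
have win5 : win p m5 c K by exact: win_upd.
have Ev5 : cell p m5 0 38 = v by rewrite !cell_upd.
have [m6 [R6 win6 E32 E33]] := runs_append ok win5 Ev5.
exists m6; split.
  apply: runs_seq R1 (runs_seq R2 _); apply: (runs_if Hcond); rewrite Ed ?eqxx // => _.
  exact: runs_seq R3 (runs_seq R4 (runs_seq R5 R6)).
have EK : cnt (bset c K v) 0 K.+1 = cnt c 0 K + v := bset_cntS c K v.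
have Ev33 : cell p m5 0 33 = u + b - v * d by rewrite !cell_upd.
have Ev32 : cell p m5 0 32 = 0 by rewrite cell_upd.
exists (bset c K v), K.+1; rewrite E32 E33 Ev32 Ev33; split=> //.
- by rewrite Et' Ed mulSn addn0 addnC.
- by rewrite Pu' EK mulnDl -addnA subnKC.
move=> k; rewrite leq_eqVlt => /orP[/eqP ->|]; last by rewrite ltnS => Hk; rewrite bset_cnt ?cP'.
rewrite EK; have -> : K.+1 * d = pad + size (rcons s b) by rewrite Et' Ed mulSn addnC.
rewrite Pu' -(subnKC vu) addnA -mulnDl divnMDl // divn_small ?addn0 //.
by move: uv d0; clear; lia.
Qed.

End Window.

(** * Initial memory, sizes and space *)


Lemma base8E p : base p 8 = 40 + (par_N p %/ par_lw p).+1 + (par_N p %/ par_S p).+1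
  + par_M p + par_M p + par_M p + par_Hs p + par_Lsz p.
Proof. by rewrite !baseS base0. Qed.

Section Initial.

Variables (w : nat) (p : params).
Hypothesis ok : valid w p.

Local Notation N := (par_N p).

Definition memory0 : memory := header p ++ nseq (base p 8 - 32) 0.

Lemma base8_ge : 40 <= base p 8.
Proof. by have := @base_le p 1 8 isT; rewrite baseS base0. Qed.

Lemma cell0_header i : i < 32 -> cell p memory0 0 i = nth 0 (header p) i.
Proof. by move=> Hi; rewrite /cell base0 add0n nth_cat Hi. Qed.

Lemma cell0_zero k i : (0 < k) || (31 < i) -> cell p memory0 k i = 0.
Proof.
move=> H; have Hk : 32 <= base p k + i.
  case: k H => [|k] H; first by rewrite base0.
  apply: leq_trans (leq_addr _ _); apply: leq_trans (base_le p (isT : 1 <= k.+1)).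
  by rewrite baseS base0.
rewrite /cell nth_cat ifF ?nth_nseq ?if_same //.
by apply/negbTE; rewrite -leqNgt.
Qed.

Lemma wf_memory0 : wf p memory0.
Proof.
split; last by move=> i /andP[_ Hi]; rewrite cell0_header.
by rewrite size_cat size_nseq /= subnKC //; apply: leq_trans base8_ge.
Qed.

(** The empty stream is the padding alone, whose [N] chunk bits are all zero; therefore a zeroed
    memory after the header is already correct. *)
Lemma win_memory0 : win p memory0 (fun => false) N.
Proof.
have c0 s l : cnt (fun => false) s l = 0 by rewrite /cnt big1.
have f0 z F a : (forall j, a j = 0) -> fsum z F a = 0.
  by move=> Ha; rewrite /fsum big1 // => j _; rewrite Ha.
split=> //; first exact: wf_memory0.
- by rewrite cell0_zero // modnn.
- by rewrite cell0_zero // c0 mod0n.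
- exists (fun => false) => //; split=> //.
  + by move=> i _; rewrite cell0_zero // /bits f0.
  + by move=> i _; rewrite cell0_zero // /prefixes f0.
  + by move=> i _; rewrite cell0_zero // /prefixes f0.
  + by move=> i _; rewrite cell0_zero // c0.
- by move=> k _ _ _; rewrite cell0_zero // c0 mod0n.
exists (fun => 0), (fun => false), 0, false, 0.
by split; rewrite ?cell0_zero ?mod0n ?c0.
Qed.

Lemma rep_memory0 : rep p memory0 [::].
Proof.
have P0 x : pcount p [::] x = 0.
  rewrite /pcount /cnt big1 // => j _.
  by rewrite /padded cats0 nth_nseq if_same.
exists (fun => false), N; rewrite !cell0_zero // P0 /cnt big1 //; split=> //.
- exact: win_memory0.
- exact: d_gt0 ok.
by move=> k _; rewrite P0 div0n big1.
Qed.

Lemma ops_memory T : ctime update_cmd <= T -> ctime ssA_cmd <= T -> ctime issA_cmd <= T ->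
  forall d, par_d p <= d ->
  supports_operations w (par_n p) d T update_cmd ssA_cmd issA_cmd (rep p).
Proof.
move=> T1 T2 T3 d Hd M s HM.
have arg x : cell p (upd p M 0 0 x) 0 0 = x by rewrite cell_upd.
have E x : set_nth 0 M 0 x = upd p M 0 0 x by rewrite /upd base0.
have R0 m : nth 0 m 0 = cell p m 0 0 by rewrite /cell base0.
split.
- move=> b; have [M' [[t [Ht Ex]] Hr]] := runs_update ok (rep_arg ok b HM) (arg b).
  exists M', (nth 0 M' 0); split=> //; exists t; split=> //; first exact: leq_trans T1.
  by rewrite E.
- move=> i Hi; have [M' [[t [Ht Ex]] Hr Ha]] := runs_ssA ok (rep_arg ok i HM) (arg i) Hi.
  exists M', (nth 0 M' 0); split=> //.
    by exists t; split=> //; [exact: leq_trans T2 | rewrite E].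
  rewrite /ssA_answer R0; move: Ha Hd; clear; lia.
- move=> i Hi; have [M' [[t [Ht Ex]] Hr Ha]] := runs_issA ok (rep_arg ok i HM) (arg i) Hi Hd.
  exists M', (nth 0 M' 0); split=> //.
    by exists t; split=> //; [exact: leq_trans T3 | rewrite E].
  by rewrite R0.
Qed.

Lemma wf_memory0_words : par_z p < w -> wf_memory w memory0.
Proof.
move=> zw; rewrite /wf_memory all_cat; apply/andP; split; last first.
  by apply/allP => x /nseqP[-> _]; rewrite expn_gt0.
have LB := L_bound ok; have NB := N_bound ok; have tot := v_total ok.
have S0 := S_gt0 ok; have F0 := v_F ok; have b0 := v_b ok.
have SL : par_S p <= par_L p by rewrite leq_pmulr.
have bS : par_b p <= par_S p by rewrite leq_pmulr.
have FS : par_F p <= par_S p by rewrite leq_pmull.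
have dn : par_d p <= par_n p by case/andP: (v_d ok).
have big := v_big ok.
have wexp := ltn_expl w (isT : 1 < 2).
have zb : 2 ^ par_z p < 2 ^ w by rewrite ltn_exp2l.
have z1 : 2 ^ (par_z p).-1 <= 2 ^ par_z p by rewrite leq_exp2l // leq_pred.
have J1 : ones (par_z p) (par_F p) < 2 ^ w.
  apply: leq_trans (exp2_w (v_zF ok)); apply: fsum_lt => j _.
  by rewrite -{1}(expn0 2) ltn_exp2l // ltnW // (v_z ok).
have bw : (par_b p).+1 * par_b p < w.
  have b2 : 0 < (par_b p).+1 * par_b p by rewrite muln_gt0.
  by have := v_bw ok; move: b2; clear; lia.
have bbw : par_b p * par_b p < w by apply: leq_ltn_trans bw; rewrite mulSn leq_addl.
have b1w : par_b p < w.
  by apply: leq_ltn_trans bbw; rewrite leq_pmulr.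
have b2w : (par_b p).+1 < w.
  have := v_bw ok; move: b0; clear; move: (par_b p) => b; nia.
have ones_lt z : 0 < z -> z * par_b p < w -> ones z (par_b p) < 2 ^ w.
  move=> z0 zb'; apply: (@leq_trans (2 ^ (z * par_b p))); last by rewrite leq_exp2l // ltnW.
  by apply: fsum_lt => j _; rewrite -{1}(expn0 2) ltn_exp2l.
have ML := v_ML ok; have GL := v_GL ok; have Z2 := v_Z ok; have Ls0 := v_Ls ok.
have G_GL : par_G p <= par_Ls p * par_G p by rewrite leq_pmull.
have base_lt k : k <= 8 -> base p k < 2 ^ w.
  by move=> Hk; apply: leq_ltn_trans tot; apply: base_le.
have LszB : par_Lsz p <= base p 8 by rewrite baseS leq_addl.
have lwW := v_lw ok.
have mb : 2 ^ (par_b p).+1 - 1 < 2 ^ w.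
  by apply: leq_ltn_trans (leq_subr _ _) _; rewrite ltn_exp2l.
rewrite /header /=; do 32?[apply/andP; split] => //; rewrite ?mb ?base_lt ?ones_lt ?ltn_exp2l //;
  try by [move: b1w b2w zb z1 wexp LB NB SL bS FS dn big lwW tot LszB ML GL G_GL Z2 zw; clear; lia].
Qed.

End Initial.

(** * Choice of the sizes and the space bound *)

(* The width of the fields; all sizes are powers of it. *)
Definition width (w : nat) : nat := 2 ^ (trunc_log 2 w %/ 10).

(** Rounding the exponent [lg w] down to a multiple of 10 loses a factor below [2 ^ 10]; this is the
    source of every 1024 in the space bound. *)
Lemma width_bounds w : 0 < w -> width w ^ 10 <= w < 1024 * width w ^ 10.
Proof.
move=> w0; have := trunc_logP (isT : 1 < 2) w0; have := trunc_log_ltn w (isT : 1 < 2).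
set k := trunc_log 2 w => H1 H2; rewrite /width -/k -expnM; apply/andP; split.
  by apply: leq_trans H2; rewrite leq_exp2l // leq_trunc_div.
apply: leq_trans H1 _; rewrite -[1024]/(2 ^ 10) -expnD leq_exp2l //.
by have := divn_eq k 10; have := ltn_pmod k (isT : 0 < 10); clear; lia.
Qed.

Lemma leq_width v w : v <= w -> width v <= width w.
Proof. by move=> H; rewrite leq_exp2l // leq_div2r // leq_trunc_log. Qed.

Lemma width_large : exists w0, 80 <= w0 /\ forall w, w0 <= w -> 8 <= trunc_log 2 w %/ 10.
Proof.
exists (2 ^ 80); split; first exact: ltnW (ltn_expl _ _).
by move=> w Hw; rewrite (@leq_divRL _ _ 10) //; apply: trunc_log_max.
Qed.

(** This is [v_Lz] for [L = a ^ 22] and [z = a]. With [a = 2 ^ k] it says [22 * k + 1 < 2 ^ k],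
    which holds from [k = 8] on and fails before; hence words of at least [2 ^ 80] bits. *)
Lemma width_exp w : 8 <= trunc_log 2 w %/ 10 -> width w ^ 22 < 2 ^ (width w).-1.
Proof.
rewrite /width; move: (_ %/ 10) => k Hk; rewrite -expnM ltn_exp2l //.
suff : k * 22 + 1 < 2 ^ k by clear; lia.
rewrite -(subnK Hk); elim: (k - 8) => [|j IH] //.
by rewrite addSn expnS; move: IH; clear; lia.
Qed.

Lemma width_ge w : 8 <= trunc_log 2 w %/ 10 -> 256 <= width w.
Proof. by move=> H; rewrite -[256]/(2 ^ 8) leq_exp2l. Qed.

Lemma bitlen_lt n : n < 2 ^ bitlen n.
Proof. exact: trunc_log_ltn. Qed.

Lemma leq_bitlen m n : m <= n -> bitlen m <= bitlen n.
Proof. by move=> H; rewrite ltnS leq_trunc_log. Qed.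

(* A single block needs no directory: then all the ones form one group. *)
Definition parameters (n d w : nat) : params :=
  let a := width w in
  let d' := minn d n in
  let N := ceil_div n d' in
  let one := N <= a ^ 22 in
  let M := N.-1 %/ a ^ 22 + 1 in
  Params n d' N (a ^ 4) a (a ^ 9) (w %/ a ^ 4)
    (if one then N.+1 else a ^ 11)
    (if one then 1 else M + 2)
    (if one then 1 else (M + 2) * a ^ 11).

(** The divisor uses the length of [x] instead of [w], so that the bound depends on the number of
    chunks only. As [x <= n], the width taken from [w] is at least as large. *)
Definition overhead (x : nat) : nat := 16 * (1024 * (x %/ width (bitlen x))).

Lemma sublinear_overhead : sublinear overhead.
Proof.
(* The width is about the tenth root of the length of [x], so a doubly exponential [x] makes it at
   least [2 ^ (k * c)], which exceeds [k * c]. *)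
move=> k; rewrite /overhead; move: (16) (1024) => c1 c2; pose c := c1 * c2; exists (2 ^ (2 ^ (10 * (k * c)))) => x Hx.
have Hw : k * c <= width (bitlen x).
  apply: (@leq_trans (2 ^ (k * c))); first exact: ltnW (ltn_expl _ _).
  rewrite leq_exp2l // leq_divRL // mulnC; apply: trunc_log_max => //.
  by apply: leqW; apply: trunc_log_max.
rewrite !mulnA -[k * c1 * c2]mulnA; apply: leq_trans (leq_trunc_div x (width (bitlen x))).
by rewrite mulnC leq_mul2l Hw orbT.
Qed.

Lemma divn_mul_le N x y : N %/ (x * y) * x <= N %/ y.
Proof. by rewrite mulnC -[X in X <= _]mulnC [x * y]mulnC divnMA leq_trunc_div. Qed.

Section Sizes.

Variables (n d w w0 : nat).
Hypothesis n_gt0 : 0 < n.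
Hypothesis d_gt0 : 0 < d.
Hypothesis w0_ge : 80 <= w0.
Hypothesis w0P : forall v, w0 <= v -> 8 <= trunc_log 2 v %/ 10.
Hypothesis wP : w0 + bitlen n <= w.

Let p := parameters n d w.
Let a := width w.
Let N := par_N p.

Lemma w_gt0 : 0 < w.
Proof. by apply: leq_trans wP; rewrite addnS. Qed.

Lemma a_ge : 256 <= a.
Proof. by apply/width_ge/w0P; apply: leq_trans wP; exact: leq_addr. Qed.

Lemma w_range : a ^ 10 <= w < 1024 * a ^ 10.
Proof. exact: width_bounds w_gt0. Qed.

Lemma w_n : 1024 * n.+1 <= 2 ^ w.
Proof.
apply: (@leq_trans (2 ^ (10 + bitlen n))).
  by rewrite expnD leq_mul2l bitlen_lt.
by rewrite leq_exp2l //; apply: leq_trans wP; rewrite leq_add2r; apply: leq_trans w0_ge.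
Qed.

(** The error [d] may be too large for a word and is replaced by [minn d n]. The number of chunks
    does not change: both quotients are 1 as soon as [d >= n]. *)
Lemma par_NE : N = ceil_div n d.
Proof.
rewrite /N /= /minn; case: ltnP => // le; rewrite /ceil_div.
have E x : n <= x -> (n + x.-1) %/ x = 1.
  move=> Hx; have x0 : 0 < x by apply: leq_trans Hx.
  apply/eqP; rewrite eqn_leq leq_divRL // mul1n; apply/andP; split.
    by rewrite -ltnS ltn_divLR //; move: Hx n_gt0; clear; lia.
  by move: Hx n_gt0; clear; lia.
by rewrite !E.
Qed.

Lemma par_N_le : 0 < N <= n.
Proof.
have d'0 : 0 < minn d n by rewrite leq_min d_gt0.
rewrite /N /= /ceil_div; apply/andP; split.
  by rewrite divn_gt0 //; move: d'0 n_gt0 (geq_minr d n); clear; lia.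
rewrite -ltnS ltn_divLR // mulSn.
by have := leq_pmulr n d'0; move: d'0; clear; lia.
Qed.

Lemma par_SE : par_S p = a ^ 13.
Proof. by rewrite /par_S /= -expnD. Qed.

Lemma par_LE : par_L p = a ^ 22.
Proof. by rewrite /par_L par_SE /= -expnD. Qed.

Lemma par_ME : par_M p = N.-1 %/ a ^ 22 + 1.
Proof. by rewrite /par_M par_LE addn1. Qed.

Lemma a_pow k : 0 < a ^ k.
Proof. by rewrite expn_gt0; have := a_ge; case: (a). Qed.

Lemma M_le : par_M p <= N %/ a ^ 22 + 1.
Proof. by rewrite par_ME leq_add2r leq_div2r // leq_pred. Qed.

Lemma G_cases :
  [/\ N <= a ^ 22, par_M p = 1, par_G p = N.+1, par_Ls p = 1 & par_Lsz p = 1] \/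
  [/\ a ^ 22 < N, par_G p = a ^ 11, par_Ls p = par_M p + 2,
    par_Lsz p = par_Ls p * par_G p & par_Lsz p <= 4 * (N %/ a ^ 22) * a ^ 11].
Proof.
have EG : par_G p = if N <= a ^ 22 then N.+1 else a ^ 11 by [].
have EL : par_Ls p = if N <= a ^ 22 then 1 else N.-1 %/ a ^ 22 + 1 + 2 by [].
have EZ : par_Lsz p = if N <= a ^ 22 then 1 else (N.-1 %/ a ^ 22 + 1 + 2) * a ^ 11 by [].
rewrite EG EL EZ; have [le|gt] := leqP N (a ^ 22); [left | right].
  split=> //; rewrite par_ME divn_small //.
  by apply: leq_trans le; rewrite prednK //; case/andP: par_N_le.
split=> //; rewrite ?par_ME // leq_mul2r; apply/orP; right.
have := M_le; rewrite par_ME.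
have : 0 < N %/ a ^ 22 by rewrite divn_gt0 ?a_pow // ltnW.
by clear; move: (_ %/ _) (_ %/ _) => x y; lia.
Qed.

Lemma M_le_N : par_M p <= N.
Proof.
have /andP[N0 _] := par_N_le; have := leq_div N.-1 (a ^ 22); rewrite par_ME.
by move: N0; clear; lia.
Qed.

Lemma log_bounds : [/\ par_Lsz p <= 4 * N, par_Ls p * par_G p <= 4 * N,
  par_Ls p <= N + 2 & par_Z p <= 3 * N + 2].
Proof.
have /andP[N0 _] := par_N_le; have MN := M_le_N.
have dG := leq_trunc_div N (par_G p).
have Z3 : par_Z p <= N + 2 * par_G p by rewrite /par_Z /par_Hs mulnDl leq_add2r.
case: G_cases => [[le M1 G1 L1 L2]|[gt G1 L1 L2 L3]].
  rewrite L1 L2; split=> //; try by [move: N0; clear; lia].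
    by rewrite mul1n G1; move: N0; clear; lia.
  by rewrite /par_Z /par_Hs G1 divn_small // add0n; clear; lia.
have a11 : a ^ 11 <= a ^ 22 by rewrite leq_pexp2l //; have := a_ge; case: (a).
have Lsz4 : par_Lsz p <= 4 * N.
  apply: leq_trans L3 _; rewrite -mulnA leq_mul2l /=.
  by apply: leq_trans (leq_trunc_div N (a ^ 22)); rewrite leq_mul2l a11 orbT.
split=> //; first by rewrite -L2.
  by rewrite L1 leq_add2r.
have GN : a ^ 11 <= N by apply: leq_trans a11 (ltnW gt).
by rewrite G1 in Z3; move: Z3 GN; clear; move: (a ^ 11) => y; lia.
Qed.

Lemma base8_le : base p 8 <= 10 * N + 50.
Proof.
have /andP[N0 _] := par_N_le; have MN := M_le_N; have [L1 _ _ _] := log_bounds.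
have := leq_div N (par_lw p); have := leq_div N (par_S p); have := leq_div N (par_G p).
rewrite base8E /par_Hs -/N; move: (N %/ _) (N %/ _) (N %/ _) => x1 x2 x3.
by move: N0 MN L1; clear; lia.
Qed.

Lemma valid_parameters : valid w p.
Proof.
have a256 := a_ge; have /andP[w1 w2] := w_range; have wn := w_n.
have /andP[N0 Nn] := par_N_le; have MN := M_le_N; have [L1 L2 L3 L4] := log_bounds.
have B8 := base8_le.
have a1 : 0 < a by apply: leq_trans a256.
have Pow k l : k <= l -> a ^ k <= a ^ l by move=> H; rewrite leq_pexp2l.
split.
- by rewrite leq_min d_gt0 n_gt0 geq_minr.
- by [].
- exact: a_pow.
- exact: a_pow.
- by apply: leq_trans a256.
- by rewrite /= divn_gt0 ?a_pow //; apply: leq_trans w1; exact: Pow.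
- exact: leq_trunc_div.
- by rewrite /= -/a -expnS.
- by rewrite par_LE; apply/width_exp/w0P; apply: leq_trans wP; exact: leq_addr.
- rewrite /= -/a; apply: leq_trans w1.
  have -> : a ^ 10 = a ^ 8 * (a * a) by rewrite (expnD a 8 2).
  have E8 : a ^ 8 = a ^ 4 * a ^ 4 by rewrite -expnD.
  have aa : 4 <= a * a by apply: (@leq_trans (4 * 1)); rewrite ?leq_mul // (leq_trans _ a256).
  have p4 : a ^ 4 <= a ^ 8 by exact: Pow.
  apply: (@leq_trans (a ^ 8 * 4)); last by rewrite leq_mul2l aa orbT.
  have -> : (a ^ 4).+1 * a ^ 4 = a ^ 4 + a ^ 8 by rewrite mulSn E8.
  by move: p4; clear; move: (a ^ 4) (a ^ 8) => x y; lia.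
- by case: G_cases => [[_ _ -> _ _]|[_ -> _ _ _]] //; exact: a_pow.
- by case: G_cases => [[_ _ _ -> _]|[_ _ -> _ _]] //; rewrite addn2.
- case: G_cases => [[_ _ _ _ -> //]|[_ G1 L1' -> _]].
  by rewrite muln_gt0 L1' G1 a_pow addn2.
- by case: G_cases => [[_ -> _ _ _]|[_ _ ? ? _]].
- by move: B8 Nn wn; clear; lia.
- by rewrite /=; move: wn n_gt0; clear; lia.
- by move: L4 Nn wn; clear; lia.
- by move: L2 Nn wn; clear; lia.
- by move: MN L3 Nn wn; clear; lia.
Qed.

(** The 48 words are the 40 cells of region 0 and 8 lost to rounding: one each for regions 1 and 2,
    one per block array, two for the entries, one for the log. The remaining overhead is ten shares
    of [1024 * (N %/ a)], bounded by 16. *)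
Lemma space_bound : base p 8 * w <= N + 16 * (1024 * (N %/ a)) + 48 * w.
Proof.
have a256 := a_ge; have /andP[w1 w2] := w_range.
have a1 : 0 < a by apply: leq_trans a256.
have /andP[N0 Nn] := par_N_le.
have wle : w <= 1024 * a ^ 10 by exact: ltnW.
(* A word charged to [a ^ 11] bits of the array: as [w <= 1024 * a ^ 10], its cost per bit is at
   most [1024 / a]. *)
have per x : x * a ^ 11 <= N -> x * w <= 1024 * (N %/ a).
  move=> Hx; apply: (@leq_trans (x * (1024 * a ^ 10))); first by rewrite leq_mul2l wle orbT.
  rewrite mulnCA leq_mul2l /= leq_divRL // -mulnA -expnSr //.
have per_div k : 11 <= k -> N %/ a ^ k * w <= 1024 * (N %/ a).
  move=> Hk; apply: per; apply: leq_trans (leq_trunc_div N (a ^ k)).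
  by rewrite leq_mul2l leq_pexp2l ?orbT.
have b0 := a_pow 4.
(* Each word of the bit array wastes fewer than [a ^ 4] bits, less than one leaf, and holds at least
   [a] leaves. *)
have lwb : N %/ par_lw p * w <= N + N %/ a.
  have lE : a <= w %/ a ^ 4.
    rewrite leq_divRL // -expnS; apply: leq_trans w1; by rewrite leq_pexp2l.
  have -> : w = par_lw p + w %% a ^ 4 by exact: divn_eq.
  rewrite mulnDr leq_add ?leq_trunc_div //.
  apply: leq_trans (leq_div2l N a1 lE).
  apply: leq_trans (divn_mul_le N (a ^ 4) (w %/ a ^ 4)).
  by rewrite /par_lw /= -/a [a ^ 4 * _]mulnC leq_mul2l ltnW ?orbT // ltn_pmod.
have Sb : N %/ par_S p * w <= 1024 * (N %/ a) by rewrite par_SE; exact: per_div.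
have Mb : par_M p * w <= 1024 * (N %/ a) + w.
  apply: (@leq_trans ((N %/ a ^ 22 + 1) * w)); first by rewrite leq_mul2r M_le orbT.
  by rewrite mulnDl mul1n leq_add2r per_div.
have Hb : par_Hs p * w <= 1024 * (N %/ a) + 2 * w.
  rewrite /par_Hs -/N mulnDl leq_add2r; case: G_cases => [[_ _ -> _ _]|[_ -> _ _ _]].
    by rewrite divn_small.
  exact: per_div.
have Lb : par_Lsz p * w <= 4 * (1024 * (N %/ a)) + w.
  case: G_cases => [[_ _ _ _ ->]|[gt _ _ _ L3]]; first by rewrite mul1n leq_addl.
  apply: leq_trans (leq_addr _ _); apply: (@leq_trans (4 * (N %/ a ^ 22) * a ^ 11 * w)).
    by rewrite leq_mul2r L3 orbT.
  have := per (N %/ a ^ 22 * a ^ 11).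
  rewrite -mulnA -expnD => /(_ (leq_trunc_div _ _)).
  by rewrite -!mulnA leq_mul2l.
have N1024 : N %/ a <= 1024 * (N %/ a) by rewrite leq_pmull.
rewrite base8E -/N; move: N1024 lwb Sb Mb Hb Lb.
move: (N %/ par_lw p) (N %/ par_S p) (par_M p) (par_Hs p) (par_Lsz p) (N %/ a) (1024 * _).
move=> x1 x2 x3 x4 x5 x6 y.
have -> : (40 + x1.+1 + x2.+1 + x3 + x3 + x3 + x4 + x5) * w =
    x1 * w + x2 * w + 3 * (x3 * w) + x4 * w + x5 * w + 42 * w 
  by rewrite !mulnDl (mulSn x1) (mulSn x2); move: (x1 * w) (x2 * w) (x3 * w) (x4 * w) (x5 * w); clear; lia.
move: (x1 * w) (x2 * w) (x3 * w) (x4 * w) (x5 * w) => y1 y2 y3 y4 y5; clear; lia.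
Qed.

End Sizes.

(* The words have Theta(lg n) bits: between lg n + O(1) and c * lg n, for an
   arbitrary c.  The programs and the constants are uniform in n, d and w. *)
Theorem theorem7 :
  exists w0 : nat, forall c : nat,
  exists (update ssA issA : cmd) (T C : nat) (f : nat -> nat),
    sublinear f /\
    forall n d w : nat,
      0 < n -> 0 < d -> w0 + bitlen n <= w <= c * bitlen n ->
      exists (M0 : memory) (Rep : memory -> stream -> Prop),
        [/\ 0 < size M0,
            wf_memory w M0,
            size M0 * w <= ceil_div n d + C * bitlen n + f (ceil_div n d),
            Rep M0 [::]
          & supports_operations w n d T update ssA issA Rep].
Proof.
have [w0 [w0_ge w0P]] := width_large; exists w0 => c.
exists update_cmd, ssA_cmd, issA_cmd, (ctime update_cmd + ctime ssA_cmd + ctime issA_cmd), (48 * c), overhead.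
split; first exact: sublinear_overhead.
move=> n d w n0 d0 /andP[wP wc].
have ok := valid_parameters n0 d0 w0_ge w0P wP.
set p := parameters n d w in ok *.
exists (memory0 p), (rep p).
have sz : size (memory0 p) = base p 8 by case: (wf_memory0 p).
split.
- by rewrite sz; apply: leq_trans (base8_ge p).
- apply: (wf_memory0_words ok) => /=.
  have /andP[w1 _] := w_range wP.
  have a256 := a_ge w0P wP.
  apply: leq_trans w1; rewrite expnS -[X in X < _]muln1 ltn_mul2l.
  by rewrite (leq_trans _ a256) //= -(exp1n 9) ltn_exp2r // (leq_trans _ a256).
- rewrite sz; apply: leq_trans (space_bound n0 d0 w0P wP) _.
  rewrite (par_NE d w n0); set x := ceil_div n d.
  have xn : x <= n by rewrite /x -(par_NE d w n0); case/andP: (par_N_le w n0 d0).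
  have H1 : 16 * (1024 * (x %/ width w)) <= overhead x.
    rewrite /overhead; apply: leq_mul => //; apply: leq_mul => //; apply: leq_div2l.
      by rewrite expn_gt0.
    by apply: leq_width; apply: leq_trans (leq_bitlen xn) (leq_trans (leq_addl _ _) wP).
  have H2 : 48 * w <= 48 * c * bitlen n by rewrite -mulnA leq_mul2l wc.
  move: H1 H2; move: (overhead x) (16 * (1024 * _)) (48 * w) (48 * c * _) => y1 y2 y3 y4.
  by clear; lia.
- exact: rep_memory0 ok.
- apply: (ops_memory ok); last exact: geq_minl.
  + by rewrite -addnA; exact: leq_addr.
  + by rewrite addnAC; exact: leq_addl.
  + exact: leq_addl.
Qed.
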